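(* Let $X$ be a locally compact Hadamard space and let $G$ be a totally disconnected topological group acting continuously, properly and cocompactly by isometries on $X$. Let $\Gamma$ be a finitely generated simple subgroup of $G$. If $\Gamma$ is contained in an amenable subgroup of $G$, then $\Gamma$ is finite.
   Context: A Hadamard space is a complete $\mathrm{CAT}(0)$ space. The action of $G$ on $X$ is proper if for every compact $C \subset X$ the set $\{g \in G : gC \cap C \neq \varnothing\}$ is compact (in particular $G$ is then locally compact); it is cocompact if $X/G$ is compact. Here $\Gamma$ is finitely generated and simple as an abstract group. A (not necessarily closed) subgroup of $G$ is amenable if, endowed with the induced topology, every continuous affine action of it on a nonempty compact convex subset of a locally convex Hausdorff topological vector space has a fixed point. *)

(* Defs.v *)
From HB Require Import structures.
From mathcomp Require Import all_boot all_order all_algebra.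
From mathcomp Require Import all_classical all_reals all_analysis.

Set Implicit Arguments.
Unset Strict Implicit.
Unset Printing Implicit Defensive.

Import Order.TTheory GRing.Theory Num.Theory.
Import numFieldNormedType.Exports.

Local Open Scope classical_set_scope.
Local Open Scope quotient_scope.
Local Open Scope ring_scope.

(* The library's [Complete] includes a distinguished point, so these spaces are
   nonempty. *)
#[short(type="completeMetricType")]
HB.structure Definition CompleteMetric (R : numDomainType) :=
  {T of Complete T & Metric R T}.

HB.structure Definition PreTopologicalGroup := {G of Topological G & Group G}.

HB.mixin Record PreTopologicalGroup_isTopologicalGroup G
    of PreTopologicalGroup G := {
  mulg_continuous : continuous (fun p : G * G => (p.1 * p.2)%g) ;
  invg_continuous : continuous (fun g : G => (g^-1)%g)
}.

#[short(type="topologicalGroupType")]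
HB.structure Definition TopologicalGroup :=
  {G of PreTopologicalGroup G & PreTopologicalGroup_isTopologicalGroup G}.

Section CAT0.
Context {R : realType}.

(* Matrix types carry the sup norm in the library, hence an explicit Euclidean
   distance. *)
Definition edist (u v : 'rV[R]_2) : R :=
  Num.sqrt (\sum_(i < 2) (u 0 i - v 0 i) ^+ 2).

Definition geodesic_segment (X : metricType R) (x y : X) (S : set X) : Prop :=
  exists c : R -> X,
    [/\ c 0 = x, c (mdist x y) = y,
        {in `[0, mdist x y] &, forall s t, mdist (c s) (c t) = `|s - t|} &
        S = c @` `[0, mdist x y]].

Definition geodesic_space (X : metricType R) : Prop :=
  forall x y : X, exists S, geodesic_segment x y S.

Definition comparison_point (X : metricType R) (p x : X)
    (p' q' x' : 'rV[R]_2) : Prop :=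
  (exists2 t : R, t \in `[0, 1] & x' = (1 - t) *: p' + t *: q') /\
  edist p' x' = mdist p x.

(* A geodesic triangle has vertices [v i] and sides [S i] from [v i] to
   [v (ordS i)], where [ordS] is the cyclic successor on ['I_3]. *)
Definition CAT0_space (X : metricType R) : Prop :=
  geodesic_space X /\
  forall (v : 'I_3 -> X) (S : 'I_3 -> set X) (v' : 'I_3 -> 'rV[R]_2),
    (forall i, geodesic_segment (v i) (v (ordS i)) (S i)) ->
    (forall i j, edist (v' i) (v' j) = mdist (v i) (v j)) ->
    forall (i j : 'I_3) (x y : X) (x' y' : 'rV[R]_2),
      S i x -> S j y ->
      comparison_point (v i) x (v' i) (v' (ordS i)) x' ->
      comparison_point (v j) y (v' j) (v' (ordS j)) y' ->
      mdist x y <= edist x' y'.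

End CAT0.

Section Subgroups.
Local Open Scope group_scope.
Context {G : groupType}.

Definition subgroup (H : set G) : Prop :=
  H 1 /\ forall x y, H x -> H y -> H (x / y).

Definition finitely_generated (H : set G) : Prop :=
  exists2 A : set G, finite_set A & H = smallest subgroup A.

Definition simple_subgroup (H : set G) : Prop :=
  [/\ subgroup H, H <> [set 1] &
      forall N : set G, subgroup N -> N `<=` H ->
        (forall n h, N n -> H h -> N (n ^ h)) ->
        N = [set 1] \/ N = H].

End Subgroups.

Section Actions.

Record group_action (G : groupType) (X : Type) := GroupAction {
  act :> G -> X -> X;
  act1 : forall x, act 1%g x = x;
  actM : forall g h x, act (g * h)%g x = act g (act h x)
}.

Definition isometric_action (R : realType) (G : groupType) (X : metricType R)
    (a : group_action G X) : Prop :=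
  forall g x y, mdist (a g x) (a g y) = mdist x y.

Definition continuous_action (G : topologicalGroupType) (X : topologicalType)
    (a : group_action G X) : Prop :=
  continuous (fun p : G * X => a p.1 p.2).

Definition proper_action (G : topologicalGroupType) (X : topologicalType)
    (a : group_action G X) : Prop :=
  forall C : set X, compact C -> compact [set g | (a g @` C) `&` C !=set0].

Section Orbits.
Context {G : groupType} {X : choiceType} (a : group_action G X).

Definition orbit_rel : rel X := fun x y => `[< exists g, y = a g x >].

Lemma orbit_rel_refl : reflexive orbit_rel.
Proof. by move=> x; apply/asboolP; exists 1%g; rewrite act1. Qed.

Lemma orbit_rel_sym : symmetric orbit_rel.
Proof.
by move=> x y; apply/asbool_equiv_eq; split=> -[g ->]; exists g^-1%g;
  rewrite -actM mulVg act1.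
Qed.

Lemma orbit_rel_trans : transitive orbit_rel.
Proof.
move=> y x z /asboolP[g ->] /asboolP[h ->]; apply/asboolP.
by exists (h * g)%g; rewrite actM.
Qed.

Definition orbit_equiv : equiv_rel X :=
  EquivRel orbit_rel orbit_rel_refl orbit_rel_sym orbit_rel_trans.

End Orbits.

Definition orbit_space (G : groupType) (X : topologicalType)
    (a : group_action G X) : topologicalType :=
  quotient_topology {eq_quot orbit_equiv a}.

Definition cocompact_action (G : groupType) (X : topologicalType)
    (a : group_action G X) : Prop :=
  compact [set: orbit_space a].

End Actions.

(* A continuous affine action of the subgroup [H] (with the induced topology) on
   the convex set [K]; the values of [b] off [H `*` K] are irrelevant. *)
Definition continuous_affine_action (R : realType) (G : topologicalGroupType)
    (E : tvsType R) (H : set G) (K : set E) (b : G -> E -> E) : Prop :=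
  [/\ forall h x, H h -> K x -> K (b h x),
      forall x, K x -> b 1%g x = x,
      forall g h x, H g -> H h -> K x -> b (g * h)%g x = b g (b h x),
      forall h x y (t : R), H h -> K x -> K y -> t \in `[0, 1] ->
        b h (t *: x + (1 - t) *: y) = t *: b h x + (1 - t) *: b h y &
      {within H `*` K, continuous (fun p : G * E => b p.1 p.2)}].

Definition amenable_subgroup (R : realType) (G : topologicalGroupType)
    (H : set G) : Prop :=
  subgroup H /\
  forall (E : tvsType R) (K : set E) (b : G -> E -> E),
    hausdorff_space E -> K !=set0 -> compact K -> convex_set K ->
    continuous_affine_action H K b ->
    exists2 x, K x & forall h, H h -> b h x = x.

(* Main.v *)
From HB Require Import structures.
Require Import Defs.
From mathcomp Require Import all_boot all_order all_algebra all_field.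
From mathcomp Require Import all_classical all_reals all_analysis.
From mathcomp Require Import ring lra.

(* Suppose that Gamma is infinite. For k >= 0 consider the complete CAT(0)
   spaces Y with an isometric action of H such that the finite configurations
   of Y x R^k occur in X up to small errors and every point of Y is moved by
   at least eps by some generator of Gamma. For k = 0 one can take Y = X: if
   the generators had arbitrarily small displacement, then conjugates of Gamma
   would fix cosets of small compact open subgroups of the totally
   disconnected group G, because an infinite simple group has no nontrivial
   finite quotient. As X has uniformly bounded geometry, k is bounded; so it
   suffices to pass from k to k + 1.

   An H-equivariant nonexpansive flow moving along geodesic rays becomes, in a
   direct limit of Y, a one-parameter group of Clifford translations, hence
   splits off a line, and the quotient by this line serves for k + 1. Such
   flows arise by going to infinity along projections to a decreasing family
   of invariant convex sets, or along the resolvents of a convex function that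
   H changes by constants only. So assume that Y is minimal. Amenability gives
   a fixed point f (up to constants) in the closed convex hull of the
   normalized distance functions, and one may assume that f is constant.
   Then some ultrafilter on Y makes all distance functions affine in the limit,
   and the geodesics towards it define an isometric flow. By minimality such
   flows are surjective, hence Y has Clifford translations. H normalizes a
   maximal group R^m of these, and Gamma commutes with it, since linear
   representations of Gamma are trivial by Malcev's theorem. The quotient of Y
   by R^m is the space required for k + 1. *)

Set Implicit Arguments.
Unset Strict Implicit.
Unset Printing Implicit Defensive.

Import Order.TTheory GRing.Theory Num.Theory.
Import numFieldNormedType.Exports.

Local Open Scope classical_set_scope.
Local Open Scope ring_scope.

(** * Complete CAT(0) pseudometric spaces *)

Section Hadamard.
Context {R : realType}.

Section Def.
Variables (Y : Type) (d : Y -> Y -> R).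

(** Spaces carry pseudometrics, so that direct limits and quotients by translations identify points
    by giving them distance 0. The new spaces need not embed into X, nor need their actions be
    proper or cocompact. Finite configurations up to small errors are what survives limits,
    completions and quotients; they transfer the packing bounds of X, which provide all ultralimits
    and bound the dimension. Amenability belongs to H and simplicity to Gamma, so H acts on every
    space, whereas only generators of Gamma have to move points. The bound eps could be lost when
    R^m is divided out; the lost part of the displacement is a homomorphism from Gamma to R^m, and
    these are trivial. The obstacle in using amenability is that the hull of the distance functions
    may contain a constant, which gives no direction to flow in. This cancellation is itself a sign
    of flatness: the convexity defects of distance functions are nonnegative, so if they average to
    0, then any finitely many of them are small at a common point. *)

Record pseudometric : Prop := Pseudometric {
  pm_refl : forall x, d x x = 0;
  pm_sym : forall x y, d x y = d y x;
  pm_tri : forall x y z, d x z <= d x y + d y z }.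

Definition cauchy_seq (u : nat -> Y) := forall e, 0 < e ->
  exists N, forall m n, (N <= m)%N -> (N <= n)%N -> d (u m) (u n) < e.

Definition converges_to (u : nat -> Y) (y : Y) := forall e, 0 < e ->
  exists N, forall n, (N <= n)%N -> d (u n) y < e.

(** [hd_cn] is the inequality of Bruhat and Tits for every ratio [t]; in Euclidean space it is an
    equality, Stewart's theorem. It speaks of distances only, which suits limits. *)
Record hadamard : Prop := Hadamard {
  hd_pm : pseudometric;
  hd_cn : forall x y t, 0 <= t <= 1 -> exists p, forall z,
    d z p ^+ 2 <= (1 - t) * d z x ^+ 2 + t * d z y ^+ 2
                  - t * (1 - t) * d x y ^+ 2;
  hd_cpl : forall u, cauchy_seq u -> exists y, converges_to u y }.

(** A packing bound: [N] depends on [rho] and [r] but not on the place in [Y], so it passes to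
    spaces whose finite configurations occur in [Y] up to small errors. *)
Definition uniformly_bounded_geometry := forall rho r, 0 < r ->
  exists N : nat, forall p : nat -> Y,
    (forall i j, (i < N)%N -> (j < N)%N -> d (p i) (p j) <= rho) ->
    exists i j, [/\ (i < j)%N, (j < N)%N & d (p i) (p j) < r].

End Def.

Section PM.
Variables (Y : Type) (d : Y -> Y -> R).
Hypothesis pm : pseudometric d.

Lemma pm_ge0 x y : 0 <= d x y.
Proof.
have := pm_tri pm x y x; rewrite (pm_refl pm) (pm_sym pm y x).
by move=> ?; lra.
Qed.

Lemma pm_tri4 x y z t : d x t <= d x y + d y z + d z t.
Proof. by have := pm_tri pm x y t; have := pm_tri pm y z t; lra. Qed.

Lemma pm_eq0l x y z : d x y = 0 -> d x z = d y z.
Proof.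
move=> xy; apply/le_anti/andP; split.
  by have := pm_tri pm x y z; rewrite xy add0r.
by have := pm_tri pm y x z; rewrite (pm_sym pm y x) xy add0r.
Qed.

Lemma pm_eq0r x y z : d x y = 0 -> d z x = d z y.
Proof. by move=> xy; rewrite !(pm_sym pm z) (pm_eq0l _ xy). Qed.

Lemma pm_dist x y z : `|d x z - d y z| <= d x y.
Proof.
rewrite ler_norml; have := pm_tri pm x y z; have := pm_tri pm y x z.
by rewrite (pm_sym pm y x) => *; apply/andP; split; lra.
Qed.

Lemma pm_eq0_le x y : (forall e, 0 < e -> d x y <= e) -> d x y = 0.
Proof.
move=> h; apply/le_anti/andP; split; last exact: pm_ge0.
by apply/ler_addgt0Pr => e /h; rewrite add0r.
Qed.

End PM.

Lemma le_of_sqr (a b : R) : 0 <= b -> a ^+ 2 <= b ^+ 2 -> a <= b.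
Proof.
move=> b0 ab; have [a0|a0] := leP 0 a; last by lra.
by rewrite -(@ler_pXn2r R 2%N) // nnegrE.
Qed.

Section HD.
Variables (Y : Type) (d : Y -> Y -> R).
Hypothesis hd : hadamard d.
Let pm := hd_pm hd.

(** Chosen from [hd_cn], hence determined only up to distance 0; outside the unit interval the value
    is [x]. *)
Definition geo (x y : Y) (t : R) : Y :=
  match pselect (0 <= t <= 1) with
  | left t01 => projT1 (cid (hd_cn hd x y t01))
  | right _ => x
  end.

Lemma geo_cn x y t z : 0 <= t <= 1 ->
  d z (geo x y t) ^+ 2 <= (1 - t) * d z x ^+ 2 + t * d z y ^+ 2
                          - t * (1 - t) * d x y ^+ 2.
Proof.
move=> t01; rewrite /geo; case: pselect => // t01'.
by case: cid => p /= /(_ z).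
Qed.

Lemma geo_lr x y t : 0 <= t <= 1 ->
  d x (geo x y t) = t * d x y /\ d (geo x y t) y = (1 - t) * d x y.
Proof.
move=> /andP[t0 t1]; set p := geo x y t.
have hx : d x p <= t * d x y.
  apply: le_of_sqr; first by apply: mulr_ge0 => //; exact: pm_ge0.
  have := @geo_cn x y t x; rewrite t0 t1 => /(_ isT); rewrite -/p.
  by rewrite (pm_refl pm); set D := d x y; set E := d x p => *; nra.
have hy : d p y <= (1 - t) * d x y.
  apply: le_of_sqr; first by apply: mulr_ge0; [lra|exact: pm_ge0].
  have := @geo_cn x y t y; rewrite t0 t1 => /(_ isT); rewrite -/p.
  rewrite (pm_refl pm) (pm_sym pm y p) (pm_sym pm y x).
  by set D := d x y; set E := d p y => *; nra.
by have := pm_tri pm x p y; split; lra.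
Qed.

Lemma geo_l x y t : 0 <= t <= 1 -> d x (geo x y t) = t * d x y.
Proof. by case/(geo_lr x y). Qed.

Lemma geo_r x y t : 0 <= t <= 1 -> d (geo x y t) y = (1 - t) * d x y.
Proof. by case/(geo_lr x y). Qed.

Lemma geo_uniq x y t p : 0 <= t <= 1 ->
  d x p <= t * d x y -> d p y <= (1 - t) * d x y -> d p (geo x y t) = 0.
Proof.
move=> t01 hx hy.
have := geo_cn x y p t01; move: (t01) => /andP[t0 t1].
rewrite (pm_sym pm p x).
have := pm_ge0 pm x p; have := pm_ge0 pm p y; have := pm_ge0 pm x y.
have g0 := pm_ge0 pm p (geo x y t).
set D := d x y in hx hy *; set E := d x p in hx *; set F := d p y in hy *.
set r := d p _ in g0 * => D0 F0 E0 h.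
have h1 : E ^+ 2 <= (t * D) ^+ 2 by rewrite ler_pXn2r ?nnegrE ?mulr_ge0.
have h2 : F ^+ 2 <= ((1 - t) * D) ^+ 2.
  by rewrite ler_pXn2r ?nnegrE ?mulr_ge0 //; lra.
have : r ^+ 2 <= 0.
  apply: le_trans h _.
  have := ler_wpM2l t0 h2; have : 0 <= 1 - t by lra.
  by move=> /ler_wpM2l/(_ _ _ h1); lra.
by move=> r2; apply/eqP; rewrite -sqrf_eq0; apply/eqP/le_anti; rewrite r2 sqr_ge0.
Qed.

Lemma geo_dist_common x y y' t : 0 <= t <= 1 ->
  d (geo x y t) (geo x y' t) <= t * d y y'.
Proof.
move=> t01; have /andP[t0 t1] := t01.
apply: le_of_sqr; first by rewrite mulr_ge0 ?pm_ge0.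
have h1 := @geo_cn x y' t (geo x y t) t01.
have h2 := @geo_cn x y t y' t01.
rewrite (pm_sym pm (geo x y t) x) geo_l // in h1.
rewrite (pm_sym pm y' (geo x y t)) (pm_sym pm y' x) (pm_sym pm y' y) in h2.
set r := d (geo x y t) (geo x y' t) in h1 *.
move: (d (geo x y t) y') (d x y) (d x y') (d y y') h1 h2 => a b c e h1 h2.
by have := ler_wpM2l t0 h2; lra.
Qed.

Lemma geo_sym x y t : 0 <= t <= 1 -> d (geo x y t) (geo y x (1 - t)) = 0.
Proof.
move=> t01; have t01' : 0 <= 1 - t <= 1 by case/andP: t01 => *; apply/andP; split; lra.
apply: geo_uniq => //.
  by rewrite (pm_sym pm y) geo_r // (pm_sym pm y x).
by rewrite (pm_sym pm _ x) geo_l // (pm_sym pm y x); lra.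
Qed.

Lemma geo_dist x y x' y' t : 0 <= t <= 1 ->
  d (geo x y t) (geo x' y' t) <= (1 - t) * d x x' + t * d y y'.
Proof.
move=> t01; have t01' : 0 <= 1 - t <= 1 by case/andP: t01 => *; apply/andP; split; lra.
have h1 := @geo_dist_common x y y' t t01.
have h2 := @geo_dist_common y' x x' (1 - t) t01'.
rewrite -(pm_eq0l pm _ (geo_sym x y' t01)) in h2.
rewrite -(pm_eq0r pm _ (geo_sym x' y' t01)) in h2.
by have := pm_tri pm (geo x y t) (geo x y' t) (geo x' y' t); lra.
Qed.

Lemma geo_congr x y x' y' t : 0 <= t <= 1 -> d x x' = 0 -> d y y' = 0 ->
  d (geo x y t) (geo x' y' t) = 0.
Proof.
move=> t01 xx yy; apply/le_anti/andP; split; last exact: pm_ge0.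
by have := geo_dist x y x' y' t01; rewrite xx yy; lra.
Qed.

Lemma geo_map (f : Y -> Y) x y t :
  (forall u v, d (f u) (f v) = d u v) -> 0 <= t <= 1 ->
  d (f (geo x y t)) (geo (f x) (f y) t) = 0.
Proof.
by move=> fi t01; apply: geo_uniq => //; rewrite !fi ?geo_l ?geo_r.
Qed.

Lemma geo_comp x y a b : 0 <= a <= 1 -> 0 <= b <= 1 ->
  d (geo (geo x y a) y b) (geo x y (a + b * (1 - a))) = 0.
Proof.
move=> a01 b01; have [[a0 a1] [b0 b1]] := (andP a01, andP b01).
have ab : 0 <= a + b * (1 - a) <= 1.
  by apply/andP; split; nra.
have dr := geo_r x y a01; have dl := geo_l x y a01.
apply: geo_uniq => //.
  apply: le_trans (pm_tri pm x (geo x y a) _) _.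
  by rewrite dl geo_l // dr; nra.
by rewrite geo_r // dr; nra.
Qed.

(* Reshetnyak/Berg-Nikolaev quadrilateral inequality *)
Lemma quadrilateral x x' z z' :
  d x z' ^+ 2 + d x' z ^+ 2 <=
  d x z ^+ 2 + d x' z' ^+ 2 + 2 * d x x' * d z z'.
Proof.
(* The point [p] at ratio [t] between [x] and [z'] gives a weighted form of the inequality; the best
   weight is [d x x' / (d x x' + d z z')]. *)
have weak t : 0 < t < 1 ->
    d x z' ^+ 2 + d x' z ^+ 2 <= d x z ^+ 2 + d x' z' ^+ 2
      + (1 - t) / t * d x x' ^+ 2 + t / (1 - t) * d z z' ^+ 2.
  move=> /andP[t0 t1]; have t01 : 0 <= t <= 1 by apply/andP; split; lra.
  set p := geo x z' t.
  have h1 := geo_cn x z' x' t01; have h2 := geo_cn x z' z t01.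
  have tr := pm_tri pm x' p z.
  rewrite -/p (pm_sym pm x' x) in h1; rewrite -/p (pm_sym pm z x) in h2.
  rewrite (pm_sym pm p z) in tr.
  have := pm_ge0 pm x' z; have := pm_ge0 pm x' p; have := pm_ge0 pm z p.
  move: (d x' p) (d z p) (d x' z) (d x x') (d x' z') (d x z') (d z z') (d x z)
    h1 h2 tr => P Q a A B C E F h1 h2 tr Q0 P0 a0.
  have h3 : a ^+ 2 <= P ^+ 2 / t + Q ^+ 2 / (1 - t).
    have : a ^+ 2 <= (P + Q) ^+ 2 by rewrite ler_pXn2r ?nnegrE ?addr_ge0.
    move=> /le_trans; apply; rewrite -subr_ge0.
    have -> : P ^+ 2 / t + Q ^+ 2 / (1 - t) - (P + Q) ^+ 2 =
              ((1 - t) * P - t * Q) ^+ 2 / (t * (1 - t)).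
      by field; rewrite !gt_eqF //; lra.
    by rewrite divr_ge0 ?sqr_ge0 // mulr_ge0; lra.
  have h1' : P ^+ 2 / t <= (1 - t) / t * A ^+ 2 + B ^+ 2 - (1 - t) * C ^+ 2.
    rewrite ler_pdivrMr //; apply: le_trans h1 _; rewrite le_eqVlt; apply/orP; left.
    by apply/eqP; field; rewrite gt_eqF.
  have h2' : Q ^+ 2 / (1 - t) <= F ^+ 2 + t / (1 - t) * E ^+ 2 - t * C ^+ 2.
    have u0 : 0 < 1 - t by lra.
    rewrite ler_pdivrMr //; apply: le_trans h2 _; rewrite le_eqVlt; apply/orP; left.
    by apply/eqP; field; rewrite gt_eqF.
  by lra.
have A0 := pm_ge0 pm x x'; have E0 := pm_ge0 pm z z'.
move: (d x x') (d z z') A0 E0 weak => A E A0 E0 weak.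
apply/ler_addgt0Pr => e e0.
(* [k] keeps both parts of the weight positive when a distance vanishes. *)
pose k := e / (1 + A + E).
have k0 : 0 < k by rewrite divr_gt0 //; lra.
pose a := A + k; pose b := E + k.
have a0 : 0 < a by rewrite /a; lra.
have b0 : 0 < b by rewrite /b; lra.
have := weak (a / (a + b)) _.
have -> : (1 - a / (a + b)) / (a / (a + b)) = b / a.
  by field; rewrite !gt_eqF //; lra.
have -> : a / (a + b) / (1 - a / (a + b)) = a / b.
  by field; rewrite !gt_eqF //; lra.
have h : 0 < a / (a + b) < 1.
  by rewrite divr_gt0 /= ?ltr_pdivrMr ?mul1r //; lra.
move=> /(_ h) /le_trans; apply.
have hA : b / a * A ^+ 2 <= b * A.
  rewrite mulrAC -mulrA ler_wpM2l //; first by rewrite ltW.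
  by rewrite ler_pdivrMr // expr2 ler_wpM2l // /a; lra.
have hE : a / b * E ^+ 2 <= a * E.
  rewrite mulrAC -mulrA ler_wpM2l //; first by rewrite ltW.
  by rewrite ler_pdivrMr // expr2 ler_wpM2l // /b; lra.
have : k * (A + E) <= e.
  rewrite /k mulrAC ler_pdivrMr; last by lra.
  by rewrite ler_wpM2l; lra.
by rewrite /a /b in hA hE *; lra.
Qed.

End HD.
End Hadamard.

(** * Ultralimits and proximal maps *)

Lemma harmonic_small {R : realType} (e : R) : 0 < e ->
  exists N, forall n, (N <= n)%N -> n.+1%:R^-1 < e.
Proof.
move=> e0; exists (Num.truncn e^-1) => n Nn.
rewrite invf_plt ?posrE ?ltr0n //; apply: lt_le_trans (truncnS_gt _) _.
by rewrite ler_nat ltnS.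
Qed.

Section Ultralimits.
Context {R : realType} {I : Type} (U : set_system I) {FU : UltraFilter U}.

Lemma ultra_exists (A : set I) : U A -> exists i, A i.
Proof. exact: filter_ex. Qed.

Lemma real_ultralimit (f : I -> R) (M : R) : U [set i | `|f i| <= M] ->
  exists l, forall e, 0 < e -> U [set i | `|f i - l| < e].
Proof.
move=> UM; pose S := [set r : R | U [set i | r <= f i]].
have supS : has_sup S.
  split; first by exists (- M); apply: filterS UM => i /=; rewrite ler_norml => /andP[].
  exists M => r Sr; have [i [/= fi]] := ultra_exists (filterI UM Sr).
  by move=> /le_trans; apply; rewrite (le_trans _ fi) // ler_norm.
exists (sup S) => e e0.
have lo : U [set i | sup S - e < f i].
  have [r Sr rS] := sup_adherent e0 supS.
  by apply: filterS Sr => i /=; exact: lt_le_trans.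
have [hi|hi] := in_ultra_setVsetC [set i | sup S + e <= f i] FU.
  have : sup S + e <= sup S by apply: ub_le_sup => //; case: supS.
  by rewrite gerDl leNgt e0.
apply: filterS (filterI lo hi) => i [/= h1 /negP]; rewrite -ltNge => h2.
by rewrite ltr_distl; apply/andP; split; lra.
Qed.

Section InSpace.
Variables (Y : Type) (d : Y -> Y -> R).
Hypothesis hd : hadamard d.
Let pm := hd_pm hd.

Definition ulim (p : I -> Y) (y : Y) :=
  forall e, 0 < e -> U [set i | d (p i) y < e].

Lemma ulim_cst y : ulim (fun=> y) y.
Proof.
by move=> e e0; apply: filterS filterT => i _ /=; rewrite (pm_refl pm).
Qed.

Lemma ulim_dist p q y z c : ulim p y -> ulim q z ->
  (forall e, 0 < e -> U [set i | d (p i) (q i) <= c + e]) -> d y z <= c.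
Proof.
move=> py qz pq; apply/ler_addgt0Pr => e e0.
have e3 : 0 < e / 3 by lra.
have [i [/= h1 [h2 h3]]] :=
  ultra_exists (filterI (py _ e3) (filterI (qz _ e3) (pq _ e3))).
by have := pm_tri4 pm y (p i) (q i) z; rewrite (pm_sym pm y (p i)); lra.
Qed.

(** For each radius some ball contains [p i] for [U]-many [i]: otherwise arbitrarily long separated
    lists of points [p i] could be chosen, against the packing bound. Centres for shrinking radii
    form a Cauchy sequence. *)
Lemma ulim_exists (p : I -> Y) x M : uniformly_bounded_geometry d ->
  U [set i | d (p i) x <= M] -> exists y, ulim p y.
Proof.
move=> bg UM.
have close e : 0 < e -> exists c, U [set i | d (p i) c < e].
  move=> e0; apply: contrapT => nc.
  have far c : U [set i | e <= d (p i) c].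
    have [h|] := in_ultra_setVsetC [set i | d (p i) c < e] FU.
      by exfalso; apply: nc; exists c.
    by apply: filterS => i /negP; rewrite -leNgt.
  have [N HN] := bg (M + M) e e0.
  have sep n : exists q : nat -> Y, (forall i, (i < n)%N -> d (q i) x <= M) /\
      (forall i j, (i < j)%N -> (j < n)%N -> e <= d (q i) (q j)).
    elim: n => [|n [q [qM qs]]]; first by exists (fun=> x); split.
    have : U [set i | forall j, (j < n)%N -> e <= d (p i) (q j)].
      have: (n <= n)%N by []; elim: {1 3}n => [|k IH] kn; first by apply: filterS filterT.
      apply: filterS (filterI (IH (ltnW kn)) (far (q k))) => i [/= h1 h2] j.
      by rewrite ltnS leq_eqVlt => /orP[/eqP -> //|/h1].
    move=> /(filterI UM)/ultra_exists [i [/= iM ifar]].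
    exists (fun j => if j == n then p i else q j); split=> [j|j k].
      by rewrite ltnS leq_eqVlt; case: eqP => //= _ /qM.
    move=> jk; rewrite ltnS leq_eqVlt => /orP[/eqP kn|kn].
      by rewrite kn eqxx ltn_eqF -?kn // (pm_sym pm) ifar // -kn.
    by rewrite !ltn_eqF // ?(ltn_trans jk kn) // qs.
  have [q [qM qs]] := sep N.
  have [i j iN jN|i [j [ij jN]]] := HN q.
    have := pm_tri pm (q i) x (q j); have := qM _ iN; have := qM _ jN.
    by rewrite (pm_sym pm x); lra.
  by rewrite ltNge qs.
have pos n : (0 : R) < n.+1%:R^-1 by rewrite invr_gt0 ltr0n.
have [c Uc] := choice (fun n : nat => close _ (pos n)).
have arch := @harmonic_small R.
have [|y cy] := hd_cpl hd (u := c).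
  move=> e e0; have [|N HN] := arch (e / 2); first by lra.
  exists N => m n /HN hm /HN hn.
  have [i [/= h1 h2]] := ultra_exists (filterI (Uc m) (Uc n)).
  apply: le_lt_trans (pm_tri pm _ (p i) _) _.
  by rewrite [ltRHS](splitr e) ltrD ?(lt_trans h2) // (pm_sym pm) (lt_trans h1).
exists y => e e0; have e2 : 0 < e / 2 by lra.
have [N1 H1] := cy _ e2; have [N2 H2] := arch _ e2.
pose n := maxn N1 N2; have h1 := H1 n (leq_maxl N1 N2).
have h2 := H2 n (leq_maxr N1 N2).
apply: filterS (Uc n) => i hi; rewrite /= in hi *.
apply: le_lt_trans (pm_tri pm _ (c n) _) _.
by rewrite [ltRHS](splitr e) ltrD // (lt_trans hi).
Qed.

End InSpace.
End Ultralimits.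

Section Prox.
Context {R : realType} (Y : Type) (d : Y -> Y -> R) (hd : hadamard d).
Let pm := hd_pm hd.

Definition closed_in (C : set Y) :=
  forall y, (forall e, 0 < e -> exists2 z, C z & d z y < e) -> C y.

Definition convex_in (C : set Y) :=
  forall x y t, 0 <= t <= 1 -> C x -> C y -> C (geo hd x y t).

Definition convex_fun (f : Y -> R) := forall x y t, 0 <= t <= 1 ->
  f (geo hd x y t) <= (1 - t) * f x + t * f y.

Definition lipschitz_fun (f : Y -> R) (L : R) := forall x y, f x - f y <= L * d x y.

Lemma closed_in_eq0 C x y : closed_in C -> d x y = 0 -> C x -> C y.
Proof. by move=> cl xy Cx; apply: cl => e e0; exists x; rewrite ?xy. Qed.

(* The variational inequality characterizing the minimizer of [f + d x ^ 2] on
   [C]: with [f = 0] it is the projection to [C], with [C] everything the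
   resolvent of [f]. *)
Definition is_prox (C : set Y) (f : Y -> R) (x p : Y) := C p /\
  forall z, C z -> f p + d x p ^+ 2 + d p z ^+ 2 <= f z + d x z ^+ 2.

(** The squared distance makes the functional uniformly convex, so minimizing sequences are Cauchy
    without any compactness. *)
Lemma prox_exists C f L x : closed_in C -> convex_in C -> C !=set0 ->
  convex_fun f -> 0 <= L -> lipschitz_fun f L -> exists p, is_prox C f x p.
Proof.
move=> Ccl Ccv [z0 Cz0] fcv L0 fL.
pose F z := f z + d x z ^+ 2.
have Fcv u v t : 0 <= t <= 1 -> F (geo hd u v t) <=
    (1 - t) * F u + t * F v - t * (1 - t) * d u v ^+ 2.
  move=> t01; have := fcv u v t t01; have := geo_cn hd u v x t01.
  by rewrite /F; lra.
pose E := [set F z | z in C].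
have Einf : has_inf E.
  split; first by exists (F z0), z0.
  (* Completing the square: the quadratic term absorbs the linear decrease of [f]. *)
  exists (f x - L ^+ 2) => _ [z Cz <-]; rewrite /F.
  have := fL x z; have := sqr_ge0 (d x z - L / 2); have := sqr_ge0 L.
  by set D := d x z; nra.
pose m := inf E.
have mF z : C z -> m <= F z by move=> Cz; apply: ge_inf; [case: Einf|exists z].
have Fd u v : C u -> C v -> d u v ^+ 2 <= 2 * F u + 2 * F v - 4 * m.
  move=> Cu Cv; have h2 : 0 <= (1 / 2 : R) <= 1 by apply/andP; split; lra.
  have := Fcv u v (1 / 2) h2; have := mF _ (Ccv u v _ h2 Cu Cv); lra.
have pos n : (0 : R) < n.+1%:R^-1 by rewrite invr_gt0 ltr0n.
have near_inf e : 0 < e -> exists z, C z /\ F z < m + e.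
  move=> e0; have [_ [z Cz <-] zm] := inf_adherent e0 Einf.
  by exists z.
have [u uP] := choice (fun n => near_inf _ (pos n)).
have arch := @harmonic_small R.
have [|p up] := hd_cpl hd (u := u).
  move=> e e0; have e4 : 0 < e ^+ 2 / 4 by rewrite divr_gt0 ?exprn_gt0 //; lra.
  have [N HN] := arch _ e4.
  exists N => a b /HN ha /HN hb; have [[Ca Fa] [Cb Fb]] := (uP a, uP b).
  have h := Fd _ _ Ca Cb.
  move: (a.+1%:R^-1 : R) (b.+1%:R^-1 : R) ha hb Fa Fb => A B ha hb Fa Fb.
  rewrite ltNge; apply/negP => ed.
  have : e ^+ 2 <= d (u a) (u b) ^+ 2.
    by rewrite ler_pXn2r // nnegrE ?pm_ge0 // ltW.
  lra.
have Cp : C p.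
  by apply: Ccl => e /up[N HN]; exists (u N); [case: (uP N)|exact: HN].
have Fp : F p <= m.
  apply/ler_addgt0Pr => e e0.
  pose K := L + 2 * d x p + 4; have D0 := pm_ge0 pm x p.
  have K0 : 0 < K by rewrite /K; lra.
  have [del [del0 d1 dK]] : exists del, [/\ 0 < del, del <= 1 & del * K <= e / 2].
    exists (Num.min 1 (e / K / 2)); split.
    - by rewrite lt_min ltr01 !divr_gt0.
    - by rewrite ge_min lexx.
    - have : Num.min 1 (e / K / 2) <= e / K / 2 by rewrite ge_min lexx orbT.
      by move=> /(ler_wpM2r (ltW K0)) /le_trans; apply; rewrite mulrAC divfK ?gt_eqF.
  have [N1 H1] := up _ del0; have [|N2 H2] := arch (e / 2); first by lra.
  pose n := maxn N1 N2.
  have h1 := H1 _ (leq_maxl N1 N2); have h2 := H2 _ (leq_maxr N1 N2).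
  have [_] := uP n; rewrite -/n in h1 h2; rewrite /F.
  move: (n.+1%:R^-1 : R) h2 => A h2.
  have := fL p (u n); have := pm_tri pm x (u n) p; have := pm_tri pm x p (u n).
  rewrite (pm_sym pm p (u n)).
  have g0 := pm_ge0 pm (u n) p; have g1 := pm_ge0 pm x (u n).
  move: (d (u n) p) (d x (u n)) (d x p) (f p) (f (u n)) h1 g0 g1 D0 @K K0 dK
    => r a b fp fu h1 g0 g1 D0 K K0 dK t1 t2 h3 h4.
  have : b ^+ 2 <= (a + r) ^+ 2 by rewrite ler_pXn2r ?nnegrE ?addr_ge0.
  have rK : r * K <= e / 2 by apply: le_trans dK; rewrite ler_wpM2r // ltW.
  have : r * a <= r * (b + r) by rewrite ler_wpM2l.
  have : r * r <= r * 1 by rewrite ler_wpM2l //; lra.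
  by rewrite /K in rK *; lra.
exists p; split=> // z Cz; rewrite -/(F p) -/(F z).
apply/ler_addgt0Pr => e e0.
pose q := d p z ^+ 2; have q0 : 0 <= q by exact: sqr_ge0.
(* Minimality of [p] is compared with points at small ratio [t] towards [z]; this [t] makes the
   error [t * q] at most [e]. *)
pose t := e / (e + q).
have t01 : 0 < t <= 1.
  by rewrite divr_gt0 ?ler_pdivrMr ?mul1r //=; lra.
have /andP[t0 t1] := t01.
have t01' : 0 <= t <= 1 by rewrite ltW.
have := le_trans Fp (mF _ (Ccv p z t t01' Cp Cz)) => /le_trans /(_ (Fcv p z t t01')).
rewrite -/q => h.
have h1 : F p + (1 - t) * q <= F z.
  by rewrite -(ler_pM2l t0); lra.
suff : t * q <= e by lra.
rewrite /t mulrAC ler_pdivrMr; last by lra.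
by rewrite ler_wpM2l; lra.
Qed.

(** When the two variational inequalities are added, [f] cancels; the quadrilateral inequality then
    bounds [d p q ^+ 2] by [d x y * d p q]. *)
Lemma prox_nonexpansive C f x y p q :
  is_prox C f x p -> is_prox C f y q -> d p q <= d x y.
Proof.
move=> [Cp hp] [Cq hq]; have := hp _ Cq; have := hq _ Cp.
have := quadrilateral hd x y p q; rewrite (pm_sym pm q p).
have := pm_ge0 pm p q; have := pm_ge0 pm x y.
move: (d p q) (d x y) => r s s0 r0 h1 h2 h3.
have h : r * r <= s * r by nra.
have [->|rn0] := eqVneq r 0; first by [].
by rewrite -(ler_pM2r (_ : 0 < r)) // lt_neqAle eq_sym rn0.
Qed.

Lemma prox_uniq C f x p q : is_prox C f x p -> is_prox C f x q -> d p q = 0.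
Proof.
move=> hp hq; apply/le_anti/andP; split; last exact: pm_ge0.
by rewrite -(pm_refl pm x); exact: prox_nonexpansive hp hq.
Qed.

End Prox.

(** * Flows along geodesic rays *)

Section Flow.
Context {R : realType} (Y : Type) (d : Y -> Y -> R) (hd : hadamard d).
Let pm := hd_pm hd.
Implicit Types phi psi : R -> Y -> Y.

Record semiflow (phi : R -> Y -> Y) : Prop := Semiflow {
  sf_speed : forall x s t, 0 <= s -> 0 <= t -> d (phi s x) (phi t x) = `|s - t|;
  sf_nonexp : forall x y t, 0 <= t -> d (phi t x) (phi t y) <= d x y;
  sf_add : forall x s t, 0 <= s -> 0 <= t ->
    d (phi (s + t) x) (phi s (phi t x)) = 0;
  sf_0 : forall x, d (phi 0 x) x = 0 }.

Lemma frac01 (t l : R) : 0 <= t -> 0 < l -> t <= l -> 0 <= t / l <= 1.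
Proof.
move=> t0 l0 tl; apply/andP; split; first by rewrite divr_ge0 // ltW.
by rewrite ler_pdivrMr // mul1r.
Qed.

Lemma geo_same x y a b : 0 <= a <= 1 -> 0 <= b <= 1 ->
  d (geo hd x y a) (geo hd x y b) = `|a - b| * d x y.
Proof.
wlog ab : a b / a <= b.
  move=> h a01 b01; have [|/ltW] := leP a b; first by move=> ?; exact: h.
  by move=> ?; rewrite (pm_sym pm) distrC; exact: h.
move=> a01 b01; have [[a0 a1] [b0 b1]] := (andP a01, andP b01).
have [aE|an1] := eqVneq a 1.
  have -> : b = a by apply/le_anti; rewrite ab andbT aE.
  by rewrite (pm_refl pm) subrr normr0 mul0r.
have a1' : 0 < 1 - a by rewrite subr_gt0 lt_neqAle an1.
pose c := (b - a) / (1 - a).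
have c01 : 0 <= c <= 1.
  by rewrite /c divr_ge0 ?subr_ge0 //= ler_pdivrMr // mul1r; lra.
have bE : b = a + c * (1 - a) by rewrite /c divfK ?gt_eqF //; ring.
rewrite [in LHS]bE -(pm_eq0r pm _ (geo_comp hd x y a01 c01)) geo_l // geo_r //.
by rewrite ler0_norm ?subr_le0 // mulrA /c divfK ?gt_eqF // opprB.
Qed.

(** The excess over [d x y] is [t / d x w] times a bounded quantity. So unit speed geodesics towards
    receding targets [w], [w'] at bounded distance from each other separate in the limit no further
    than their origins. *)
Lemma ray_near x w y w' t : 0 <= t -> 0 < d x w -> 0 < d y w' ->
  t <= d x w -> t <= d y w' ->
  d (geo hd x w (t / d x w)) (geo hd y w' (t / d y w')) <=
  d x y + t / d x w * (d x y + 2 * d w w').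
Proof.
move=> t0 xw0 yw0 txw tyw.
have a01 : 0 <= t / d x w <= 1 by apply: frac01.
have b01 : 0 <= t / d y w' <= 1 by apply: frac01.
apply: le_trans (pm_tri pm _ (geo hd y w' (t / d x w)) _) _.
rewrite (geo_same _ _ a01 b01).
have -> : `|t / d x w - t / d y w'| * d y w' = t / d x w * `|d y w' - d x w|.
  have -> : t / d x w - t / d y w' = t / (d x w * d y w') * (d y w' - d x w).
    by field; rewrite !gt_eqF.
  rewrite normrM ger0_norm; last by rewrite divr_ge0 // mulr_ge0 // ltW.
  rewrite mulrAC; congr (_ * _).
  by field; rewrite !gt_eqF.
have h1 := geo_dist hd x w y w' a01.
have h2 : `|d y w' - d x w| <= d x y + d w w'.
  rewrite ler_norml; have := pm_tri4 pm x y w' w; have := pm_tri4 pm y x w w'.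
  by rewrite (pm_sym pm y x) (pm_sym pm w' w) => *; apply/andP; split; lra.
have a0 : 0 <= t / d x w by case/andP: a01.
have h3 := ler_wpM2l a0 h2; have h4 := mulr_ge0 a0 (pm_ge0 pm x y).
apply: le_trans (lerD h1 h3) _; rewrite !mulrDr -subr_ge0.
move: (t / d x w) h4 => a h4; apply: le_trans h4 _; rewrite le_eqVlt.
by apply/orP; left; apply/eqP; ring.
Qed.

Section Escape.
Context {I : Type} (U : set_system I) {FU : UltraFilter U}.
Variable P : I -> Y -> Y.
Hypothesis bg : uniformly_bounded_geometry d.
Hypothesis Pne : forall i x y, d (P i x) (P i y) <= d x y.
Hypothesis Pesc : forall x M, U [set i | M <= d x (P i x)].

Definition along i x t := geo hd x (P i x) (t / d x (P i x)).

Lemma escape_limit x t : 0 <= t -> exists y, ulim U d (fun i => along i x t) y.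
Proof.
move=> t0; apply: (ulim_exists hd (x := x) (M := t)) => //.
apply: filterS (Pesc x (t + 1)) => i /= h.
have l0 : 0 < d x (P i x) by lra.
rewrite (pm_sym pm) /along geo_l ?divfK ?gt_eqF //.
by apply: frac01 => //; lra.
Qed.

(** [P i] is nonexpansive, so the targets [P i x] and [P i y] stay within [d x y] of each other
    while they recede, as [ray_near] requires. *)
Lemma escape_semiflow : exists phi, semiflow phi /\
  forall x t, 0 <= t -> ulim U d (fun i => along i x t) (phi t x).
Proof.
have ex (tx : R * Y) : exists y, 0 <= tx.1 ->
    ulim U d (fun i => along i tx.2 tx.1) y.
  have [/escape_limit|/ltW t0] := leP 0 tx.1; last by exists tx.2; lra.
  by move=> /(_ tx.2)[y]; exists y.
have [f fP] := choice ex; pose phi t x := f (t, x).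
have lim x t : 0 <= t -> ulim U d (fun i => along i x t) (phi t x).
  exact: (fP (t, x)).
exists phi; split => //.
have ok x c t M : 0 <= t -> U [set i | [/\ M <= d x (P i x), 0 < d x (P i x),
    t <= d x (P i x), c < d x (P i x) & 0 <= t / d x (P i x) <= 1]].
  move=> t0; apply: filterS (Pesc x (Num.max M (`|c| + t + 1))) => i /=.
  rewrite ge_max => /andP[h1 h2]; have := ler_norm c; have := normr_ge0 c.
  move=> *; have l0 : 0 < d x (P i x) by lra.
  split=> //; try lra.
  by apply: frac01 => //; lra.
have ne x y t : 0 <= t -> d (phi t x) (phi t y) <= d x y.
  move=> t0; apply: (ulim_dist (FU := FU) hd (lim x t t0) (lim y t t0)) => e e0.
  have K0 : 0 <= t * (3 * d x y).
    by rewrite mulr_ge0 // mulr_ge0 // (pm_ge0 pm).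
  apply: filterS (filterI (ok x 0 t (t * (3 * d x y) / e) t0) (ok y 0 t 0 t0)).
  move=> i /= [[hM l0 tl _ _] [_ l0' tl' _ _]].
  apply: le_trans (ray_near t0 l0 l0' tl tl') _.
  rewrite lerD2l mulrAC ler_pdivrMr //.
  move: hM; rewrite ler_pdivrMr // => hM; rewrite (le_trans _ (le_trans hM _)) //.
    by rewrite ler_wpM2l //; have := Pne i x y; lra.
  by rewrite mulrC.
split=> //.
- move=> x s t s0 t0.
  have hle : d (phi s x) (phi t x) <= `|s - t|.
    apply: (ulim_dist (FU := FU) hd (lim x s s0) (lim x t t0)) => e e0.
    apply: filterS (filterI (ok x 0 s 0 s0) (ok x 0 t 0 t0)).
    move=> i /= [[_ l0 _ _ sl] [_ _ _ _ tl]].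
    rewrite /along geo_same // -mulrBl normrM normfV (gtr0_norm l0) divfK ?gt_eqF //.
    by rewrite lerDl ltW.
  apply/le_anti; rewrite hle /=; apply/ler_addgt0Pr => e e0.
  have e2 : 0 < e / 2 by lra.
  have [i] := ultra_exists (filterI (filterI (ok x 0 s 0 s0) (ok x 0 t 0 t0))
    (filterI (lim x s s0 _ e2) (lim x t t0 _ e2))).
  move=> [/= [[_ l0 _ _ sl] [_ _ _ _ tl]] [h1 h2]].
  have := geo_same x (P i x) sl tl.
  rewrite -mulrBl normrM normfV (gtr0_norm l0) divfK ?gt_eqF // => <-.
  rewrite /along in h1 h2.
  have := pm_tri4 pm (geo hd x (P i x) (s / d x (P i x))) (phi s x) (phi t x)
    (geo hd x (P i x) (t / d x (P i x))).
  rewrite (pm_sym pm (phi t x) (geo _ _ _ _)); lra.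
- move=> x s t s0 t0; apply/le_anti; rewrite pm_ge0 // andbT.
  have st0 : 0 <= s + t by rewrite addr_ge0.
  set z := phi t x.
  apply: (ulim_dist (FU := FU) hd (lim x _ st0) (lim z s s0)) => e e0.
  have e3 : 0 < e / 3 by lra.
  pose del := Num.min 1 (e / 3).
  have del0 : 0 < del by rewrite lt_min ltr01.
  apply: filterS (filterI (filterI (ok x t (s + t) 0 st0)
      (ok z 0 s (s * (3 * (1 + 2 * t)) / e) s0)) (lim x t t0 _ del0)).
  move=> i /= [[[_ l0 stl tl a01] [lz lz0 sz _ b01]] zi].
  (* The geodesic from [zi'] to [P i x] continues the one from [x]. Since [zi'] tends to [z], and
     [P i z] is within [t] of [P i x], the geodesics from [z] and from [zi'] have the same limit. *)
  pose zi' := along i x t.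
  have tl01 : 0 <= t / d x (P i x) <= 1.
    by apply: frac01 => //; exact: ltW.
  have dzi : d zi' (P i x) = d x (P i x) - t.
    by rewrite /zi' /along geo_r // mulrBl mul1r divfK ?gt_eqF.
  have zi0 : 0 < d zi' (P i x) by rewrite dzi; lra.
  have szi : s <= d zi' (P i x) by rewrite dzi; lra.
  have c01 : 0 <= s / d zi' (P i x) <= 1.
    by apply: frac01.
  have same : d (geo hd zi' (P i x) (s / d zi' (P i x))) (along i x (s + t)) = 0.
    have := geo_comp hd x (P i x) tl01 c01; rewrite -/(along i x t) -/zi' => h.
    rewrite (pm_eq0l pm _ h).
    have -> : t / d x (P i x) + s / d zi' (P i x) * (1 - t / d x (P i x)) =
              (s + t) / d x (P i x).
      rewrite dzi in zi0 *.
      by field; rewrite !gt_eqF.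
    exact: pm_refl.
  rewrite -(pm_eq0l pm _ same) (pm_sym pm).
  apply: le_trans (ray_near s0 lz0 zi0 sz szi) _.
  rewrite add0r -/z.
  have zd : d z zi' < del by rewrite (pm_sym pm).
  have d1 : del <= 1 by rewrite ge_min lexx.
  have d2 : del <= e / 3 by rewrite ge_min lexx orbT.
  have zP : d (P i z) (P i x) <= t.
    apply: le_trans (Pne i z x) _; rewrite (pm_sym pm).
    apply: (ulim_dist (FU := FU) hd (ulim_cst (FU := FU) hd x) (lim x t t0)) => e' e'0.
    apply: filterS (ok x 0 t 0 t0) => j /= [_ l0' _ _ h].
    by rewrite /along geo_l // divfK ?gt_eqF // lerDl ltW.
  have : s / d z (P i z) * (d z zi' + 2 * d (P i z) (P i x)) <= e / 3.
    rewrite mulrAC ler_pdivrMr //.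
    move: lz; rewrite ler_pdivrMr // => lz.
    have : s * (d z zi' + 2 * d (P i z) (P i x)) <= s * (1 + 2 * t).
      by rewrite ler_wpM2l //; lra.
    lra.
  lra.
- move=> x; apply/le_anti; rewrite pm_ge0 // andbT.
  apply: (ulim_dist (FU := FU) hd (lim x 0 (lexx _)) (ulim_cst (FU := FU) hd x)) => e e0.
  apply: filterS (ok x 0 0 0 (lexx _)) => j /= [_ l0' _ _ h].
  rewrite /along (pm_sym pm) geo_l // divfK ?gt_eqF //.
  by rewrite addr_ge0 // ltW.
Qed.

Lemma escape_equivariant phi h :
  (forall x t, 0 <= t -> ulim U d (fun i => along i x t) (phi t x)) ->
  (forall x y, d (h x) (h y) = d x y) ->
  (forall i x, d (h (P i x)) (P i (h x)) = 0) ->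
  forall x t, 0 <= t -> d (h (phi t x)) (phi t (h x)) = 0.
Proof.
move=> lim hi hP x t t0; apply/le_anti; rewrite pm_ge0 // andbT.
have hlim : ulim U d (fun i => h (along i x t)) (h (phi t x)).
  by move=> e /(lim x t t0); apply: filterS => i /=; rewrite hi.
apply: (ulim_dist (FU := FU) hd hlim (lim (h x) t t0)) => e e0.
apply: filterS (Pesc x (t + 1)) => i /= hh.
have l0 : 0 < d x (P i x) by lra.
have a01 : 0 <= t / d x (P i x) <= 1.
  by apply: frac01 => //; lra.
rewrite /along -(pm_eq0r pm (h x) (hP i x)) hi.
rewrite (pm_eq0l pm _ (geo_map hd _ _ hi a01)).
rewrite (_ : d _ _ = 0) ?add0r ?ltW //.
by apply: geo_congr => //; exact: pm_refl.
Qed.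

End Escape.
End Flow.

(** * Isometric flows and their Busemann functions *)

Section IsometricFlow.
Context {R : realType} (Y : Type) (d : Y -> Y -> R) (hd : hadamard d).
Let pm := hd_pm hd.
Implicit Types phi psi : R -> Y -> Y.

Record isoflow (nu : R) (phi : R -> Y -> Y) : Prop := Isoflow {
  if_speed : forall x s t, 0 <= s -> 0 <= t ->
    d (phi s x) (phi t x) = nu * `|s - t|;
  if_iso : forall x y t, 0 <= t -> d (phi t x) (phi t y) = d x y;
  if_add : forall x s t, 0 <= s -> 0 <= t ->
    d (phi (s + t) x) (phi s (phi t x)) = 0;
  if_0 : forall x, d (phi 0 x) x = 0 }.

(** By polarization, the Euclidean inner product of [phi 1 x - x] and [y - x]. For a flow of speed
    [nu > 0] it is [- nu] times the Busemann function of the ray from [x], normalized at [x]. *)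
Definition busemann phi x y :=
  (d (phi 1 x) x ^+ 2 + d x y ^+ 2 - d (phi 1 x) y ^+ 2) / 2.

Lemma linear_from_halves (A : R -> R) :
  (forall s t, 0 <= s -> 0 <= t <= 1 -> A (t * s) = t * A s) ->
  forall s, 0 <= s -> A s = s * A 1.
Proof.
move=> h s s0; have [s1|/ltW s1] := leP s 1.
  by rewrite -[in LHS](mulr1 s) h // s0.
have sp : 0 < s by lra.
have := h s s^-1 s0; rewrite mulVf ?gt_eqF // invr_ge0 s0 invf_le1 // s1.
by move=> /(_ isT) ->; rewrite mulrA divff ?mul1r ?gt_eqF.
Qed.

Lemma le_of_linear_bound (a C : R) : (forall s, 0 <= s -> s * a <= C) -> a <= 0.
Proof.
move=> h; rewrite leNgt; apply/negP => a0.
have C0 : 0 <= C by have := h 0 (lexx _); rewrite mul0r.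
have s0 : 0 <= (C + 1) / a by rewrite divr_ge0 //; lra.
by have := h _ s0; rewrite divfK ?gt_eqF //; lra.
Qed.

Section OneFlow.
Variables (nu : R) (phi : R -> Y -> Y) (fl : isoflow nu phi).

Lemma if_dist x t : 0 <= t -> d x (phi t x) = nu * t.
Proof.
move=> t0; rewrite -(pm_eq0l pm _ (if_0 fl x)) (if_speed fl) //.
by rewrite sub0r normrN ger0_norm.
Qed.

Lemma if_geo x s t : 0 <= s -> 0 <= t <= 1 ->
  d (phi (t * s) x) (geo hd x (phi s x) t) = 0.
Proof.
move=> s0 t01; have /andP[t0 t1] := t01.
have ts0 : 0 <= t * s by rewrite mulr_ge0.
apply: geo_uniq => //; rewrite !if_dist //; first by rewrite mulrCA.
rewrite (if_speed fl) // distrC ger0_norm; first by rewrite le_eqVlt; apply/orP; left; apply/eqP; ring.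
by rewrite subr_ge0 ler_piMl.
Qed.

(** In Euclidean space this is [- 2 * s] times an inner product. CN along the ray makes it
    subhomogeneous in [s], and antisymmetry in [x] and [y] turns this into linearity. *)
Let A x y s := d (phi s x) y ^+ 2 - (nu * s) ^+ 2 - d x y ^+ 2.

Let A_convex x y s t : 0 <= s -> 0 <= t <= 1 -> A x y (t * s) <= t * A x y s.
Proof.
move=> s0 t01; have := geo_cn hd x (phi s x) y t01.
rewrite -(pm_eq0r pm _ (if_geo x s0 t01)) if_dist // /A.
rewrite (pm_sym pm y x) !(pm_sym pm y (phi _ x)).
have -> : (nu * (t * s)) ^+ 2 = t ^+ 2 * (nu * s) ^+ 2 by ring.
move: (nu * s) => w; lra.
Qed.

(** One inequality is the quadrilateral inequality; the other is CN at [phi s x], the midpoint of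
    [x] and [phi (s + s) x], seen from [phi s y]. *)
Let A_anti x y s : 0 <= s -> A y x s = - A x y s.
Proof.
move=> s0; apply/le_anti/andP; split; rewrite /A.
  have := quadrilateral hd x (phi s x) y (phi s y).
  rewrite (if_iso fl) // !if_dist // (pm_sym pm x (phi s y)) (pm_sym pm y x).
  by move=> h; rewrite -subr_le0; lra.
have h2 : 0 <= (1 / 2 : R) <= 1 by apply/andP; split; lra.
have s2 : 0 <= s + s by lra.
have := geo_cn hd x (phi (s + s) x) (phi s y) h2.
have := if_geo x s2 h2.
rewrite (_ : 1 / 2 * (s + s) = s); last by lra.
move=> /(pm_eq0r pm (phi s y)) <-.
rewrite if_dist // (if_iso fl) // (pm_eq0r pm _ (if_add fl x s0 s0)) (if_iso fl) //.
rewrite (pm_sym pm y (phi s x)) (pm_sym pm y x).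
by rewrite [nu * (s + s)]mulrDr; move: (nu * s) => w; lra.
Qed.

Let A_linear x y s : 0 <= s -> A x y s = s * A x y 1.
Proof.
apply: linear_from_halves => {}s t s0 t01; have /andP[t0 t1] := t01.
apply/le_anti; rewrite A_convex //=.
have := A_convex y x s0 t01; rewrite !(A_anti x y) ?mulr_ge0 //; lra.
Qed.

Let A1 x y : A x y 1 = - 2 * busemann phi x y.
Proof.
by rewrite /A /busemann (pm_sym pm (phi 1 x) x) if_dist // mulr1; lra.
Qed.

Lemma busemann_fwd x y s : 0 <= s ->
  d (phi s x) y ^+ 2 = (nu * s) ^+ 2 - 2 * s * busemann phi x y + d x y ^+ 2.
Proof. by move=> /(A_linear x y); rewrite A1 /A; lra. Qed.

Lemma busemann_anti x y : busemann phi y x = - busemann phi x y.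
Proof. by have := A_anti x y ler01; rewrite !A1; lra. Qed.

Lemma busemann_bwd x y s : 0 <= s ->
  d x (phi s y) ^+ 2 = (nu * s) ^+ 2 + 2 * s * busemann phi x y + d x y ^+ 2.
Proof.
move=> s0; rewrite (pm_sym pm) busemann_fwd // busemann_anti (pm_sym pm y x).
by ring.
Qed.

Lemma busemann_le x y : busemann phi x y <= nu * d x y.
Proof.
have := busemann_fwd x y ler01; have := pm_dist pm (phi 1 x) y x.
rewrite !mulr1 (pm_sym pm _ x) if_dist // mulr1 (pm_sym pm y x) => h1 h2.
have h3 : (nu - d x y) ^+ 2 <= d (phi 1 x) y ^+ 2.
  by rewrite -(real_normK (num_real (_ - _))) ler_pXn2r ?nnegrE ?(pm_ge0 pm).
by rewrite h2 in h3; nra.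
Qed.

Lemma busemann_refl x : busemann phi x x = 0.
Proof. by have := busemann_anti x x; lra. Qed.

(** The triangle inequality from [phi (s + s) u] through [phi s v] to [w], squared and divided by a
    large [s], leaves one inequality between the Busemann terms; antisymmetry gives the other. *)
Lemma busemann_add x y z :
  busemann phi x z = busemann phi x y + busemann phi y z.
Proof.
have half u v w : busemann phi u v + busemann phi v w <= busemann phi u w.
  rewrite -subr_le0; apply: (@le_of_linear_bound _ ((d u v ^+ 2 + d v w ^+ 2) / 2)) => s s0.
  have s2 : 0 <= s + s by lra.
  have tr := pm_tri pm (phi (s + s) u) (phi s v) w.
  rewrite (pm_eq0l pm (phi s v) (if_add fl u s0 s0)) (if_iso fl) // in tr.
  have := busemann_fwd u w s2; have := busemann_fwd u v s0.
  have := busemann_fwd v w s0; have := sqr_ge0 (d (phi s u) v - d (phi s v) w).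
  have : d (phi (s + s) u) w ^+ 2 <= (d (phi s u) v + d (phi s v) w) ^+ 2.
    by rewrite ler_pXn2r ?nnegrE ?addr_ge0 ?(pm_ge0 pm).
  have := sqr_ge0 (d u w).
  move: (busemann phi u v) (busemann phi v w) (busemann phi u w) => a b c.
  by rewrite [nu * (s + s)]mulrDr; move: (nu * s) => q; nra.
apply/le_anti; rewrite half andbT.
have := half z y x; rewrite (busemann_anti x z) (busemann_anti y z) (busemann_anti x y).
lra.
Qed.

Lemma busemann_dist x y : `|busemann phi x y| <= nu * d x y.
Proof.
rewrite ler_norml busemann_le andbT.
have := busemann_le y x; rewrite busemann_anti (pm_sym pm y x); lra.
Qed.

Lemma busemann_eq0 x y : d x y = 0 -> busemann phi x y = 0.
Proof.
move=> xy; have := busemann_dist x y; rewrite xy mulr0 normr_le0.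
by move=> /eqP.
Qed.

Lemma busemann_eq0r x y z : d x y = 0 -> busemann phi z x = busemann phi z y.
Proof. by move=> /busemann_eq0 h; rewrite (busemann_add z x y) h addr0. Qed.

(** CN for the geodesic moved by [phi s] and seen from [z], and CN for the geodesic itself seen from
    [phi s z]: for large [s] the terms linear in [s] give the two inequalities. *)
Lemma busemann_geo x y z t : 0 <= t <= 1 ->
  busemann phi z (geo hd x y t) =
  (1 - t) * busemann phi z x + t * busemann phi z y.
Proof.
move=> t01; have /andP[t0 t1] := t01; set p := geo hd x y t.
set C := (1 - t) * d z x ^+ 2 + t * d z y ^+ 2.
apply/le_anti/andP; split; rewrite -subr_le0.
  apply: (@le_of_linear_bound _ (C / 2)) => s s0.
  have ip := geo_map hd x y (fun u v => if_iso fl u v s0) t01.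
  have := geo_cn hd (phi s x) (phi s y) z t01; rewrite -(pm_eq0r pm z ip) -/p.
  rewrite (if_iso fl) // !busemann_bwd //.
  have := mulr_ge0 (mulr_ge0 t0 (_ : 0 <= 1 - t)) (sqr_ge0 (d x y)).
  rewrite subr_ge0 => /(_ t1); have := sqr_ge0 (d z p); rewrite /C.
  by move: (nu * s) => q; nra.
apply: (@le_of_linear_bound _ (C / 2)) => s s0.
have := geo_cn hd x y (phi s z) t01; rewrite -/p !busemann_fwd //.
have := mulr_ge0 (mulr_ge0 t0 (_ : 0 <= 1 - t)) (sqr_ge0 (d x y)).
rewrite subr_ge0 => /(_ t1); have := sqr_ge0 (d z p); rewrite /C.
by move: (nu * s) => q; nra.
Qed.

End OneFlow.

Section TwoFlows.
Variables (nu mu : R) (phi psi : R -> Y -> Y).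
Hypotheses (flphi : isoflow nu phi) (flpsi : isoflow mu psi).

Lemma busemann_along x t : 0 <= t ->
  busemann phi x (psi t x) = t * busemann phi x (psi 1 x).
Proof.
move=> t0; apply: (linear_from_halves (A := fun t => busemann phi x (psi t x))) => //.
move=> s u s0 u01 /=; rewrite (busemann_eq0r flphi _ (if_geo flpsi x s0 u01)).
by rewrite (busemann_geo flphi) // (busemann_refl flphi) mulr0 add0r.
Qed.

(** The angle between two flows is the same everywhere: both are isometric, so [s] times the
    difference stays bounded as [s] grows. *)
Lemma busemann_along_const x y :
  busemann phi x (psi 1 x) = busemann phi y (psi 1 y).
Proof.
have half u v : busemann phi u (psi 1 u) <= busemann phi v (psi 1 v).
  rewrite -subr_le0; apply: (@le_of_linear_bound _ (2 * (nu * d u v))) => s s0.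
  rewrite mulrBr -!busemann_along //.
  have := busemann_add flphi u v (psi s u).
  have := busemann_add flphi v (psi s v) (psi s u).
  have := busemann_le flphi u v.
  have := busemann_le flphi (psi s v) (psi s u).
  by rewrite (if_iso flpsi) // (pm_sym pm v u); lra.
by apply/le_anti; rewrite !half.
Qed.

End TwoFlows.

Lemma flows_dist nu mu phi psi x s t : isoflow nu phi -> isoflow mu psi ->
  0 <= s -> 0 <= t ->
  d (phi s x) (psi t x) ^+ 2 =
  (nu * s) ^+ 2 + (mu * t) ^+ 2 - 2 * s * t * busemann phi x (psi 1 x).
Proof.
move=> fp fq s0 t0; rewrite (busemann_fwd fp) // (if_dist fq) //.
by rewrite (busemann_along fp fq) //; ring.
Qed.

Lemma busemann_self nu phi x t : isoflow nu phi -> 0 <= t ->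
  busemann phi x (phi t x) = nu ^+ 2 * t.
Proof.
move=> fp t0; rewrite (busemann_along fp fp) // mulrC /busemann (pm_refl pm).
rewrite (pm_sym pm _ x) (if_dist fp) // mulr1; congr (_ * _).
by rewrite expr0n subr0; lra.
Qed.

(** [busemann_fwd] and the cocycle relation expand the squared distance; its terms cancel because
    the angle between the flows is constant. *)
Lemma flows_commute nu mu phi psi x s t : isoflow nu phi -> isoflow mu psi ->
  0 <= s -> 0 <= t -> d (phi s (psi t x)) (psi t (phi s x)) = 0.
Proof.
move=> fp fq s0 t0; apply/eqP; rewrite -sqrf_eq0; apply/eqP.
rewrite (busemann_fwd fp) // (if_iso fq) // (if_dist fp) //.
rewrite (busemann_add fp _ x) (busemann_add fp x (phi s x)) (busemann_anti fp x).
rewrite (busemann_self _ fp) // (busemann_along fp fq x t0) (busemann_along fp fq (phi s x) t0).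
by rewrite (busemann_along_const fp fq (phi s x) x); ring.
Qed.

End IsometricFlow.

(** * Spaces represented in X *)

Section HSpace.
Context {R : realType} {G : groupType}.
Variables (H : set G) (S : seq G) (N : set_system G) (eps : R).
Variables (X : Type) (dX : X -> X -> R).

Definition sqnorm_diff k (v w : nat -> R) := \sum_(l < k) (v l - w l) ^+ 2.

(* The vectors of [R^k] are the first [k] terms of the sequences [v i]. *)
Definition finitely_represented k (Y : Type) (d : Y -> Y -> R) :=
  forall (n : nat) (y : nat -> Y) (v : nat -> nat -> R) (e : R), 0 < e ->
  exists x : nat -> X, forall i j, (i < n)%N -> (j < n)%N ->
    `|dX (x i) (x j) ^+ 2 - (d (y i) (y j) ^+ 2 + sqnorm_diff k (v i) (v j))| <= e.

(** The laws hold only up to distance 0, which is all that extensions to a completion can satisfy.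
    [N] will be the neighbourhood filter of 1, so [ia_cts] is continuity of the orbit maps at 1,
    restricted to [H]. *)
Record isom_action (Y : Type) (d : Y -> Y -> R) (act : G -> Y -> Y) : Prop :=
  IsomAction {
  ia_iso : forall h x y, H h -> d (act h x) (act h y) = d x y;
  ia_1 : forall x, d (act 1%g x) x = 0;
  ia_M : forall g h x, H g -> H h -> d (act (g * h)%g x) (act g (act h x)) = 0;
  ia_cts : forall x e, 0 < e -> N [set h | H h -> d (act h x) x < e] }.

Definition moving (Y : Type) (d : Y -> Y -> R) (act : G -> Y -> Y) :=
  forall y, exists2 s, s \in S & eps <= d (act s y) y.

Record hspace k (Y : Type) (d : Y -> Y -> R) (act : G -> Y -> Y) : Prop :=
  HSpace {
  hs_hd : hadamard d;
  hs_act : isom_action d act;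
  hs_fr : finitely_represented k d;
  hs_moving : moving d act }.

Lemma sq_close (a b e M : R) : 0 <= a <= M -> 0 <= b -> `|a - b| <= e -> e <= 1 ->
  `|a ^+ 2 - b ^+ 2| <= e * (2 * M + 1).
Proof.
move=> /andP[a0 aM] b0 ab e1.
rewrite subr_sqr normrM; apply: ler_pM => //.
by rewrite ger0_norm ?addr_ge0 //; move: ab; rewrite ler_norml => /andP[*]; lra.
Qed.

Lemma finitely_represented_geometry k Y (d : Y -> Y -> R) :
  pseudometric d -> pseudometric dX -> finitely_represented k d ->
  uniformly_bounded_geometry dX -> uniformly_bounded_geometry d.
Proof.
move=> pm pmX fr bg rho r r0.
(* The enlarged diameter and the halved separation leave room for the error in the squared
   distances. *)
have [|n hn] := bg (`|rho| + 1) (r / 2); first by lra.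
exists n => p hp.
pose e := Num.min 1 (r ^+ 2 / 2).
have e0 : 0 < e by rewrite lt_min ltr01 divr_gt0 ?exprn_gt0.
have e1 : e <= 1 by rewrite ge_min lexx.
have e2 : e <= r ^+ 2 / 2 by rewrite ge_min lexx orbT.
have [x hx] := fr n p (fun _ _ => 0) e e0.
have z v : sqnorm_diff k v v = 0.
  by rewrite /sqnorm_diff big1 // => l _; rewrite subrr expr0n.
have hx' i j : (i < n)%N -> (j < n)%N ->
    `|dX (x i) (x j) ^+ 2 - d (p i) (p j) ^+ 2| <= e.
  by move=> iN jN; have := hx i j iN jN; rewrite z addr0.
have [i j iN jN|i [j [ij jN dij]]] := hn x.
  apply: le_of_sqr; first by rewrite addr_ge0.
  have := hx' i j iN jN; rewrite ler_norml => /andP[_ h].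
  have h2 : d (p i) (p j) ^+ 2 <= `|rho| ^+ 2.
    rewrite ler_pXn2r ?nnegrE ?(pm_ge0 pm) //.
    by apply: le_trans (hp i j iN jN) _; exact: ler_norm.
  by have := normr_ge0 rho; nra.
exists i, j; split=> //.
have := hx' i j (ltn_trans ij jN) jN; rewrite ler_norml => /andP[h _].
have h2 : dX (x i) (x j) ^+ 2 < (r / 2) ^+ 2.
  by rewrite ltr_pXn2r ?nnegrE ?(pm_ge0 pmX) //; lra.
rewrite ltNge; apply/negP => rd.
have : r ^+ 2 <= d (p i) (p j) ^+ 2.
  by rewrite ler_pXn2r ?nnegrE ?(pm_ge0 pm) // ltW.
by nra.
Qed.

(** Over a single point [y], basis vectors of [R^k] are at mutual distance sqrt 2. Copied into [X]
    with error 1/2 in the squares, their distances stay between 1 and 2, so the packing bound for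
    these two radii limits their number. *)
Lemma finitely_represented_dim : uniformly_bounded_geometry dX ->
  pseudometric dX -> exists n, forall k (Y : Type) (d : Y -> Y -> R) (y : Y),
    pseudometric d -> finitely_represented k d -> (k < n)%N.
Proof.
move=> bg pmX; have [n hn] := bg 2 1 ltr01; exists n => k Y d y pm fr.
rewrite ltnNge; apply/negP => nk.
pose v (i l : nat) : R := (i == l)%:R.
have sq i j : (i < k)%N -> (j < k)%N -> sqnorm_diff k (v i) (v j) = 2 * (i != j)%:R.
  move=> ik jk; rewrite /sqnorm_diff /v; have [->|ij] := eqVneq i j.
    by rewrite mulr0 big1 // => l _; rewrite subrr expr0n.
  rewrite (bigD1 (Ordinal ik)) //= (bigD1 (Ordinal jk)) /=; last first.
    by rewrite -val_eqE /= eq_sym.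
  rewrite !eqxx (negPf ij) eq_sym (negPf ij) big1 ?addr0 => [|l /andP[h1 h2]].
    by rewrite subr0 sub0r sqrrN !expr1n mulr1.
  rewrite -!val_eqE /= in h1 h2; rewrite ![_ == (l : nat)]eq_sym (negPf h1) (negPf h2).
  by rewrite subrr expr0n.
have [|x hx] := fr n (fun=> y) v (1 / 2); first by lra.
have hx' i j : (i < n)%N -> (j < n)%N ->
    `|dX (x i) (x j) ^+ 2 - 2 * (i != j)%:R| <= 1 / 2.
  move=> iN jN; have := hx i j iN jN.
  by rewrite (pm_refl pm) expr0n add0r sq // (leq_trans _ nk).
have [i j iN jN|i [j [ij jN]]] := hn x.
  apply: le_of_sqr => //; have := hx' i j iN jN.
  by rewrite ler_norml => /andP[_]; case: (i == j) => /=; lra.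
have := hx' i j (ltn_trans ij jN) jN.
rewrite neq_ltn ij /= mulr1 ler_norml => /andP[h _] h1.
have : dX (x i) (x j) ^+ 2 < 1 ^+ 2 by rewrite ltr_pXn2r ?nnegrE ?(pm_ge0 pmX).
lra.
Qed.

Section Subspace.
Variables (k : nat) (Y : Type) (d : Y -> Y -> R) (act : G -> Y -> Y).
Hypothesis hY : hspace k d act.
Let hd := hs_hd hY.
Let pm := hd_pm hd.
Hypothesis HS : forall s, s \in S -> H s.
Hypothesis HG : H 1%g /\ forall g h, H g -> H h -> H (g * h)%g.
Variable C : set Y.
Hypotheses (Ccl : closed_in d C) (Ccv : convex_in hd C).
Hypothesis CH : forall h x, H h -> C x -> C (act h x).

Definition sub_dist (x y : {y | C y}) := d (sval x) (sval y).

Definition sub_act (h : G) (x : {y | C y}) : {y | C y} :=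
  match pselect (C (act h (sval x))) with
  | left c => exist _ _ c
  | right _ => x
  end.

Lemma sub_actE h x : H h -> sval (sub_act h x) = act h (sval x).
Proof.
move=> Hh; rewrite /sub_act; case: pselect => //= nc; exfalso; apply: nc.
by apply: CH => //; exact: (svalP x).
Qed.

Lemma sub_hspace : hspace k sub_dist sub_act.
Proof.
have [pmr pms pmt] := pm; split.
- split.
  + by split=> [x|x y|x y z]; rewrite /sub_dist; [exact: pmr|exact: pms|exact: pmt].
  + move=> [x Cx] [y Cy] t t01; exists (exist _ _ (Ccv t01 Cx Cy)) => -[z Cz].
    exact: geo_cn.
  + move=> u cu; have [|y uy] := hd_cpl hd (u := fun n => sval (u n)); first exact: cu.
    have Cy : C y.
      apply: Ccl => e /uy[n hn]; exists (sval (u n)); first exact: (svalP (u n)).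
      exact: hn.
    by exists (exist _ y Cy); exact: uy.
- split=> [h x y Hh|x|g h x Hg Hh|x e e0]; rewrite /sub_dist.
  + by rewrite !sub_actE // (ia_iso (hs_act hY)).
  + by rewrite sub_actE ?(ia_1 (hs_act hY)) //; case: HG.
  + by rewrite !sub_actE ?(ia_M (hs_act hY)) //; case: HG => _; apply.
  + have := ia_cts (hs_act hY) (sval x) e0.
    rewrite (_ : [set h | H h -> d (sval (sub_act h x)) (sval x) < e] =
      [set h | H h -> d (act h (sval x)) (sval x) < e]) //.
    by apply/seteqP; split => h /= hh Hh; have := hh Hh; rewrite sub_actE.
- by move=> n y v e e0; exact: (hs_fr hY n (fun i => sval (y i)) v e0).
- move=> x; have [s sS hs] := hs_moving hY (sval x); exists s => //.
  by rewrite /sub_dist sub_actE //; exact: HS.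
Qed.

End Subspace.
End HSpace.

(** * Completion *)

Lemma real_cauchy {R : realType} (a : nat -> R) :
  (forall e, 0 < e -> exists N, forall m n, (N <= m)%N -> (N <= n)%N ->
    `|a m - a n| <= e) ->
  exists l, forall e, 0 < e -> exists N, forall n, (N <= n)%N -> `|a n - l| <= e.
Proof.
move=> ca; pose A := [set r | exists N, forall n, (N <= n)%N -> r <= a n].
have lb e N : (forall m n, (N <= m)%N -> (N <= n)%N -> `|a m - a n| <= e) ->
    A (a N - e).
  move=> hN; exists N => n Nn; have := hN n N Nn (leqnn _).
  by rewrite ler_distl => /andP[].
have ub e N : (forall m n, (N <= m)%N -> (N <= n)%N -> `|a m - a n| <= e) ->
    forall r, A r -> r <= a N + e.
  move=> hN r [N' hr]; apply: le_trans (hr _ (leq_maxr N N')) _.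
  have := hN (maxn N N') N (leq_maxl _ _) (leqnn _).
  by rewrite ler_distl => /andP[].
have supA : has_sup A.
  have [N hN] := ca 1 ltr01; split; first by exists (a N - 1); exact: lb hN.
  by exists (a N + 1) => r; exact: ub hN _.
exists (sup A) => e e0; have [|N hN] := ca (e / 2); first by lra.
exists N => n Nn.
have h1 : a N - e / 2 <= sup A by apply: ub_le_sup; [case: supA|exact: lb].
have h2 : sup A <= a N + e / 2.
  by apply: ge_sup; [case: supA|move=> r; exact: ub hN _].
have := hN n N Nn (leqnn _); rewrite !ler_distl => /andP[*].
by apply/andP; split; lra.
Qed.

Section Completion.
Context {R : realType} (Y : Type) (d : Y -> Y -> R) (pm : pseudometric d).

Let cY := {u : nat -> Y | cauchy_seq d u}.

Let dist_lim (u v : cY) : exists l, forall e, 0 < e -> exists N, forall n,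
  (N <= n)%N -> `|d (sval u n) (sval v n) - l| <= e.
Proof.
apply: real_cauchy => e e0; have e2 : 0 < e / 2 by lra.
have [N1 h1] := svalP u _ e2; have [N2 h2] := svalP v _ e2.
exists (maxn N1 N2) => m n; rewrite !geq_max => /andP[m1 m2] /andP[n1 n2].
have := h1 m n m1 n1; have := h2 m n m2 n2.
have := pm_tri4 pm (sval u m) (sval u n) (sval v n) (sval v m).
have := pm_tri4 pm (sval u n) (sval u m) (sval v m) (sval v n).
rewrite (pm_sym pm (sval v n) (sval v m)) (pm_sym pm (sval u n) (sval u m)).
by move=> *; rewrite ler_distl; apply/andP; split; lra.
Qed.

Let cd u v := projT1 (cid (dist_lim u v)).

Let cdP u v e : 0 < e -> exists N, forall n, (N <= n)%N ->
  `|d (sval u n) (sval v n) - cd u v| <= e.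
Proof. by rewrite /cd; case: cid => l /= h; exact: h. Qed.

Let cd_le u v c : (forall e, 0 < e -> exists N, forall n, (N <= n)%N ->
  d (sval u n) (sval v n) <= c + e) -> cd u v <= c.
Proof.
move=> h; apply/ler_addgt0Pr => e e0; have e2 : 0 < e / 2 by lra.
have [N1 h1] := h _ e2; have [N2 h2] := cdP u v e2.
have := h1 _ (leq_maxl N1 N2); have := h2 _ (leq_maxr N1 N2).
by rewrite ler_distl => /andP[*]; lra.
Qed.

Let cd_ge u v c : (forall e, 0 < e -> exists N, forall n, (N <= n)%N ->
  c - e <= d (sval u n) (sval v n)) -> c <= cd u v.
Proof.
move=> h; apply/ler_addgt0Pr => e e0; have e2 : 0 < e / 2 by lra.
have [N1 h1] := h _ e2; have [N2 h2] := cdP u v e2.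
have := h1 _ (leq_maxl N1 N2); have := h2 _ (leq_maxr N1 N2).
by rewrite ler_distl => /andP[*]; lra.
Qed.

Let const_cauchy y : cauchy_seq d (fun=> y).
Proof. by move=> e e0; exists 0%N => *; rewrite (pm_refl pm). Qed.

Let iota_ y : cY := exist _ _ (const_cauchy y).

Lemma completion_exists : exists (cY : Type) (cd : cY -> cY -> R) (i : Y -> cY),
  [/\ pseudometric cd, (forall x y, cd (i x) (i y) = d x y),
      (forall u e, 0 < e -> exists x, cd u (i x) < e) &
      (forall u, cauchy_seq cd u -> exists y, converges_to cd u y)].
Proof.
have pmc : pseudometric cd.
  split=> [u|u v|u v w].
  - apply/le_anti/andP; split; first by apply: cd_le => e e0; exists 0%N => n _; rewrite (pm_refl pm); lra.
    by apply: cd_ge => e e0; exists 0%N => n _; rewrite (pm_refl pm); lra.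
  - have half a b : cd a b <= cd b a.
      apply: cd_le => e /(cdP b a)[n hn]; exists n => m /hn.
      by rewrite (pm_sym pm) ler_distl => /andP[]; lra.
    by apply/le_anti; rewrite !half.
  - apply: cd_le => e e0; have e2 : 0 < e / 2 by lra.
    have [N1 h1] := cdP u v e2; have [N2 h2] := cdP v w e2.
    exists (maxn N1 N2) => n; rewrite geq_max => /andP[/h1 + /h2].
    have := pm_tri pm (sval u n) (sval v n) (sval w n).
    by rewrite !ler_distl => ? /andP[_ ?] /andP[_ ?]; lra.
have iso x y : cd (iota_ x) (iota_ y) = d x y.
  apply/le_anti/andP; split; first by apply: cd_le => e e0; exists 0%N => n _ /=; lra.
  by apply: cd_ge => e e0; exists 0%N => n _ /=; lra.
have tail (u : cY) e : 0 < e -> exists N, forall n, (N <= n)%N ->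
    cd u (iota_ (sval u n)) <= e.
  move=> e0; have [n hn] := svalP u _ e0; exists n => m nm.
  apply: cd_le => e' e'0; exists n => p np /=; have := hn p m np nm; lra.
exists cY, cd, iota_; split => //.
  move=> u e e0; have [|n hn] := tail u (e / 2); first by lra.
  by exists (sval u n); have := hn n (leqnn _); lra.
move=> u cu.
have dense n : exists x, cd (u n) (iota_ x) < n.+1%:R^-1.
  have n0 : 0 < (n.+1%:R^-1 : R) by rewrite invr_gt0 ltr0n.
  have [|m hm] := tail (u n) (n.+1%:R^-1 / 2); first by rewrite divr_gt0.
  by exists (sval (u n) m); apply: le_lt_trans (hm m (leqnn _)) _; rewrite ltr_pdivrMr // ltr_pMr // ltr1n.
have [x hx] := choice dense.
have cx : cauchy_seq d x.
  move=> e e0; have e3 : 0 < e / 3 by lra.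
  have [N1 h1] := cu _ e3; have [N2 h2] := harmonic_small e3.
  exists (maxn N1 N2) => m n; rewrite !geq_max => /andP[m1 m2] /andP[n1 n2].
  rewrite -iso; apply: le_lt_trans (pm_tri4 pmc _ (u m) (u n) _) _.
  have := h1 m n m1 n1; have := lt_trans (hx m) (h2 m m2).
  have := lt_trans (hx n) (h2 n n2); rewrite (pm_sym pmc _ (u m)).
  by move=> *; lra.
exists (exist _ x cx) => e e0; have e3 : 0 < e / 3 by lra.
have [N1 h1] := tail (exist _ x cx) _ e3; have [N2 h2] := harmonic_small e3.
exists (maxn N1 N2) => n; rewrite geq_max => /andP[/h1 /= n1 n2].
have := lt_trans (hx n) (h2 n n2).
have := pm_tri pmc (u n) (iota_ (x n)) (exist _ x cx).
by rewrite (pm_sym pmc (iota_ _) (exist _ _ _)); lra.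
Qed.

End Completion.

(** * Approximate CAT(0) inequalities *)

Section ApproxCAT0.
Context {R : realType}.

(** An incomplete direct limit may lack exact dividing points. One [p] has to serve all [z] within
    [M] of [x], so that approximations with different errors can be compared with each other. *)
Definition approx_cn (Y : Type) (d : Y -> Y -> R) := forall x y t e M,
  0 <= t <= 1 -> 0 < e -> exists p, forall z, d z x <= M ->
  d z p ^+ 2 <= (1 - t) * d z x ^+ 2 + t * d z y ^+ 2
                - t * (1 - t) * d x y ^+ 2 + e.

Lemma sq_le_add (a b e M : R) : 0 <= a <= M -> 0 <= b -> b <= a + e ->
  0 <= e <= 1 -> b ^+ 2 <= a ^+ 2 + e * (2 * M + 1).
Proof.
move=> /andP[a0 aM] b0 ba /andP[e0 e1].
have : b ^+ 2 <= (a + e) ^+ 2 by rewrite ler_pXn2r ?nnegrE ?addr_ge0.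
have : e * a <= e * M by rewrite ler_wpM2l.
have : e * e <= e * 1 by rewrite ler_wpM2l.
nra.
Qed.

(* An approximate CN inequality survives a perturbation of the four distances by [k]. *)
Lemma cn_perturb (a b c p a' b' c' p' t k Q m e : R) : 0 <= t <= 1 -> 0 <= k <= 1 ->
  0 <= a <= Q -> 0 <= b <= Q -> 0 <= c -> 0 <= p ->
  0 <= a' <= a + k -> 0 <= b' <= b + k -> 0 <= c' <= Q -> 0 <= p' <= p + k ->
  c <= c' + k -> m <= 1 ->
  p ^+ 2 <= (1 - t) * a' ^+ 2 + t * b' ^+ 2 - t * (1 - t) * c' ^+ 2 + m ->
  3 * (k * (2 * Q + 5)) + m <= e ->
  p' ^+ 2 <= (1 - t) * a ^+ 2 + t * b ^+ 2 - t * (1 - t) * c ^+ 2 + e.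
Proof.
move=> /andP[t0 t1] /andP[k0 k1] /andP[a0 aQ] /andP[b0 bQ] c0 p0 /andP[a'0 a'k].
move=> /andP[b'0 b'k] /andP[c'0 c'Q] /andP[p'0 p'k] ck m1 h kQ.
have Q0 : 0 <= Q := le_trans a0 aQ; have u0 : 0 <= 1 - t by rewrite subr_ge0.
have tu : t * (1 - t) <= 1 by rewrite mulr_ile1 // gerBl.
have tu0 : 0 <= t * (1 - t) by rewrite mulr_ge0.
have k01 : 0 <= k <= 1 by rewrite k0.
have ha : a' ^+ 2 <= a ^+ 2 + k * (2 * Q + 1) by apply: sq_le_add; rewrite // a0.
have hb : b' ^+ 2 <= b ^+ 2 + k * (2 * Q + 1) by apply: sq_le_add; rewrite // b0.
have hc : c ^+ 2 <= c' ^+ 2 + k * (2 * Q + 1) by apply: sq_le_add; rewrite // c'0.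
have kQ0 : 0 <= k * (2 * Q + 1) by rewrite mulr_ge0 // addr_ge0 // mulr_ge0.
have sq x y : 0 <= x -> y <= Q -> x <= y + k -> x ^+ 2 <= (Q + 1) ^+ 2.
  move=> x0 yQ xk; rewrite ler_pXn2r ?nnegrE ?addr_ge0 //.
  by apply: le_trans xk _; exact: lerD.
have pQ : p <= Q + 2.
  have := ler_wpM2l u0 (sq _ _ a'0 aQ a'k); have := ler_wpM2l t0 (sq _ _ b'0 bQ b'k).
  have := mulr_ge0 tu0 (sqr_ge0 c') => h1 h2 h3.
  apply: le_of_sqr; first by rewrite addr_ge0.
  move: h h1 h2 h3; clear - Q0 m1.
  by move: (a' ^+ 2) (b' ^+ 2) (c' ^+ 2) (p ^+ 2) => A B C P *; lra.
have hp : p' ^+ 2 <= p ^+ 2 + k * (2 * (Q + 2) + 1) by apply: sq_le_add; rewrite // p0.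
have := ler_wpM2l u0 ha; have := ler_wpM2l t0 hb; have := ler_wpM2l tu0 hc.
have := ler_wpM2r kQ0 tu; move: h hp kQ; clear - k0.
move: (a' ^+ 2) (b' ^+ 2) (c' ^+ 2) (p' ^+ 2) => A' B' C' P'.
move: (a ^+ 2) (b ^+ 2) (c ^+ 2) (p ^+ 2) => A B C P.
by move=> *; lra.
Qed.

Lemma perturb_size (Q e : R) : 0 <= Q -> 0 < e ->
  exists k, [/\ 0 < k, k <= 1 & 3 * (k * (2 * Q + 5)) <= e].
Proof.
move=> Q0 e0; have K0 : 0 < 3 * (2 * Q + 5) by lra.
exists (Num.min 1 (e / (3 * (2 * Q + 5)))); split.
- by rewrite lt_min ltr01 divr_gt0.
- by rewrite ge_min lexx.
- by rewrite mulrCA -ler_pdivlMr // ge_min lexx orbT.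
Qed.

(** [dx] and [dy] are the distances of a point from the ends of a geodesic of length [c], and [du]
    is its distance from the dividing point. CN makes [du] small, since [v] exceeds [c] by at most
    [eta]. *)
Lemma near_midpoint (t D v c eta k du dx dy : R) : 0 <= t <= 1 -> 0 <= D <= c ->
  0 <= v <= D + eta -> 0 <= eta -> 0 <= dx <= t * v -> 0 <= dy <= (1 - t) * v ->
  du ^+ 2 <= (1 - t) * dx ^+ 2 + t * dy ^+ 2 - t * (1 - t) * c ^+ 2 ->
  eta * (2 * D + eta) <= k ^+ 2 -> du ^+ 2 <= k ^+ 2.
Proof.
move=> /andP[t0 t1] /andP[D0 Dc] /andP[v0 vD] eta0 /andP[x0 xv] /andP[y0 yv] hu hk.
have u0 : 0 <= 1 - t by rewrite subr_ge0.
have tt0 : 0 <= t * (1 - t) by rewrite mulr_ge0.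
have tt1 : t * (1 - t) <= 1 by rewrite mulr_ile1 // gerBl.
have hx : dx ^+ 2 <= (t * v) ^+ 2 by rewrite ler_pXn2r ?nnegrE ?mulr_ge0.
have hy : dy ^+ 2 <= ((1 - t) * v) ^+ 2 by rewrite ler_pXn2r ?nnegrE ?mulr_ge0.
have hc : D ^+ 2 <= c ^+ 2 by rewrite ler_pXn2r ?nnegrE // (le_trans D0).
have hv : v ^+ 2 <= (D + eta) ^+ 2 by rewrite ler_pXn2r ?nnegrE ?addr_ge0.
have h5 : 0 <= eta * (2 * D + eta) by rewrite mulr_ge0 ?addr_ge0 ?mulr_ge0.
have := ler_wpM2l u0 hx; have := ler_wpM2l t0 hy.
have := ler_wpM2l tt0 hc; have := ler_wpM2l tt0 hv; have := ler_wpM2r h5 tt1.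
clear - hu hk; lra.
Qed.

(** With error [1 / (n + 1)] and radius [n] the approximations [p n] are Cauchy: eventually each
    [p m] lies in the ball where the inequality for [p n] holds, and that inequality makes them
    close. *)
Lemma complete_approx_cn (Y : Type) (d : Y -> Y -> R) : pseudometric d ->
  (forall u, cauchy_seq d u -> exists y, converges_to d u y) ->
  approx_cn d -> hadamard d.
Proof.
move=> pm cpl acn; split=> // x y t t01; have /andP[t0 t1] := t01.
have pos n : 0 < (n.+1%:R^-1 : R) by rewrite invr_gt0 ltr0n.
have [p hp] := choice (fun n : nat => acn x y t _ n%:R t01 (pos n)).
have D0 := pm_ge0 pm x y.
have px n : d x (p n) ^+ 2 <= t ^+ 2 * d x y ^+ 2 + n.+1%:R^-1.
  have := hp n x; rewrite (pm_refl pm) ler0n => /(_ isT).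
  by move: (n.+1%:R^-1 : R) => a; lra.
have inv1 n : (n.+1%:R^-1 : R) <= 1 by rewrite invf_le1 ?ltr0n // ler1n.
have pxM n : d x (p n) <= d x y + 1.
  apply: le_of_sqr; first by lra.
  apply: le_trans (px n) _; have := inv1 n; move: (n.+1%:R^-1 : R) => a a1.
  have : t ^+ 2 * d x y ^+ 2 <= 1 * d x y ^+ 2.
    by rewrite ler_wpM2r ?sqr_ge0 // expr_le1.
  by nra.
have [n0 hn0] : exists n0 : nat, forall n, (n0 <= n)%N -> d x y + d x y + 1 <= n%:R.
  exists (Num.truncn (d x y + d x y + 1)).+1 => n hn.
  apply: le_trans (ltW (truncnS_gt _)) _; first by rewrite ler_nat.
have py n : (n0 <= n)%N -> d y (p n) ^+ 2 <= (1 - t) ^+ 2 * d x y ^+ 2 + n.+1%:R^-1.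
  move=> nn; have := hp n y; have := hn0 n nn; rewrite (pm_refl pm) (pm_sym pm y x).
  by move=> h /(_ (le_trans _ h)); move: (n.+1%:R^-1 : R) => a; lra.
have [|q hq] := cpl p.
  move=> e e0; have [|N1 h1] := @harmonic_small R (e ^+ 2 / 4).
    by rewrite divr_gt0 ?exprn_gt0.
  exists (maxn n0 N1) => m n; rewrite !geq_max => /andP[m1 m2] /andP[n1 n2].
  have := hp n (p m); rewrite !(pm_sym pm (p m)) => /(_ _).
  have := px m; have := py m m1; have := h1 m m2; have := h1 n n2.
  have := hn0 n n1; have := pxM m.
  move: (m.+1%:R^-1 : R) (n.+1%:R^-1 : R) => a b xM nM b0 a0 ym xm.
  have -> : d x (p m) <= n%:R by lra.
  move=> /(_ isT) h.
  have u0 : 0 <= 1 - t by lra.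
  have := ler_wpM2l u0 xm; have := ler_wpM2l t0 ym => h2 h3.
  rewrite ltNge; apply/negP => ed.
  have : e ^+ 2 <= d (p n) (p m) ^+ 2.
    by rewrite ler_pXn2r // ?nnegrE ?(pm_ge0 pm) // ltW.
  have : 0 < e ^+ 2 by rewrite exprn_gt0.
  nra.
exists q => z; apply/ler_addgt0Pr => e e0.
pose M := d z x + d x y + 1.
have M0 : 0 <= M by rewrite /M; have := pm_ge0 pm z x; lra.
have [del [del0 del1 delM]] : exists del, [/\ 0 < del, del <= 1 & del * (2 * M + 1) <= e / 2].
  have K0 : 0 < 2 * M + 1 by lra.
  exists (Num.min 1 (e / 2 / (2 * M + 1))); split.
  - by rewrite lt_min ltr01 !divr_gt0.
  - by rewrite ge_min lexx.
  - by rewrite -ler_pdivlMr // ge_min lexx orbT.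
have [N1 h1] := hq _ del0; have [|N2 h2] := @harmonic_small R (e / 2); first by lra.
have [n3 hn3] : exists n3 : nat, d z x <= n3%:R.
  by exists (Num.truncn (d z x)).+1; exact: ltW (truncnS_gt _).
pose n := maxn (maxn N1 N2) n3.
have n1 : (N1 <= n)%N by rewrite /n !leq_max leqnn.
have n2 : (N2 <= n)%N by rewrite /n !leq_max leqnn orbT.
have nz : d z x <= n%:R by apply: le_trans hn3 _; rewrite ler_nat /n leq_max leqnn orbT.
have := hp n z nz; have := h2 n n2; have := h1 n n1.
move: (n.+1%:R^-1 : R) => a dn ae hz.
have : d z q ^+ 2 <= d z (p n) ^+ 2 + del * (2 * M + 1).
  apply: sq_le_add; rewrite ?(pm_ge0 pm) ?del1 ?andbT //=; last exact: ltW.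
    by have := pm_tri pm z x (p n); have := pxM n; rewrite /M; lra.
  by have := pm_tri pm z (p n) q; lra.
lra.
Qed.

Lemma approx_cn_dense (Y cY : Type) (d : Y -> Y -> R) (cd : cY -> cY -> R) (i : Y -> cY) :
  pseudometric cd -> (forall x y, cd (i x) (i y) = d x y) ->
  (forall u e, 0 < e -> exists x, cd u (i x) < e) ->
  approx_cn d -> approx_cn cd.
Proof.
move=> pm iso dense acn x y t e M t01 e0.
have D0 := pm_ge0 pm x y; have M0 := normr_ge0 M; have M1 := ler_norm M.
have [k [k0 k1 kQ]] : exists k, [/\ 0 < k, k <= 1 &
    3 * (k * (2 * (`|M| + cd x y + 1) + 5)) <= e / 2].
  by apply: perturb_size; lra.
have k20 : 0 < k / 2 by rewrite divr_gt0.
have [x' hx] := dense x _ k20; have [y' hy] := dense y _ k20.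
have e2 : 0 < Num.min 1 (e / 2) by rewrite lt_min ltr01 divr_gt0.
have [p hp] := acn x' y' t _ (`|M| + 1) t01 e2.
exists (i p) => z zM; have [z' hz] := dense z _ k20.
have xx := pm_tri4 pm (i z') z x (i x'); have yy := pm_tri4 pm (i z') z y (i y').
have dd := pm_tri4 pm x (i x') (i y') y; have zy := pm_tri pm z x y.
have dd' := pm_tri4 pm (i x') x y (i y'); have zp := pm_tri pm z (i z') (i p).
rewrite (pm_sym pm (i z') z) in xx yy; rewrite (pm_sym pm (i y') y) in dd.
rewrite (pm_sym pm (i x') x) in dd'.
have := hp z'; rewrite -!iso (_ : cd _ _ <= _); last by clear - xx hx hz zM M1 k1; lra.
move=> /(_ isT) h; apply: (cn_perturb t01 _ _ _ _ _ _ _ _ _ _ _ h (k := k) (Q := `|M| + cd x y + 1));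
  rewrite ?(pm_ge0 pm) ?(ltW k0) //= ?ge_min ?lexx //.
- by clear - zM M1 D0; lra.
- by clear - zM M1 zy; lra.
- by clear - xx hx hz; lra.
- by clear - yy hy hz; lra.
- by clear - dd' hx hy M0 k1; lra.
- by clear - zp hz k20; lra.
- by clear - dd hx hy; lra.
- have : Num.min 1 (e / 2) <= e / 2 by rewrite ge_min lexx orbT.
  by move: (Num.min _ _) kQ => m; clear; lra.
Qed.

End ApproxCAT0.

(** * Clifford translations and extension of isometries to completions *)

Section Clifford.
Context {R : realType}.

Definition dotv m (v w : 'rV[R]_m) := \sum_i v 0 i * w 0 i.

Record clifford m (Y : Type) (d : Y -> Y -> R) (Psi : 'rV[R]_m -> Y -> Y) : Prop :=
  Clifford {
  cl_iso : forall v x y, d (Psi v x) (Psi v y) = d x y;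
  cl_add : forall v w x, d (Psi (v + w) x) (Psi v (Psi w x)) = 0;
  cl_norm : forall v x, d (Psi v x) x ^+ 2 = dotv v v }.

Section Extension.
Variables (Y cY : Type) (d : Y -> Y -> R) (cd : cY -> cY -> R) (i : Y -> cY).
Hypotheses (pm : pseudometric cd) (iso : forall x y, cd (i x) (i y) = d x y).
Hypothesis dense : forall u e, 0 < e -> exists x, cd u (i x) < e.
Hypothesis cpl : forall u, cauchy_seq cd u -> exists y, converges_to cd u y.

(** The extension is described by its distances to the dense image, which determine [g u] up to
    distance 0; identities between extensions then need no sequences. *)
Definition extends (f : Y -> Y) (g : cY -> cY) :=
  forall u x, cd (g u) (i (f x)) = cd u (i x).

Lemma extends_exists f : (forall x y, d (f x) (f y) = d x y) -> exists g, extends f g.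
Proof.
move=> fi; suff ex u : exists w, forall x, cd w (i (f x)) = cd u (i x).
  by have [g hg] := choice ex; exists g => u x.
have pos n : 0 < (n.+1%:R^-1 : R) by rewrite invr_gt0 ltr0n.
have [x hx] := choice (fun n => dense u (pos n)).
have [|w hw] := cpl (u := fun n => i (f (x n))).
  move=> e e0; have [|N hN] := @harmonic_small R (e / 2); first by lra.
  exists N => m n /hN hm /hN hn; rewrite iso fi -iso.
  have := lt_trans (hx m) hm; have := lt_trans (hx n) hn.
  by have := pm_tri pm (i (x m)) u (i (x n)); rewrite (pm_sym pm _ u); lra.
exists w => y; apply/eqP; rewrite -subr_eq0 -normr_le0.
apply/ler_addgt0Pr => e e0; rewrite add0r.
have [|N hN] := @harmonic_small R (e / 2); first by lra.
have [|N' hN'] := hw (e / 2); first by lra.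
pose n := maxn N N'; have h1 := lt_trans (hx n) (hN n (leq_maxl _ _)).
have h2 := hN' n (leq_maxr _ _).
have : cd (i (f (x n))) (i (f y)) = cd (i (x n)) (i y) by rewrite !iso.
have := pm_dist pm (i (f (x n))) w (i (f y)); have := pm_dist pm u (i (x n)) (i y).
rewrite ler_norml => /andP[a b]; rewrite ler_norml => /andP[a' b'] E.
by rewrite ler_norml; apply/andP; split; lra.
Qed.

Lemma extends_iso f g u v : extends f g -> cd (g u) (g v) = cd u v.
Proof.
move=> fg; apply/eqP; rewrite -subr_eq0 -normr_le0.
apply/ler_addgt0Pr => e e0; rewrite add0r.
have [|x hx] := dense v (e := e / 2); first by lra.
have h1 := pm_dist pm (g v) (i (f x)) (g u); have h2 := pm_dist pm v (i x) u.
rewrite fg !(pm_sym pm _ (g u)) fg in h1; rewrite !(pm_sym pm _ u) in h2.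
rewrite ler_norml; move: h1 h2; rewrite ler_norml => /andP[a b].
rewrite ler_norml => /andP[a' b'].
by apply/andP; split; lra.
Qed.

Lemma extends_eq f f' g g' u : extends f g -> extends f' g' ->
  (forall x, d (f x) (f' x) = 0) -> cd (g u) (g' u) = 0.
Proof.
move=> fg fg' ff; apply: pm_eq0_le => // e e0.
have [|x hx] := dense u (e := e / 2); first by lra.
have := pm_tri4 pm (g u) (i (f x)) (i (f' x)) (g' u).
by rewrite fg (pm_sym pm (i (f' x))) fg' iso ff; lra.
Qed.

Lemma extends_comp f f' g g' : extends f g -> extends f' g' ->
  extends (fun x => f (f' x)) (fun u => g (g' u)).
Proof. by move=> fg fg' u x; rewrite fg fg'. Qed.

Lemma extends_id : extends id id. Proof. by []. Qed.

Lemma extends_disp f g c u : extends f g -> (forall x, d (f x) x = c) -> cd (g u) u = c.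
Proof.
move=> fg fc; apply/eqP; rewrite -subr_eq0 -normr_le0.
apply/ler_addgt0Pr => e e0; rewrite add0r.
have [|x hx] := dense u (e := e / 2); first by lra.
have := pm_tri4 pm (g u) (i (f x)) (i x) u; have := pm_tri4 pm (i (f x)) (g u) u (i x).
rewrite iso fc !(pm_sym pm (i _) _) fg => *.
by rewrite ler_norml; apply/andP; split; lra.
Qed.

End Extension.
End Clifford.

Section CompletionHSpace.
Context {R : realType} {G : groupType}.
Variables (H : set G) (S : seq G) (N : set_system G) (eps : R).
Hypothesis FN : Filter N.
Variables (X : Type) (dX : X -> X -> R).
Hypothesis HS : forall s, s \in S -> H s.
Hypothesis HG : H 1%g /\ forall g h, H g -> H h -> H (g * h)%g.

(** If all the finitely many generators moved a point by less than [eps], a common margin would be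
    left; hence [moving] survives approximation. *)
Lemma finite_gap (I : eqType) (s : seq I) (f : I -> R) (c : R) :
  (forall i, i \in s -> f i < c) ->
  exists2 e, 0 < e & forall i, i \in s -> f i + e < c.
Proof.
elim: s => [|i s IH] h; first by exists 1.
have [j js|e e0 he] := IH; first by apply: h; rewrite inE js orbT.
have hi : f i < c by apply: h; rewrite inE eqxx.
exists (Num.min e ((c - f i) / 2)).
  by rewrite lt_min e0 /=; lra.
move=> j; rewrite inE => /orP[/eqP -> | js].
  have : Num.min e ((c - f i) / 2) <= (c - f i) / 2 by rewrite ge_min lexx orbT.
  lra.
have : Num.min e ((c - f i) / 2) <= e by rewrite ge_min lexx.
by have := he j js; lra.
Qed.

Lemma pairs_bounded n (f : nat -> nat -> R) :
  exists M, forall i j, (i < n)%N -> (j < n)%N -> f i j <= M.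
Proof.
exists (\big[Num.max/0]_(i < n) \big[Num.max/0]_(j < n) f i j) => i j iN jN.
apply: le_trans (le_bigmax _ _ (Ordinal iN)).
exact: le_trans (le_bigmax _ (fun j : 'I_n => f i j) (Ordinal jN)).
Qed.

Lemma completion_hspace m k (Z : Type) (d : Z -> Z -> R) (act : G -> Z -> Z)
    (Psi : 'rV[R]_m -> Z -> Z) :
  pseudometric d -> approx_cn d -> isom_action H N d act ->
  finitely_represented dX k d -> moving S eps d act -> clifford d Psi ->
  (forall h v x, H h -> d (Psi v (act h x)) (act h (Psi v x)) = 0) ->
  exists (Y : Type) (i : Z -> Y) (d' : Y -> Y -> R) (act' : G -> Y -> Y)
    (Psi' : 'rV[R]_m -> Y -> Y),
    [/\ hspace H S N eps dX k d' act', clifford d' Psi' &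
     forall h v x, H h -> d' (Psi' v (act' h x)) (act' h (Psi' v x)) = 0].
Proof.
move=> pm acn ia fr mv cl com.
have [Y [cd [i [pmc iso dense cpl]]]] := completion_exists pm.
have exa h : exists g, H h -> extends cd i (act h) g.
  have [Hh|nH] := pselect (H h); last by exists id.
  have [|g hg] := extends_exists pmc iso dense cpl (f := act h).
    by move=> x y; rewrite (ia_iso ia).
  by exists g.
have [act' ea] := choice exa.
have exP v := extends_exists pmc iso dense cpl (cl_iso cl v).
have [Psi' eP] := choice exP.
exists Y, i, cd, act', Psi'; split.
- split.
  + apply: complete_approx_cn => //.
    exact: approx_cn_dense pmc iso dense acn.
  + split.
    * by move=> h x y Hh; exact: (extends_iso pmc dense _ _ (ea h Hh)).
    * have H1 := HG.1; move=> x.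
      apply: (extends_eq pmc iso dense x (ea _ H1) (extends_id _ _)) => y.
      exact: (ia_1 ia).
    * move=> g h x Hg Hh; have Hgh := HG.2 _ _ Hg Hh.
      apply: (extends_eq pmc iso dense x (ea _ Hgh) (extends_comp (ea _ Hg) (ea _ Hh))) => y.
      exact: (ia_M ia).
    * move=> x e e0; have e3 : 0 < e / 3 by lra.
      have [y hy] := dense x _ e3.
      apply: filterS (ia_cts ia y e3) => h /= hh Hh.
      have := pm_tri4 pmc (act' h x) (i (act h y)) (i y) x.
      by rewrite (ea h Hh) iso (pm_sym pmc (i y) x); have := hh Hh; lra.
  + move=> n y v e e0.
    have [M hM] := pairs_bounded n (fun a b => cd (y a) (y b)).
    have K0 : 0 < 2 * `|M| + 1 by have := normr_ge0 M; lra.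
    pose del := Num.min (1 / 2) (e / 4 / (2 * `|M| + 1)).
    have del0 : 0 < del by rewrite lt_min !divr_gt0.
    have del1 : del <= 1 / 2 by rewrite ge_min lexx.
    have del2 : del * (2 * `|M| + 1) <= e / 4.
      by rewrite -ler_pdivlMr // ge_min lexx orbT.
    have [z hz] := choice (fun a => dense (y a) _ del0).
    have [|x hx] := fr n z v (e / 2); first by lra.
    exists x => a b aN bN; have := hx a b aN bN.
    have : `|cd (y a) (y b) ^+ 2 - d (z a) (z b) ^+ 2| <= (2 * del) * (2 * `|M| + 1).
      apply: sq_close; rewrite ?(pm_ge0 pm) ?(pm_ge0 pmc) //=; last by lra.
        by have := hM a b aN bN; have := ler_norm M; lra.
      rewrite -iso; have := hz a; have := hz b.
      have := pm_tri4 pmc (y a) (i (z a)) (i (z b)) (y b).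
      have := pm_tri4 pmc (i (z a)) (y a) (y b) (i (z b)).
      rewrite (pm_sym pmc (i (z b)) (y b)) (pm_sym pmc (i (z a)) (y a)) => *.
      by rewrite ler_norml; apply/andP; split; lra.
    rewrite ler_norml => /andP[a1 a2]; rewrite ler_norml => /andP[a3 a4].
    by rewrite ler_norml; apply/andP; split; lra.
  + move=> y; apply: contrapT => nmv.
    have lt s : s \in S -> cd (act' s y) y < eps.
      by move=> sS; rewrite ltNge; apply/negP => h; apply: nmv; exists s.
    have [e e0 he] := finite_gap lt.
    have [|x hx] := dense y (e / 2); first by lra.
    have [s sS hs] := mv x.
    have := pm_tri4 pmc (i (act s x)) (act' s y) y (i x).
    rewrite iso (pm_sym pmc (i _) (act' _ _)) (ea s (HS sS)).
    by have := he s sS; lra.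
- split.
  + by move=> v x y; exact: (extends_iso pmc dense _ _ (eP v)).
  + move=> v w x; apply: (extends_eq pmc iso dense x (eP _) (extends_comp (eP _) (eP _))) => y.
    exact: (cl_add cl).
  + move=> v x.
    have nn : 0 <= dotv v v by rewrite sumr_ge0 // => j _; rewrite -expr2 sqr_ge0.
    have disp y : d (Psi v y) y = Num.sqrt (dotv v v).
      by rewrite -(cl_norm cl v y) sqrtr_sqr ger0_norm // pm_ge0.
    by rewrite (extends_disp pmc iso dense x (eP v) disp) sqr_sqrtr.
- move=> h v x Hh.
  apply: (extends_eq pmc iso dense x (extends_comp (eP v) (ea h Hh)) (extends_comp (ea h Hh) (eP v))) => y.
  exact: com.
Qed.

End CompletionHSpace.

(** * Direct limit along a flow *)

Section Eventually.
Context {R : realType}.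

Definition eventually_le (P : R -> Prop) := exists T0, forall T, T0 <= T -> P T.

Lemma eventually_le_and P Q : eventually_le P -> eventually_le Q ->
  eventually_le (fun T => P T /\ Q T).
Proof.
move=> [a ha] [b hb]; exists (Num.max a b) => T; rewrite ge_max => /andP[aT bT].
by split; [exact: ha|exact: hb].
Qed.

Lemma eventually_le_all n (P : nat -> R -> Prop) :
  (forall i, (i < n)%N -> eventually_le (P i)) ->
  eventually_le (fun T => forall i, (i < n)%N -> P i T).
Proof.
elim: n => [|n IH] h; first by exists 0.
have [|T0 h0] := IH; first by move=> i /ltnW; exact: h.
have [T1 h1] := h n (leqnn _).
exists (Num.max T0 T1) => T; rewrite ge_max => /andP[t0 t1] i.
by rewrite ltnS leq_eqVlt => /orP[/eqP -> |]; [exact: h1|exact: h0].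
Qed.

Lemma eventually_le_seq (I : eqType) (s : seq I) (P : I -> R -> Prop) :
  (forall i, i \in s -> eventually_le (P i)) ->
  eventually_le (fun T => forall i, i \in s -> P i T).
Proof.
elim: s => [|i s IH] h; first by exists 0.
have [|T0 h0] := IH; first by move=> j js; apply: h; rewrite inE js orbT.
have [T1 h1] := h i (mem_head _ _).
exists (Num.max T0 T1) => T; rewrite ge_max => /andP[t0 t1] j.
by rewrite inE => /orP[/eqP -> |]; [exact: h1|exact: h0].
Qed.

End Eventually.

Section DirectLimit.
Context {R : realType} {G : groupType}.
Variables (H : set G) (S : seq G) (N : set_system G) (eps : R).
Hypothesis FN : Filter N.
Variables (X : Type) (dX : X -> X -> R).
Hypothesis HS : forall s, s \in S -> H s.
Variables (k : nat) (Y : Type) (d : Y -> Y -> R) (act : G -> Y -> Y).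
Hypothesis hY : hspace H S N eps dX k d act.
Let hd := hs_hd hY.
Let pm := hd_pm hd.
Let ia := hs_act hY.
Variable phi : R -> Y -> Y.
Hypothesis fl : semiflow d phi.
Hypothesis com : forall h x t, H h -> 0 <= t ->
  d (act h (phi t x)) (phi t (act h x)) = 0.

(* [(x, a)] stands for the possibly virtual point [phi a x]. *)
Let Z := (Y * R)%type.
Implicit Types p q : Z.

(** Flowing by [T] has to make both times nonnegative, which is [ok T]. The flow is nonexpansive, so
    [val] decreases in [T] and its limit is the infimum [delta]. *)
Let val T p q := d (phi (T + p.2) p.1) (phi (T + q.2) q.1).
Let ok T p q := 0 <= T + p.2 /\ 0 <= T + q.2.

Let val_mono T T' p q : ok T p q -> T <= T' -> val T' p q <= val T p q.
Proof.
move=> [a b] TT; have u0 : 0 <= T' - T by rewrite subr_ge0.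
have e c : T' + c = (T' - T) + (T + c) by ring.
rewrite /val (e p.2) (e q.2) (pm_eq0l pm _ (sf_add fl _ u0 a)) (pm_eq0r pm _ (sf_add fl _ u0 b)).
exact: (sf_nonexp fl).
Qed.

Let delta p q := inf [set val T p q | T in [set T | ok T p q]].

Let delta_has_inf p q : has_inf [set val T p q | T in [set T | ok T p q]].
Proof.
split; last by exists 0 => _ [T _ <-]; exact: (pm_ge0 pm).
pose T := `|p.2| + `|q.2|; exists (val T p q), T => //; split.
  by have := ler_norm (- p.2); have := normr_ge0 q.2; rewrite normrN /T; lra.
by have := ler_norm (- q.2); have := normr_ge0 p.2; rewrite normrN /T; lra.
Qed.

Let delta_le T p q : ok T p q -> delta p q <= val T p q.
Proof.
by move=> okT; apply: ge_inf; [case: (delta_has_inf p q)|exists T].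
Qed.

Let delta_ap p q e : 0 < e ->
  eventually_le (fun T => ok T p q /\ val T p q <= delta p q + e).
Proof.
move=> e0; have [_ [T okT <-] hT] := inf_adherent e0 (delta_has_inf p q).
exists T => T' TT'; split; last by apply: le_trans (val_mono okT TT') (ltW hT).
by case: okT => *; split; lra.
Qed.

Let delta_ge c p q : eventually_le (fun T => c <= val T p q) -> c <= delta p q.
Proof.
move=> h; apply/ler_addgt0Pr => e e0.
have [T hT] := eventually_le_and h (delta_ap p q e0).
have [? [_ ?]] := hT _ (lexx _); lra.
Qed.

Let delta_le_ev c p q : (forall e, 0 < e -> eventually_le (fun T => val T p q <= c + e)) ->
  delta p q <= c.
Proof.
move=> h; apply/ler_addgt0Pr => e e0.
have [T hT] := eventually_le_and (h e e0) (delta_ap p q ltr01).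
by have [? [okT _]] := hT _ (lexx _); apply: le_trans (delta_le okT) _.
Qed.

Let delta_ge0 p q : 0 <= delta p q.
Proof. by apply: delta_ge; exists 0 => T _; exact: (pm_ge0 pm). Qed.

Let delta_sym_le p q : delta p q <= delta q p.
Proof.
apply: delta_le_ev => e /(delta_ap q p) [T hT].
by exists T => T' /hT [_]; rewrite /val (pm_sym pm).
Qed.

Let delta_pm : pseudometric delta.
Proof.
split=> [p|p q|p q r].
- apply/le_anti; rewrite delta_ge0 andbT; apply: delta_le_ev => e e0.
  by exists 0 => T _; rewrite /val (pm_refl pm); lra.
- by apply/le_anti; rewrite !delta_sym_le.
- apply: delta_le_ev => e e0; have e2 : 0 < e / 2 by lra.
  have [T hT] := eventually_le_and (delta_ap p q e2) (delta_ap q r e2).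
  exists T => T' /hT [[_ h1] [_ h2]].
  apply: le_trans (pm_tri pm _ (phi (T' + q.2) q.1) _) _.
  by rewrite /val in h1 h2; lra.
Qed.

Let delta_cn : approx_cn delta.
Proof.
move=> x y t e M t01 e0; have /andP[t0 t1] := t01.
have D0 := delta_ge0 x y; have M0 := normr_ge0 M; have M1 := ler_norm M.
have [kap [k0 k1 kQ]] : exists k', [/\ 0 < k', k' <= 1 &
    3 * (k' * (2 * (`|M| + delta x y + 1) + 5)) <= e].
  by apply: perturb_size; rewrite ?addr_ge0.
have [eta [eta0 eta1 etaD]] : exists eta, [/\ 0 < eta, eta <= 1 &
    eta * (2 * delta x y + eta) <= kap ^+ 2].
  have DD : 0 < 2 * delta x y + 1 by rewrite ltr_wpDl ?mulr_ge0.
  exists (Num.min 1 (kap ^+ 2 / (2 * delta x y + 1))).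
  have m0 : 0 < Num.min 1 (kap ^+ 2 / (2 * delta x y + 1)).
    by rewrite lt_min ltr01 divr_gt0 ?exprn_gt0.
  have m1 : Num.min 1 (kap ^+ 2 / (2 * delta x y + 1)) <= 1 by rewrite ge_min lexx.
  split=> //; apply: le_trans (_ : _ <= Num.min 1 (kap ^+ 2 / (2 * delta x y + 1)) * (2 * delta x y + 1)) _.
    by rewrite ler_pM2l // lerD2l.
  by rewrite -ler_pdivlMr // ge_min lexx orbT.
have [T hT] := delta_ap x y eta0; have [[Tx Ty] vT] := hT _ (lexx _).
pose p := geo hd (phi (T + x.2) x.1) (phi (T + y.2) y.1) t.
(* [p] is a point of stage [T], so in the limit it represents the point that reaches [p] after time
   [T]. *)
exists (p, - T) => z zM.
have [V hV] := eventually_le_and (delta_ap x y eta0)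
  (eventually_le_and (delta_ap z x k0) (delta_ap z y k0)).
pose V' := Num.max T V.
have VT : T <= V' by rewrite le_max lexx.
have VV : V <= V' by rewrite le_max lexx orbT.
have [[okxy vxy] [[okzx vzx] [okzy vzy]]] := hV _ VV.
have lxy := delta_le okxy; rewrite /val in lxy vxy vzx vzy.
set w := phi (V' + z.2) z.1 in vzx vzy; set u := phi (V' - T) p.
set xV := phi (V' + x.2) x.1 in lxy vxy vzx.
set yV := phi (V' + y.2) y.1 in lxy vxy vzy.
pose pV := geo hd xV yV t.
have u0 : 0 <= V' - T by rewrite subr_ge0.
have ux : d u xV <= t * val T x y.
  rewrite /xV; have -> : V' + x.2 = (V' - T) + (T + x.2) by ring.
  rewrite (pm_eq0r pm _ (sf_add fl _ u0 Tx)); apply: le_trans (sf_nonexp fl _ _ u0) _.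
  by rewrite (pm_sym pm) geo_l.
have uy : d u yV <= (1 - t) * val T x y.
  rewrite /yV; have -> : V' + y.2 = (V' - T) + (T + y.2) by ring.
  rewrite (pm_eq0r pm _ (sf_add fl _ u0 Ty)); apply: le_trans (sf_nonexp fl _ _ u0) _.
  by rewrite geo_r.
(* At the later stage [V'] the image [u] of [p] is at most as far from the ends [xV], [yV] as [p]
   was at stage [T], whose length exceeds the present one by at most [eta]. *)
have up : d u pV <= kap.
  apply: le_of_sqr; first exact: ltW.
  apply: (near_midpoint t01 _ _ (ltW eta0) _ _ (geo_cn hd xV yV u t01) etaD (v := val T x y));
    by rewrite ?(pm_ge0 pm) ?D0.
have zp : delta z (p, - T) <= d w u.
  by apply: (delta_le (T := V')); split => //=; case: okzx.
have zy := pm_tri delta_pm z x y; have wp := pm_tri pm w pV u.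
rewrite (pm_sym pm pV u) in wp.
apply: (cn_perturb t01 _ _ _ D0 _ _ _ _ _ _ ler01 _ _ (a' := d w xV) (b' := d w yV)
  (c' := d xV yV) (p := d w pV) (k := kap) (Q := `|M| + delta x y + 1) (m := 0));
  rewrite ?(pm_ge0 pm) ?delta_ge0 ?(ltW k0) //= ?addr0 //.
- lra.
- lra.
- lra.
- lra.
- lra.
- exact: (geo_cn hd xV yV w t01).
Qed.

Let zact h p : Z := (act h p.1, p.2).
Let zflow (v : 'rV[R]_1) p : Z := (p.1, p.2 + v 0 0).

Let zact_val T h p q : H h -> ok T p q -> val T (zact h p) (zact h q) = val T p q.
Proof.
move=> Hh [a b]; rewrite /val /= -(pm_eq0l pm _ (com _ Hh a)).
by rewrite -(pm_eq0r pm _ (com _ Hh b)) (ia_iso ia).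
Qed.

(** In the limit the flow is the shift of the time coordinate, hence invertible, and [H] acts on the
    other coordinate. *)
Lemma direct_limit_hspace : H 1%g -> (forall g h, H g -> H h -> H (g * h)%g) ->
  exists (Y' : Type) (i : Z -> Y') (d' : Y' -> Y' -> R) (act' : G -> Y' -> Y')
    (Psi : 'rV[R]_1 -> Y' -> Y'),
    [/\ hspace H S N eps dX k d' act', clifford d' Psi &
     forall h v x, H h -> d' (Psi v (act' h x)) (act' h (Psi v x)) = 0].
Proof.
move=> H1 HM.
apply: (completion_hspace FN HS (conj H1 HM) (d := delta) (act := zact) (Psi := zflow)) => //.
- split=> [h p q Hh|p|g h p Hg Hh|p e e0].
  + apply/le_anti/andP; split.
      apply: delta_le_ev => e /(delta_ap p q)[T hT].
      by exists T => T' /hT [okT]; rewrite zact_val.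
    apply: delta_ge; have [T hT] := delta_ap p q ltr01.
    by exists T => T' /hT [okT _]; rewrite zact_val //; exact: delta_le.
  + apply/le_anti; rewrite delta_ge0 andbT; apply: delta_le_ev => e e0.
    have [T hT] := delta_ap p p e0; exists T => T' /hT [[okT _] _].
    rewrite /val /=; apply: le_trans (sf_nonexp fl _ _ okT) _.
    by rewrite (ia_1 ia); lra.
  + apply/le_anti; rewrite delta_ge0 andbT; apply: delta_le_ev => e e0.
    have [T hT] := delta_ap p p e0; exists T => T' /hT [[okT _] _].
    rewrite /val /=; apply: le_trans (sf_nonexp fl _ _ okT) _.
    by rewrite (ia_M ia) //; lra.
  + apply: filterS (ia_cts ia p.1 e0) => h /= hh Hh.
    apply: le_lt_trans (hh Hh); apply: delta_le_ev => e' e'0.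
    have [T hT] := delta_ap p p e'0; exists T => T' /hT [[okT _] _].
    rewrite /val /=; apply: le_trans (sf_nonexp fl _ _ okT) _; lra.
- move=> n z v e e0.
  have [M hM] := pairs_bounded n (fun a b => delta (z a) (z b)).
  have K0 : 0 < 2 * `|M| + 1 by have := normr_ge0 M; lra.
  pose k0 := Num.min 1 (e / 2 / (2 * `|M| + 1)).
  have kp : 0 < k0 by rewrite lt_min ltr01 !divr_gt0.
  have k1 : k0 <= 1 by rewrite ge_min lexx.
  have kM : k0 * (2 * `|M| + 1) <= e / 2 by rewrite -ler_pdivlMr // ge_min lexx orbT.
  (* At one late stage all the finitely many distances are nearly those of the limit, so the
     configuration already occurs in [Y]. *)
  have [T hT] : eventually_le (fun T => forall a, (a < n)%N -> forall b, (b < n)%N ->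
      ok T (z a) (z b) /\ val T (z a) (z b) <= delta (z a) (z b) + k0).
    by apply: eventually_le_all => a _; apply: eventually_le_all => b _; exact: delta_ap.
  have [|x hx] := hs_fr hY n (fun a => phi (T + (z a).2) (z a).1) v (e := e / 2).
    by lra.
  exists x => a b aN bN; have := hx a b aN bN.
  have [okT vT] := hT T (lexx _) a aN b bN; have lT := delta_le okT.
  have : `|delta (z a) (z b) ^+ 2 - val T (z a) (z b) ^+ 2| <= k0 * (2 * `|M| + 1).
    apply: sq_close; rewrite ?delta_ge0 ?(pm_ge0 pm) //=.
      by have := hM a b aN bN; have := ler_norm M; lra.
    by rewrite ler_norml; apply/andP; split; lra.
  rewrite ler_norml => /andP[a1 a2]; rewrite ler_norml => /andP[a3 a4].
  by rewrite ler_norml; rewrite /val in a1 a2; apply/andP; split; lra.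
- move=> p; apply: contrapT => nmv.
  have lt s : s \in S -> delta (zact s p) p < eps.
    by move=> sS; rewrite ltNge; apply/negP => h; apply: nmv; exists s.
  have [e e0 he] := finite_gap lt.
  have [T hT] := eventually_le_seq (s := S) (fun s _ => delta_ap (zact s p) p e0).
  have [s sS hs] := hs_moving hY (phi (T + p.2) p.1).
  have [[ok1 ok2] vT] := hT T (lexx _) s sS.
  have := he s sS; rewrite /val /= in vT.
  by rewrite (pm_eq0l pm _ (com _ (HS sS) ok2)) in hs; lra.
- split.
  + move=> v p q; apply/le_anti/andP; split.
      apply: delta_le_ev => e /(delta_ap p q)[T hT]; exists (T - v 0 0) => T' TT.
      have [|okT] := hT (T' + v 0 0); first by lra.
      by rewrite /val /= -!addrA ![v 0 0 + _]addrC.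
    apply: delta_ge; have [T hT] := delta_ap p q ltr01; exists (T - v 0 0) => T' TT.
    have [|okT _] := hT (T' + v 0 0); first by lra.
    have := delta_le okT.
    by rewrite /val /= -!addrA ![v 0 0 + _]addrC.
  + move=> v w p; rewrite /zflow /= mxE [v 0 0 + _]addrC addrA.
    exact: (pm_refl delta_pm).
  + move=> v p; rewrite /dotv big_ord1 -expr2 -[RHS]real_normK ?num_real //.
    congr (_ ^+ 2); apply/le_anti/andP; split.
      apply: delta_le_ev => e e0; have [T hT] := delta_ap (zflow v p) p e0.
      exists T => T' /hT [[a b] _]; rewrite /val (sf_speed fl) //= opprD.
      by rewrite [X in `|X|](_ : _ = v 0 0); [lra|ring].
    apply: delta_ge; have [T hT] := delta_ap (zflow v p) p ltr01.
    exists T => T' /hT [[a b] _]; rewrite /val (sf_speed fl) //= opprD.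
    by rewrite [X in _ <= `|X|](_ : _ = v 0 0); [lra|ring].
- by move=> h v p Hh; exact: (pm_refl delta_pm).
Qed.

End DirectLimit.

(** * Quotient by Clifford translations *)

Section Dotv.
Context {R : realType} {m : nat}.
Implicit Types v w : 'rV[R]_m.

Lemma dotvC v w : dotv v w = dotv w v.
Proof. by apply: eq_bigr => i _; rewrite mulrC. Qed.

Lemma dotvDl v v' w : dotv (v + v') w = dotv v w + dotv v' w.
Proof. by rewrite -big_split; apply: eq_bigr => i _; rewrite mxE mulrDl. Qed.

Lemma dotvZl a v w : dotv (a *: v) w = a * dotv v w.
Proof. by rewrite /dotv mulr_sumr; apply: eq_bigr => i _; rewrite mxE mulrA. Qed.

Lemma dotvNl v w : dotv (- v) w = - dotv v w.
Proof. by rewrite -scaleN1r dotvZl mulN1r. Qed.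

Lemma dotvDr v w w' : dotv v (w + w') = dotv v w + dotv v w'.
Proof. by rewrite !(dotvC v) dotvDl. Qed.

Lemma dotvZr a v w : dotv v (a *: w) = a * dotv v w.
Proof. by rewrite !(dotvC v) dotvZl. Qed.

Lemma dotvNr v w : dotv v (- w) = - dotv v w.
Proof. by rewrite !(dotvC v) dotvNl. Qed.

Lemma dotv_ge0 v : 0 <= dotv v v.
Proof. by rewrite sumr_ge0 // => i _; rewrite -expr2 sqr_ge0. Qed.

Lemma dotv0l v : dotv 0 v = 0.
Proof. by rewrite /dotv big1 // => i _; rewrite mxE mul0r. Qed.

Lemma dotv_delta i v : dotv (delta_mx 0 i) v = v 0 i.
Proof.
rewrite /dotv (bigD1 i) //= mxE !eqxx mul1r big1 ?addr0 // => j ji.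
by rewrite mxE (negPf ji) andbF mul0r.
Qed.

Lemma dotv_eq0 v : dotv v v = 0 -> v = 0.
Proof.
move=> v0; apply/rowP => i; rewrite mxE.
have /psumr_eq0P : \sum_j v 0 j * v 0 j = 0 := v0.
move=> /(_ (fun j _ => _)) h.
have hh : v 0 i * v 0 i = 0 by apply: h => // j; rewrite -expr2 sqr_ge0.
by apply/eqP; rewrite -(orbb (_ == 0)) -mulf_eq0 hh.
Qed.

End Dotv.

Section CliffordFlows.
Context {R : realType} (Y : Type) (d : Y -> Y -> R) (hd : hadamard d).
Let pm := hd_pm hd.
Variables (m : nat) (Psi : 'rV[R]_m -> Y -> Y).
Hypothesis cl : clifford d Psi.
Implicit Types v w : 'rV[R]_m.

Definition cflow v (t : R) := Psi (t *: v).

Lemma cl_0 x : d (Psi 0 x) x = 0.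
Proof. by apply/eqP; rewrite -sqrf_eq0 (cl_norm cl) dotv0l. Qed.

Lemma cl_dist2 v w x : d (Psi v x) (Psi w x) ^+ 2 = dotv (v - w) (v - w).
Proof.
have {1}-> : v = w + (v - w) by rewrite addrC subrK.
by rewrite (pm_eq0l pm _ (cl_add cl _ _ _)) (cl_iso cl) (cl_norm cl).
Qed.

Lemma cflow_isoflow v : isoflow d (Num.sqrt (dotv v v)) (cflow v).
Proof.
split=> [x s t _ _|x y t _|x s t _ _|x]; rewrite /cflow.
- apply/eqP; rewrite -(@eqrXn2 _ 2) ?mulr_ge0 ?sqrtr_ge0 ?(pm_ge0 pm) //.
  rewrite cl_dist2 -scalerBl dotvZl dotvZr exprMn sqr_sqrtr ?dotv_ge0 //.
  by rewrite real_normK ?num_real //; apply/eqP; ring.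
- exact: (cl_iso cl).
- by rewrite scalerDl; exact: (cl_add cl).
- by rewrite scale0r; exact: cl_0.
Qed.

Definition cbeta v x y := busemann d (cflow v) x y.

Lemma cl_dist v x y :
  d (Psi v x) y ^+ 2 = dotv v v - 2 * cbeta v x y + d x y ^+ 2.
Proof.
have := busemann_fwd hd (cflow_isoflow v) x y ler01.
rewrite {1}/cflow scale1r => ->.
by rewrite !mulr1 sqr_sqrtr ?dotv_ge0.
Qed.

Lemma cbeta_add v x y z : cbeta v x z = cbeta v x y + cbeta v y z.
Proof. exact: (busemann_add hd (cflow_isoflow v)). Qed.

Lemma cbeta_eq0 v x y : d x y = 0 -> cbeta v x y = 0.
Proof. exact: (busemann_eq0 hd (cflow_isoflow v)). Qed.

Lemma cbeta_anti v x y : cbeta v y x = - cbeta v x y.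
Proof. exact: (busemann_anti hd (cflow_isoflow v)). Qed.

Lemma cbeta_along v w x : cbeta v (Psi w x) x = - dotv v w.
Proof.
have := cl_dist v (Psi w x) x; rewrite (cl_norm cl w x).
rewrite -(pm_eq0l pm _ (cl_add cl v w x)) (cl_norm cl).
by rewrite !dotvDl !dotvDr (dotvC w v); lra.
Qed.

Lemma cbetaD v w x y : cbeta (v + w) x y = cbeta v x y + cbeta w x y.
Proof.
have h1 := cl_dist (v + w) x y; have h2 := cl_dist v (Psi w x) y.
rewrite (pm_eq0l pm _ (cl_add cl v w x)) h2 (cl_dist w x y) in h1.
rewrite (cbeta_add v _ x) cbeta_along in h1.
by move: h1; rewrite !dotvDl !dotvDr (dotvC w v); lra.
Qed.

Lemma cbeta0 x y : cbeta 0 x y = 0.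
Proof. by have := cbetaD 0 0 x y; rewrite addr0; lra. Qed.

Lemma cbetaN v x y : cbeta (- v) x y = - cbeta v x y.
Proof. by have := cbetaD v (- v) x y; rewrite subrr cbeta0; lra. Qed.

Lemma cbetaZ a v x y : cbeta (a *: v) x y = a * cbeta v x y.
Proof.
wlog a0 : a / 0 <= a.
  move=> h; have [|/ltW a0] := leP 0 a; first exact: h.
  have := h (- a); rewrite scaleNr cbetaN => /(_ _).
  by rewrite oppr_ge0 => /(_ a0); lra.
have h1 := busemann_fwd hd (cflow_isoflow v) x y a0.
have h2 := cl_dist (a *: v) x y; rewrite -/(cflow v a) h1 in h2.
move: h2; rewrite -/(cbeta v x y) exprMn sqr_sqrtr ?dotv_ge0 // dotvZl dotvZr.
by move=> h; lra.
Qed.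

(** The component of [y - x] along [R^m], read off from the Busemann cocycles of the basis
    vectors. *)
Definition wvec x y : 'rV[R]_m := \row_i cbeta (delta_mx 0 i) x y.

Lemma cbeta_dot v x y : cbeta v x y = dotv v (wvec x y).
Proof.
rewrite {1}(row_sum_delta v).
rewrite (big_morph (fun v => cbeta v x y) (fun v w => cbetaD v w x y) (cbeta0 x y)).
by apply: eq_bigr => i _; rewrite cbetaZ mxE.
Qed.

Lemma wvec_add x y z : wvec x z = wvec x y + wvec y z.
Proof. by apply/rowP => i; rewrite !mxE; exact: cbeta_add. Qed.

Lemma wvec_anti x y : wvec y x = - wvec x y.
Proof. by apply/rowP => i; rewrite !mxE; exact: cbeta_anti. Qed.

Lemma wvec_eq0 x y : d x y = 0 -> wvec x y = 0.
Proof. by move=> xy; apply/rowP => i; rewrite !mxE; exact: cbeta_eq0. Qed.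

(** The distance between the [R^m]-orbits of [x] and [y]: by the Pythagorean identity
    [cl_dist_split], translation by [wvec x y] is the best one. *)
Definition qdist x y := d (Psi (wvec x y) x) y.

Lemma cl_dist_split v x y :
  d (Psi v x) y ^+ 2 = dotv (v - wvec x y) (v - wvec x y) + qdist x y ^+ 2.
Proof.
rewrite /qdist !cl_dist !cbeta_dot.
rewrite !dotvDl !dotvDr !dotvNl !dotvNr (dotvC (wvec x y) v); ring.
Qed.

Lemma qdist_le v x y : qdist x y <= d (Psi v x) y.
Proof.
apply: le_of_sqr; first exact: (pm_ge0 pm).
by rewrite (cl_dist_split v) lerDr dotv_ge0.
Qed.

Lemma qdist_le_dist x y : qdist x y <= d x y.
Proof. by rewrite -(pm_eq0l pm _ (cl_0 x)); exact: qdist_le. Qed.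

Lemma qdist_sq x y : qdist x y ^+ 2 = d x y ^+ 2 - dotv (wvec x y) (wvec x y).
Proof.
have := cl_dist_split 0 x y.
by rewrite (pm_eq0l pm _ (cl_0 x)) sub0r dotvNl dotvNr opprK => ->; ring.
Qed.

Lemma cl_shift v w x y : d (Psi v x) (Psi w y) = d (Psi (v - w) x) y.
Proof.
have {1}-> : v = w + (v - w) by rewrite addrC subrK.
by rewrite (pm_eq0l pm _ (cl_add cl _ _ _)) (cl_iso cl).
Qed.

Lemma qdist_pm : pseudometric qdist.
Proof.
have q0 x y : 0 <= qdist x y := pm_ge0 pm _ _.
split=> [x|x y|x y z].
- apply/eqP; rewrite -sqrf_eq0 qdist_sq (pm_refl pm) wvec_eq0 ?(pm_refl pm) //.
  by rewrite dotv0l expr0n subr0.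
- apply/eqP; rewrite -(@eqrXn2 _ 2) ?q0 // !qdist_sq (wvec_anti y x) (pm_sym pm y).
  by rewrite dotvNl dotvNr opprK.
- apply: le_trans (qdist_le (wvec y z + wvec x y) x z) _.
  rewrite (pm_eq0l pm _ (cl_add cl _ _ _)).
  apply: le_trans (pm_tri pm _ (Psi (wvec y z) y) _) _.
  by rewrite (cl_iso cl).
Qed.

Lemma qdist_hadamard : hadamard qdist.
Proof.
split; first exact: qdist_pm.
- move=> x y t t01; have /andP[t0 t1] := t01.
  (* Translating each point by its [wvec _ y] moves it into the slice without [R^m]-component
     relative to [y], where [qdist] agrees with [d]. *)
  exists (geo hd (Psi (wvec x y) x) y t) => z.
  apply: le_trans (_ : d (Psi (wvec z y) z) (geo hd (Psi (wvec x y) x) y t) ^+ 2 <= _).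
    by rewrite ler_pXn2r ?nnegrE ?(pm_ge0 pm) //; exact: qdist_le.
  apply: le_trans (geo_cn hd _ _ _ t01) _.
  rewrite cl_shift (_ : wvec z y - wvec x y = wvec z x) //.
  by rewrite (wvec_add z x y) addrK.
- move=> u cu; pose f n := Psi (wvec (u n) (u 0%N)) (u n).
  have fd p n : d (f p) (f n) = qdist (u p) (u n).
    by rewrite /f cl_shift (wvec_add (u p) (u n)) addrK.
  have [|y hy] := hd_cpl hd (u := f).
    by move=> e /cu[n hn]; exists n => p q pn qn; rewrite fd; exact: hn.
  exists y => e /hy[n hn]; exists n => p /hn; apply: le_lt_trans.
  exact: qdist_le.
Qed.

End CliffordFlows.

Section CliffordQuotient.
Context {R : realType} {G : groupType}.
Variables (H Gam : set G) (S : seq G) (N : set_system G) (eps : R).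
Hypothesis FN : Filter N.
Variables (X : Type) (dX : X -> X -> R).
Hypothesis HS : forall s, s \in S -> Gam s.
Hypothesis GamH : Gam `<=` H.
Hypothesis H1 : H 1%g.
Hypothesis HV : forall h, H h -> H h^-1%g.
Hypothesis perfect : forall c : G -> R,
  (forall g h, Gam g -> Gam h -> c (g * h)%g = c g + c h) ->
  forall g, Gam g -> c g = 0.
Variables (k : nat) (Y : Type) (d : Y -> Y -> R) (act : G -> Y -> Y).
Hypothesis hY : hspace H S N eps dX k d act.
Let hd := hs_hd hY.
Let pm := hd_pm hd.
Let ia := hs_act hY.
Variables (m : nat) (Psi : 'rV[R]_m.+1 -> Y -> Y).
Hypothesis cl : clifford d Psi.
Hypothesis normalized : forall h v, H h -> exists w, forall x,
  d (Psi w (act h x)) (act h (Psi v x)) = 0.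
Hypothesis centralized : forall g v x, Gam g ->
  d (Psi v (act g x)) (act g (Psi v x)) = 0.

Let q := qdist d Psi.
Let qpm : pseudometric q := qdist_pm hd cl.

(** [Gam] commutes with the translations and so preserves their Busemann cocycles; hence each
    coordinate is a real character of [Gam], which [perfect] excludes. *)
Lemma wvec_fixed g x : Gam g -> wvec d Psi (act g x) x = 0.
Proof.
move=> Gg; apply/rowP => i; rewrite !mxE; set v := delta_mx 0 i.
apply: (perfect (c := fun g => cbeta d Psi v (act g x) x)) => // {Gg} {}g h Gg Gh.
have Gdist u w : d (Psi v (act g u)) (act g w) = d (Psi v u) w.
  by rewrite (pm_eq0l pm _ (centralized v u Gg)) (ia_iso ia) //; exact: GamH.
have inv u w : cbeta d Psi v (act g u) (act g w) = cbeta d Psi v u w.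
  have := cl_dist hd cl v (act g u) (act g w); rewrite Gdist (cl_dist hd cl).
  by rewrite (ia_iso ia); [lra|exact: GamH].
rewrite (cbeta_add hd cl v _ (act g (act h x))).
rewrite (cbeta_eq0 hd cl v (ia_M ia x (GamH Gg) (GamH Gh))) add0r.
by rewrite (cbeta_add hd cl v _ (act g x)) inv addrC.
Qed.

Lemma clifford_quotient : exists d' : Y -> Y -> R,
  hspace H S N eps dX k.+1 d' act.
Proof.
exists q; split.
- exact: qdist_hadamard.
- have qle h x y : H h -> q (act h x) (act h y) <= q x y.
    move=> Hh; have [w hw] := normalized (wvec d Psi x y) Hh.
    apply: le_trans (qdist_le hd cl w _ _) _.
    by rewrite (pm_eq0l pm _ (hw x)) (ia_iso ia).
  split=> [h x y Hh|x|g h x Hg Hh|x e e0].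
  + have inv u : q (act h^-1%g (act h u)) u = 0.
      apply/le_anti; rewrite (pm_ge0 qpm) andbT.
      apply: le_trans (qdist_le_dist hd cl _ _) _.
      rewrite -(pm_eq0l pm _ (ia_M ia u (HV Hh) Hh)) mulVg.
      by rewrite (ia_1 ia).
    apply/le_anti; rewrite qle //=.
    by rewrite -(pm_eq0l qpm _ (inv x)) -(pm_eq0r qpm _ (inv y)) qle //; exact: HV.
  + apply/le_anti; rewrite (pm_ge0 qpm) andbT -(ia_1 ia x).
    exact: qdist_le_dist.
  + apply/le_anti; rewrite (pm_ge0 qpm) andbT -(ia_M ia x Hg Hh).
    exact: qdist_le_dist.
  + apply: filterS (ia_cts ia x e0) => h /= hh /hh; apply: le_lt_trans.
    exact: qdist_le_dist.
- move=> n y v e e0.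
  pose e1 : 'rV[R]_m.+1 := delta_mx 0 0.
  (* The second summand puts all [y i] into the slice of [y 0]. The new coordinate [v i k] is
     realized along the unit vector [e1] of the group that is divided out. *)
  pose u i := v i k *: e1 + wvec d Psi (y i) (y 0%N).
  have [x hx] := hs_fr hY n (fun i => Psi (u i) (y i)) v e0.
  exists x => i j iN jN; have := hx i j iN jN.
  rewrite (cl_shift hd cl) (cl_dist_split hd cl).
  have -> : u i - u j - wvec d Psi (y i) (y j) = (v i k - v j k) *: e1.
    rewrite /u (wvec_add hd cl (y i) (y j) (y 0%N)) scalerBl.
    move: (v i k *: e1) (v j k *: e1) (wvec _ _ _ _) (wvec _ _ _ _) => A B C D.
    by apply/rowP => l; rewrite !mxE; ring.
  rewrite dotvZl dotvZr dotv_delta mxE !eqxx mulr1 -expr2.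
  rewrite /sqnorm_diff big_ord_recr /= -/q [_ + q _ _ ^+ 2]addrC -addrA.
  by rewrite [_ ^+ 2 + \sum_(_ < _) _]addrC.
- move=> y; have [s sS hs] := hs_moving hY y; exists s => //.
  apply: le_trans hs _; apply: le_of_sqr; first exact: (pm_ge0 qpm).
  by rewrite (qdist_sq hd cl) wvec_fixed ?dotv0l ?subr0 //; exact: HS.
Qed.

End CliffordQuotient.

(** * From k to k + 1 *)

Section Translations.
Context {R : realType} (Y : Type) (d : Y -> Y -> R) (hd : hadamard d).
Let pm := hd_pm hd.

Record transflow (F : R -> Y -> Y) : Prop := Transflow {
  tf_iso : forall r x y, d (F r x) (F r y) = d x y;
  tf_add : forall r s x, d (F (r + s) x) (F r (F s x)) = 0;
  tf_speed : forall r x, d (F r x) x = `|r| }.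

Lemma transflow_isoflow F : transflow F -> isoflow d 1 F.
Proof.
move=> tf; split=> [x s t _ _|x y t _|x s t _ _|x].
- have {1}-> : s = t + (s - t) by ring.
  by rewrite (pm_eq0l pm _ (tf_add tf _ _ _)) (tf_iso tf) (tf_speed tf) mul1r.
- exact: (tf_iso tf).
- exact: (tf_add tf).
- by rewrite (tf_speed tf) normr0.
Qed.

(** Flowing forward reduces negative times to nonnegative ones: for large [T], [F r x] is the point
    that [phi T] sends to [phi (T + r) x]. *)
Lemma isoflow_two_sided phi : isoflow d 1 phi ->
  (forall t y, 0 <= t -> exists x, d (phi t x) y = 0) -> exists F, transflow F.
Proof.
move=> fl sur.
have ex (ry : R * Y) : exists x, 0 <= ry.1 -> d (phi ry.1 x) ry.2 = 0.
  have [r0|r0] := leP 0 ry.1; last by exists ry.2; lra.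
  by have [x hx] := sur _ ry.2 r0; exists x.
have [g hg] := choice ex.
pose F r y := if 0 <= r then phi r y else g (- r, y).
have char r x T : 0 <= T -> 0 <= T + r -> d (phi T (F r x)) (phi (T + r) x) = 0.
  move=> T0 Tr; rewrite /F; case: ifPn => [r0|]; first by rewrite (pm_sym pm) (if_add fl).
  rewrite -ltNge => r0; have r0' : 0 <= - r by lra.
  have h := hg (- r, x) r0'; rewrite /= in h.
  have {1}-> : T = (T + r) + - r by ring.
  by rewrite (pm_eq0l pm _ (if_add fl _ Tr r0')) (if_iso fl).
exists F; split=> [r x y|r s x|r x].
- pose T := `|r|; have T0 : 0 <= T by exact: normr_ge0.
  have Tr : 0 <= T + r by have := ler_norm (- r); rewrite normrN /T; lra.
  rewrite -(if_iso fl _ _ T0) (pm_eq0l pm _ (char _ _ _ T0 Tr)).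
  by rewrite (pm_eq0r pm _ (char _ _ _ T0 Tr)) (if_iso fl).
- pose T := `|r| + `|s|; have := ler_norm (- r); have := ler_norm (- s).
  rewrite !normrN => s1 r1; have := normr_ge0 r; have := normr_ge0 s => s2 r2.
  have T0 : 0 <= T by rewrite /T; lra.
  have Tr : 0 <= T + r by rewrite /T; lra.
  have Trs : 0 <= T + (r + s) by rewrite /T; lra.
  rewrite -(if_iso fl _ _ T0) (pm_eq0l pm _ (char _ _ _ T0 Trs)).
  rewrite (pm_eq0r pm _ (char _ _ _ T0 Tr)) addrA in Trs *.
  by rewrite (pm_eq0r pm _ (char _ _ _ Tr Trs)) (pm_refl pm).
- pose T := `|r|; have T0 : 0 <= T by exact: normr_ge0.
  have Tr : 0 <= T + r by have := ler_norm (- r); rewrite normrN /T; lra.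
  rewrite -(if_iso fl _ _ T0) (pm_eq0l pm _ (char _ _ _ T0 Tr)) (if_speed fl) //.
  by rewrite mul1r addrC addKr.
Qed.

Lemma transflow_clifford F : transflow F ->
  clifford d (fun v : 'rV[R]_1 => F (v 0 0)).
Proof.
move=> tf; split=> [v x y|v w x|v x]; first exact: (tf_iso tf).
  by rewrite mxE; exact: (tf_add tf).
by rewrite (tf_speed tf) /dotv big_ord1 -expr2 real_normK ?num_real.
Qed.

(** Orthonormal vectors of the group move [y0] to points at mutual distance sqrt 2, whose number the
    packing bound for radii 2 and 1 limits. *)
Lemma clifford_dim (y0 : Y) : uniformly_bounded_geometry d -> exists n,
  forall m (Psi : 'rV[R]_m -> Y -> Y), clifford d Psi -> (m < n)%N.
Proof.
move=> bg; have [n hn] := bg 2 1 ltr01; exists n => m Psi cl.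
rewrite ltnNge; apply/negP => nm.
pose p i := if insub i is Some o then Psi (delta_mx 0 o) y0 else y0.
have dp i j : (i < n)%N -> (j < n)%N -> d (p i) (p j) ^+ 2 = 2 * (i != j)%:R.
  move=> iN jN; have im := leq_trans iN nm; have jm := leq_trans jN nm.
  rewrite /p !insubT (cl_dist2 hd cl) !dotvDl !dotvDr !dotvNl !dotvNr !dotv_delta !mxE.
  by rewrite !eqxx /= -!val_eqE /= (eq_sym j i); case: (i == j) => /=; lra.
have [i j iN jN|i [j [ij jN]]] := hn p.
  apply: le_of_sqr => //; rewrite dp //; case: (i == j) => /=; lra.
move=> h; have := dp i j (ltn_trans ij jN) jN.
rewrite neq_ltn ij /= mulr1 => h2.
have : d (p i) (p j) ^+ 2 < 1 ^+ 2 by rewrite ltr_pXn2r ?nnegrE ?(pm_ge0 pm).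
lra.
Qed.

Section Span.
Variables (m : nat) (Psi : 'rV[R]_m -> Y -> Y) (F : R -> Y -> Y).
Hypotheses (cl : clifford d Psi) (tf : transflow F).

Let Finv r x : d (F (- r) (F r x)) x = 0.
Proof.
rewrite -(pm_eq0l pm _ (tf_add tf _ _ _)) addNr.
by rewrite (tf_speed tf) normr0.
Qed.

Lemma translations_commute r v x : d (F r (Psi v x)) (Psi v (F r x)) = 0.
Proof.
wlog r0 : r x / 0 <= r.
  move=> h; have [|r0] := leP 0 r; first exact: h.
  have r0' : 0 <= - r by lra.
  rewrite -(tf_iso tf (- r)) (pm_eq0l pm _ (Finv _ _)).
  rewrite (pm_eq0r pm _ (h _ (F r x) r0')) (cl_iso cl) (pm_sym pm).
  exact: Finv.
have := flows_commute hd x (transflow_isoflow tf) (cflow_isoflow hd cl v) r0 ler01.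
by rewrite /cflow scale1r.
Qed.

Variable y0 : Y.
Let a := wvec d Psi y0 (F 1 y0).

Let cbeta_flow v r x : cbeta d Psi v x (F r x) = r * dotv v a.
Proof.
have pos t u : 0 <= t -> cbeta d Psi v u (F t u) = t * dotv v a.
  move=> t0; rewrite /cbeta (busemann_along hd (cflow_isoflow hd cl v) (transflow_isoflow tf)) //.
  rewrite (busemann_along_const hd (cflow_isoflow hd cl v) (transflow_isoflow tf) _ y0).
  by rewrite -/(cbeta d Psi v y0 (F 1 y0)) (cbeta_dot hd cl).
have [|r0] := leP 0 r; first exact: pos.
have r0' : 0 <= - r by lra.
have := pos (- r) (F r x) r0'.
rewrite (cbeta_add hd cl v _ x) (cbeta_eq0 hd cl v (x := x)) ?addr0; last first.
  by rewrite (pm_sym pm); exact: Finv.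
by rewrite (cbeta_anti hd cl v x); lra.
Qed.

Let dist_combine u r x :
  d (Psi u (F r x)) x ^+ 2 = dotv u u + 2 * r * dotv u a + r ^+ 2.
Proof.
rewrite (cl_dist hd cl) (cbeta_anti hd cl u x) cbeta_flow (tf_speed tf).
by rewrite real_normK ?num_real //; ring.
Qed.

(** [a] is the orthogonal projection of the direction of [F] to [R^m]. If [a] has length 1, it is
    that direction; otherwise the orthogonal rest, divided by its length [nu] as in the Gram-Schmidt
    process, is a further dimension. *)
Lemma span_or_extend :
  (forall r x, d (F r x) (Psi (r *: a) x) = 0) \/
  exists Psi' : 'rV[R]_m.+1 -> Y -> Y, clifford d Psi'.
Proof.
have Psi0 u x y : d (Psi (- u) x) y = d x (Psi u y).
  rewrite -[RHS](cl_iso cl (- u)) -(pm_eq0r pm _ (cl_add cl (- u) u y)).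
  by rewrite addNr (pm_eq0r pm _ (cl_0 cl y)).
have nn : 0 <= 1 - dotv a a.
  have := sqr_ge0 (d (Psi (- a) (F 1 y0)) y0); rewrite dist_combine.
  by rewrite !dotvNl dotvNr; lra.
have [z|nz] := eqVneq (1 - dotv a a) 0.
  left=> r x; rewrite -Psi0; apply/eqP; rewrite -sqrf_eq0 dist_combine.
  rewrite !dotvNl !dotvNr !dotvZl !dotvZr; apply/eqP.
  by rewrite (_ : dotv a a = 1); [ring|lra].
right; pose nu := Num.sqrt (1 - dotv a a).
have nu2 : nu ^+ 2 = 1 - dotv a a by rewrite sqr_sqrtr.
have nu0 : nu != 0 by rewrite -sqrf_eq0 nu2.
pose rest (v : 'rV[R]_m.+1) : 'rV[R]_m := \row_i v 0 (lift ord0 i).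
pose u (v : 'rV[R]_m.+1) := rest v - (v 0 0 / nu) *: a.
exists (fun v x => Psi (u v) (F (v 0 0 / nu) x)); split.
- by move=> v x y; rewrite (cl_iso cl) (tf_iso tf).
- move=> v w x.
  have -> : u (v + w) = u v + u w.
    by apply/rowP => i; rewrite !mxE; ring.
  have -> : (v + w) 0 0 / nu = v 0 0 / nu + w 0 0 / nu by rewrite mxE mulrDl.
  rewrite (pm_eq0l pm _ (cl_add cl _ _ _)) !(cl_iso cl).
  rewrite -(pm_eq0l pm _ (_ : d (Psi (u w) (F (v 0 0 / nu) (F (w 0 0 / nu) x)))
     (Psi (u w) (F (v 0 0 / nu + w 0 0 / nu) x)) = 0)); last first.
    by rewrite (cl_iso cl) (pm_sym pm) (tf_add tf).
  by rewrite (pm_sym pm) translations_commute.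
- move=> v x; rewrite dist_combine [RHS]/dotv big_ord_recl -expr2 -[ord0]/(0 : 'I_m.+1).
  have -> : \sum_(i < m) v 0 (lift ord0 i) * v 0 (lift ord0 i) = dotv (rest v) (rest v).
    by apply: eq_bigr => i _; rewrite !mxE.
  rewrite /u !dotvDl !dotvDr !dotvNl !dotvNr !dotvZl !dotvZr (dotvC a (rest v)).
  have e : dotv a a = 1 - nu ^+ 2 by rewrite nu2; ring.
  by rewrite e; field.
Qed.

End Span.
End Translations.

(** * Minimal spaces and escape to infinity *)

Section Step.
Context {R : realType} {G : groupType}.
Variables (H Gam : set G) (S : seq G) (N : set_system G) (eps : R).
Hypothesis FN : Filter N.
Variables (X : Type) (dX : X -> X -> R).
Hypothesis HS : forall s, s \in S -> Gam s.
Hypothesis GamH : Gam `<=` H.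
Hypothesis H1 : H 1%g.
Hypothesis HV : forall h, H h -> H h^-1%g.
Hypothesis HM : forall g h, H g -> H h -> H (g * h)%g.
Hypothesis perfect : forall c : G -> R,
  (forall g h, Gam g -> Gam h -> c (g * h)%g = c g + c h) ->
  forall g, Gam g -> c g = 0.
Hypothesis pmX : pseudometric dX.
Hypothesis bgX : uniformly_bounded_geometry dX.

Let SH s : s \in S -> H s. Proof. by move=> /HS/GamH. Qed.

Definition has_hspace k := exists (Y : Type) (d : Y -> Y -> R) (act : G -> Y -> Y),
  inhabited Y /\ hspace H S N eps dX k d act.

Section Fixed.
Variables (k : nat) (Y : Type) (d : Y -> Y -> R) (act : G -> Y -> Y).
Hypothesis hY : hspace H S N eps dX k d act.
Let hd := hs_hd hY.
Let pm := hd_pm hd.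
Let ia := hs_act hY.

Lemma hspace_geometry : uniformly_bounded_geometry d.
Proof. exact: finitely_represented_geometry pm pmX (hs_fr hY) bgX. Qed.

Lemma act_invK h x : H h -> d (act h (act h^-1%g x)) x = 0.
Proof.
move=> Hh; rewrite -(pm_eq0l pm _ (ia_M ia x Hh (HV Hh))) mulgV.
exact: (ia_1 ia).
Qed.

Lemma act_Kinv h x : H h -> d (act h^-1%g (act h x)) x = 0.
Proof.
move=> Hh; rewrite -(pm_eq0l pm _ (ia_M ia x (HV Hh) Hh)) mulVg.
exact: (ia_1 ia).
Qed.

Lemma escape_step (I : Type) (U : set_system I) (P : I -> Y -> Y) :
  UltraFilter U -> inhabited Y ->
  (forall i x y, d (P i x) (P i y) <= d x y) ->
  (forall x M, U [set i | M <= d x (P i x)]) ->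
  (forall h i x, H h -> d (act h (P i x)) (P i (act h x)) = 0) ->
  has_hspace k.+1.
Proof.
move=> FU [y0] Pne Pesc Peq.
have [phi [fl lim]] := escape_semiflow (FU := FU) hd hspace_geometry Pne Pesc.
have com h x t : H h -> 0 <= t -> d (act h (phi t x)) (phi t (act h x)) = 0.
  move=> Hh t0; apply: (escape_equivariant (FU := FU) Pesc lim) => //.
    by move=> u v; exact: (ia_iso ia).
  by move=> i u; exact: Peq.
have [Y' [i [d' [act' [Psi [hY' cl cm]]]]]] := direct_limit_hspace FN SH hY fl com H1 HM.
have norm h (v : 'rV[R]_1) : H h -> exists w, forall x,
    d' (Psi w (act' h x)) (act' h (Psi v x)) = 0.
  by move=> Hh; exists v => x; exact: cm.
have cent g v x : Gam g -> d' (Psi v (act' g x)) (act' g (Psi v x)) = 0.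
  by move=> /GamH; exact: cm.
have [d'' hY''] := clifford_quotient FN HS GamH HV perfect hY' cl norm cent.
by exists Y', d'', act'; split => //; exact: (inhabits (i (y0, 0))).
Qed.

Definition invariant_convex (C : set Y) := [/\ C !=set0, closed_in d C,
  convex_in hd C & forall h x, H h -> C x -> C (act h x)].

Definition minimal_hspace := forall C, invariant_convex C -> forall x, C x.

End Fixed.

(** The convex sets are the complements of the members of [F]. If the projections to them stayed
    bounded along the ultrafilter of tails of the chain, their ultralimit would lie in every one of
    these closed sets, but [F] covers [Y]. *)
Lemma escaping_family k (Y : Type) (d : Y -> Y -> R) (act : G -> Y -> Y)
    (hY : hspace H S N eps dX k d act) (F : set (set Y)) :
  inhabited Y -> F !=set0 -> total_on F subset ->
  (forall A, F A -> invariant_convex hY (~` A)) ->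
  (forall y, exists2 A, F A & A y) -> has_hspace k.+1.
Proof.
move=> inY [A0 FA0] Ftot Fgood Fcov; have hd := hs_hd hY; have pm := hd_pm hd.
pose B := filter_from F (fun A => [set A' | F A' /\ A `<=` A']).
have FB : ProperFilter B.
  apply: filter_from_proper; last by move=> A FA; exists A; split.
  apply: filter_from_filter; first by exists A0.
  move=> A A' FA FA'; have [AA|AA] := Ftot _ _ FA FA'.
    by exists A' => // C [FC ?]; split; split => //; exact: subset_trans AA _.
  by exists A => // C [FC ?]; split; split => //; exact: subset_trans AA _.
have [U [FU BU]] := ultraFilterLemma FB.
have exP (Ax : set Y * Y) : exists p, F Ax.1 ->
    is_prox d (~` Ax.1) (fun=> 0) Ax.2 p.
  have [FA|nFA] := pselect (F Ax.1); last by exists Ax.2.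
  have [ne cl cv _] := Fgood _ FA.
  have [||p hp] := @prox_exists R Y d (hs_hd hY) (~` Ax.1) (fun=> 0) 0 Ax.2 cl cv ne _ (lexx 0).
  - by move=> x y t _; rewrite !mulr0 addr0.
  - by move=> x y; rewrite subrr mul0r.
  - by exists p.
have [pr hpr] := choice exP.
pose P A x := match pselect (F A) with left _ => pr (A, x) | right _ => x end.
have PE A x : F A -> is_prox d (~` A) (fun=> 0) x (P A x).
  by move=> FA; rewrite /P; case: pselect => // _; exact: (hpr (A, x)).
have Pn A : ~ F A -> forall x, P A x = x.
  by move=> nFA x; rewrite /P; case: pselect.
apply: (escape_step hY (U := U) (P := P)) => //.
- move=> A x y; have [FA|nFA] := pselect (F A); last by rewrite !Pn.
  exact: (prox_nonexpansive (hs_hd hY) (PE A x FA) (PE A y FA)).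
- move=> x M; have [//|UM] := in_ultra_setVsetC [set i | M <= d x (P i x)] FU.
  have UM' : U [set i | d (P i x) x <= M].
    by apply: filterS UM => A /= /negP; rewrite -ltNge (pm_sym pm) => /ltW.
  have [y hy] := ulim_exists (FU := FU) (hs_hd hY) (hspace_geometry hY) UM'.
  have [A FA Ay] := Fcov y; exfalso.
  have [_ cl _ _] := Fgood A FA; apply: (cl y) => // e e0.
  have UA : U [set A' | F A' /\ A `<=` A'] by apply: BU; exists A.
  have [A' [/= dA [FA' AA']]] := ultra_exists (filterI (hy e e0) UA).
  by exists (P A' x) => //; have [nA' _] := PE A' x FA' => /AA'.
- move=> h A x Hh; have [FA|nFA] := pselect (F A); last by rewrite !Pn // (pm_refl pm).
  have [_ cl cv inv] := Fgood A FA; have [pA hp] := PE A x FA.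
  apply: (prox_uniq (hs_hd hY) _ (PE A _ FA)); split; first exact: inv.
  move=> z zA; rewrite !add0r.
  have := hp _ (inv _ _ (HV Hh) zA); rewrite !add0r.
  have ia := hs_act hY.
  rewrite -(ia_iso ia (P A x) _ Hh) -(ia_iso ia x (P A x) Hh) -(ia_iso ia x (act h^-1%g z) Hh).
  by rewrite !(pm_eq0r pm _ (act_invK hY z Hh)).
Qed.

(** Zorn's lemma is applied to the complements of invariant convex sets. A chain can lack a bound
    only because the corresponding sets have empty intersection, and then their projections
    escape. *)
Lemma minimal_or_escape k : has_hspace k ->
  has_hspace k.+1 \/ exists (Y : Type) (d : Y -> Y -> R) (act : G -> Y -> Y)
    (hY : hspace H S N eps dX k d act), inhabited Y /\ minimal_hspace hY.
Proof.
move=> [Y [d [act [[y0] hY]]]]; have pm := hd_pm (hs_hd hY).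
pose good A := invariant_convex hY (~` A).
have [allF|nF] := pselect (forall F : set (set Y), F `<=` good -> total_on F subset ->
  good (\bigcup_(A in F) A)).
  right; have [A [gA maxA]] := Zorn_bigcup allF.
  have [[c0 Cc0] Ccl Ccv CH] := gA.
  have hC := sub_hspace SH (conj H1 HM) Ccl Ccv CH.
  exists {y | (~` A) y}, (sub_dist d (C := ~` A)), (sub_act act (C := ~` A)), hC.
  split; first exact: (inhabits (exist _ c0 Cc0)).
  move=> C [[x0 Cx0] cl cv inv] x; apply: contrapT => nCx.
  (* A proper invariant convex subset of the subspace, viewed in [Y], has a complement larger than
     [A]. *)
  pose B := ~` [set y | exists c, C (exist (~` A) y c)].
  have sub : A `<` B.
    split; first by move=> y Ay [c _]; exact: c.
    move=> /(_ (sval x)) BA; apply: (svalP x); apply: BA => -[c].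
    by case: x nCx c => y c' /= nC c; rewrite (Prop_irrelevance c c').
  apply: (maxA B sub); rewrite /good /B setCK; split.
  - by case: x0 Cx0 => y c Cy; exists y, c.
  - move=> y hy; have cy : (~` A) y.
      by apply: Ccl => e /hy[z [c _] zy]; exists z.
    exists cy; apply: cl => e /hy[z [c Cz] zy]; by exists (exist _ z c).
  - move=> y z t t01 [cy Cy] [cz Cz].
    have := cv _ _ t t01 Cy Cz; set p := geo _ _ _ _ => Cp.
    have [hl hr] := geo_lr (hs_hd hC) (exist _ y cy) (exist _ z cz) t01.
    rewrite /sub_dist /= -/p in hl hr.
    have p0 : d (sval p) (geo (hs_hd hY) y z t) = 0.
      by apply: geo_uniq; rewrite // ?hl ?hr.
    have cg := Ccv y z t t01 cy cz.
    by exists cg; apply: closed_in_eq0 cl _ Cp.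
  - move=> h y Hh [c Cy]; have := inv h _ Hh Cy.
    have cc := CH h y Hh c; exists cc.
    rewrite (_ : exist _ _ cc = sub_act act h (exist _ y c)) //.
    rewrite /sub_act; case: pselect => //= c'.
    by rewrite (Prop_irrelevance cc c').
left; move/existsNP: nF => [F /not_implyP[Fg /not_implyP[Ftot ngood]]].
have cov y : exists2 A, F A & A y.
  have [[A FA Ay]|nA] := pselect ((\bigcup_(A in F) A) y); first by exists A.
  exfalso; apply: ngood; split; first by exists y.
  - move=> z hz [A FA Az]; have [_ cl _ _] := Fg A FA.
    apply: cl Az => e /hz[w nw wz]; exists w => // Aw; apply: nw; by exists A.
  - move=> u v t t01 nu nv [A FA Ag]; have [_ _ cv _] := Fg A FA.
    apply: (cv u v t t01 _ _ Ag) => Au; [apply: nu|apply: nv]; by exists A.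
  - move=> h u Hh nu [A FA Ah]; have [_ _ _ inv] := Fg A FA.
    apply: (inv h u Hh _ Ah) => Au; apply: nu; by exists A.
have [A0 FA0 _] := cov y0.
apply: (escaping_family (hY := hY) (F := F)) => //.
by exists A0.
Qed.

(** * Functions in the convex hull of the normalized distance functions *)

Hypothesis eps0 : 0 < eps.

(* [f] satisfies every affine inequality valid for all the normalized distance
   functions [d y - d y y0]: it lies in their pointwise closed convex hull. *)
Definition horo_hull (Y : Type) (d : Y -> Y -> R) (y0 : Y) (f : Y -> R) :=
  forall (s : seq (R * Y)) (c : R),
    (forall y, c <= \sum_(p <- s) p.1 * (d y p.2 - d y y0)) ->
    c <= \sum_(p <- s) p.1 * f p.2.

Hypothesis amenable : forall k (Y : Type) (d : Y -> Y -> R) (act : G -> Y -> Y) y0,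
  hspace H S N eps dX k d act -> exists f : Y -> R,
    horo_hull d y0 f /\ forall h x, H h -> f (act h x) = f x + f (act h y0).

Section Fixed.
Variables (k : nat) (Y : Type) (d : Y -> Y -> R) (act : G -> Y -> Y).
Hypothesis hY : hspace H S N eps dX k d act.
Hypothesis minY : minimal_hspace hY.
Let hd := hs_hd hY.
Let pm := hd_pm hd.
Let ia := hs_act hY.
Variable y0 : Y.

Lemma dist_convex z x y t : 0 <= t <= 1 ->
  d z (geo hd x y t) <= (1 - t) * d z x + t * d z y.
Proof.
move=> t01; have /andP[t0 t1] := t01; have t1' : 0 <= 1 - t by lra.
apply: le_of_sqr; first by rewrite addr_ge0 // mulr_ge0 // (pm_ge0 pm).
apply: le_trans (geo_cn hd x y z t01) _.
have := pm_dist pm x y z; rewrite !(pm_sym pm _ z) => h.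
have h2 : (d z x - d z y) ^+ 2 <= d x y ^+ 2.
  rewrite -(real_normK (num_real (_ - _))) ler_pXn2r ?nnegrE ?(pm_ge0 pm) //.
have := ler_wpM2l (mulr_ge0 t0 t1') h2; lra.
Qed.

Section Hull.
Variable f : Y -> R.
Hypothesis fh : horo_hull d y0 f.

(** Convexity, like the Lipschitz bound after it, is an affine inequality that all normalized
    distance functions satisfy. *)
Lemma hull_convex : convex_fun hd f.
Proof.
move=> x y t t01.
have := fh (s := [:: (1 - t, x); (t, y); (-1, geo hd x y t)]) (c := 0) _.
rewrite !big_cons big_nil /= => /(_ _) h; rewrite -subr_ge0.
have {}h : 0 <= (1 - t) * f x + (t * f y + (-1 * f (geo hd x y t) + 0)).
  apply: h => z; rewrite !big_cons big_nil /=.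
  by have := dist_convex z x y t01; lra.
lra.
Qed.

Lemma hull_lipschitz : lipschitz_fun d f 1.
Proof.
move=> x y.
have := fh (s := [:: (-1, x); (1, y)]) (c := - d x y) _.
rewrite !big_cons big_nil /= => /(_ _) h.
have {}h : - d x y <= -1 * f x + (1 * f y + 0).
  apply: h => z; rewrite !big_cons big_nil /=.
  by have := pm_tri pm z y x; rewrite (pm_sym pm y x); lra.
lra.
Qed.

Lemma hull_eq0 x y : d x y = 0 -> f x = f y.
Proof.
move=> xy; have := hull_lipschitz x y; have := hull_lipschitz y x.
by rewrite (pm_sym pm y x) xy; lra.
Qed.

Hypothesis fH : forall h x, H h -> f (act h x) = f x + f (act h y0).

(** Iterating an element that lowers [f] by a constant shows that [f] is unbounded below, so its
    resolvents escape. They commute with [H], because additive constants do not affect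
    minimizers. *)
Lemma resolvent_step h0 : H h0 -> f (act h0 y0) != 0 -> has_hspace k.+1.
Proof.
move=> Hh0 c0.
have [h1 Hh1 c1] : exists2 h, H h & f (act h y0) < 0.
  have [lt0|gt0|eq0] := ltgtP (f (act h0 y0)) 0; first by exists h0.
    exists h0^-1%g; first exact: HV.
    have := fH (act h0^-1%g y0) Hh0.
    have e1 := hull_eq0 (ia_1 ia y0); have e2 := fH y0 H1.
    rewrite (hull_eq0 (act_invK hY y0 Hh0)); lra.
  by rewrite eq0 eqxx in c0.
have low (n : nat) : exists y, f y <= f y0 + n%:R * f (act h1 y0).
  elim: n => [|n [y hy]]; first by exists y0; lra.
  exists (act h1 y); rewrite fH // -[n.+1]addn1 natrD; lra.
have unb (M : R) : exists y, f y <= M.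
  have c1' : 0 < - f (act h1 y0) by lra.
  pose n := (Num.truncn ((f y0 - M) / - f (act h1 y0))).+1.
  have [y hy] := low n; exists y; apply: le_trans hy _.
  have : (f y0 - M) / - f (act h1 y0) < n%:R by exact: truncnS_gt.
  by rewrite ltr_pdivrMr //; lra.
have ex (nx : nat * Y) : exists p, is_prox d setT (fun z => nx.1%:R * f z) nx.2 p.
  apply: (@prox_exists R Y d hd setT _ nx.1%:R) => //; first by exists y0.
    move=> x y t t01; have := ler_wpM2l (ler0n R nx.1) (hull_convex x y t01); lra.
  move=> x y; have := ler_wpM2l (ler0n R nx.1) (hull_lipschitz x y); lra.
have [pr hpr] := choice ex; pose P n x := pr (n, x).
have PE n x := hpr (n, x); rewrite -/(P _ _) /= in PE.
pose B := filter_from setT (fun n : nat => [set m | (n <= m)%N]).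
have FB : ProperFilter B.
  apply: filter_from_proper; last by move=> n _; exists n => /=.
have [U [FU BU]] := ultraFilterLemma FB.
apply: (escape_step hY (U := U) (P := P)) => //.
- by move=> n x y; exact: (prox_nonexpansive hd (PE n x) (PE n y)).
- move=> x M; have [//|UM] := in_ultra_setVsetC [set i | M <= d x (P i x)] FU.
  (* If [P m x] is within [M] of [x], then [f (P m x) >= f w + 1], and comparison with the
     competitor [w] gives [m <= d x w ^+ 2]. *)
  exfalso; have [w hw] := unb (f x - M - 1).
  pose n := (Num.truncn (d x w ^+ 2)).+1.
  have Un : U [set m | (n <= m)%N] by apply: BU; exists n.
  have [m [/= /negP dm nm]] := ultra_exists (filterI UM Un).
  rewrite -ltNge in dm.
  have [_ hp] := PE m x; have := hp w I; have := sqr_ge0 (d x (P m x)).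
  have := sqr_ge0 (d (P m x) w); have := hull_lipschitz x (P m x).
  have mn : d x w ^+ 2 < m%:R.
    apply: lt_le_trans (truncnS_gt _) _; by rewrite ler_nat.
  have m0 : 0 <= (m%:R : R) by [].
  move=> l1 l2 l3 l4.
  have : m%:R * (f w + 1) <= m%:R * f (P m x) by rewrite ler_wpM2l //; lra.
  lra.
- move=> h n x Hh; apply: (prox_uniq hd _ (PE n (act h x))); split=> // z _.
  have [_ hp] := PE n x; have := hp (act h^-1%g z) I.
  rewrite -(ia_iso ia (P n x) _ Hh) -(ia_iso ia x (P n x) Hh) -(ia_iso ia x (act h^-1%g z) Hh).
  rewrite !(pm_eq0r pm _ (act_invK hY z Hh)) (fH (P n x) Hh).
  have -> : f z = f (act h^-1%g z) + f (act h y0).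
    by rewrite -fH //; apply/esym/hull_eq0; exact: (act_invK hY).
  lra.
Qed.

(** Sublevel sets of the invariant convex function [f] are invariant, closed and convex; by
    minimality each nonempty one is everything. *)
Lemma hull_constant : (forall h, H h -> f (act h y0) = 0) -> forall x y, f x = f y.
Proof.
move=> c0; have le x y : f x <= f y.
  apply: (minY (C := [set z | f z <= f y])); split; first by exists y => /=.
  - move=> z hz /=; apply/ler_addgt0Pr => e /hz[w /= wy wz].
    by have := hull_lipschitz z w; rewrite (pm_sym pm z); lra.
  - move=> u v t t01 /= fu fv; apply: le_trans (hull_convex u v t01) _.
    have /andP[t0 t1] := t01; have t1' : 0 <= 1 - t by lra.
    by have := ler_wpM2l t0 fv; have := ler_wpM2l t1' fu; lra.
  - by move=> h z Hh /=; rewrite fH // c0 // addr0.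
by move=> x y; apply/le_anti; rewrite !le.
Qed.

End Hull.

(* convexity defect of [d y] on the geodesic from [p.1.1] to [p.1.2] *)
Definition defect (p : Y * Y * R) y :=
  (1 - p.2) * d y p.1.1 + p.2 * d y p.1.2 - d y (geo hd p.1.1 p.1.2 p.2).

Lemma defect_ge0 p y : 0 <= p.2 <= 1 -> 0 <= defect p y.
Proof. by move=> t01; rewrite /defect; have := dist_convex y p.1.1 p.1.2 t01; lra. Qed.

(** If at every [y] some defect were at least [e], so would be the sum of these nonnegative numbers.
    This is an affine inequality in the distance functions, hence true for [f]; but a constant has
    defect 0. *)
Lemma small_defects (f : Y -> R) : horo_hull d y0 f -> (forall x y, f x = f y) ->
  forall n (q : nat -> Y * Y * R) e, 0 < e -> (forall i, 0 <= (q i).2 <= 1) ->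
  exists y, forall i, (i < n)%N -> defect (q i) y < e.
Proof.
move=> fh fc n q e e0 q01; apply: contrapT => nex.
pose s := flatten [seq [:: (1 - (q i).2, (q i).1.1); ((q i).2, (q i).1.2);
  (-1, geo hd (q i).1.1 (q i).1.2 (q i).2)] | i <- iota 0 n].
have sE (g : Y -> R) : \sum_(p <- s) p.1 * g p.2 = \sum_(i <- iota 0 n)
    ((1 - (q i).2) * g (q i).1.1 + (q i).2 * g (q i).1.2 -
     g (geo hd (q i).1.1 (q i).1.2 (q i).2)).
  rewrite /s big_flatten big_map; apply: eq_bigr => i _.
  by rewrite !big_cons big_nil /=; ring.
have : e <= \sum_(p <- s) p.1 * f p.2.
  apply: fh => y; rewrite (sE (fun z => d y z - d y y0)).
  have [i [iN di]] : exists i, (i < n)%N /\ e <= defect (q i) y.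
    apply: contrapT => nd; apply: nex; exists y => i iN; rewrite ltNge.
    by apply/negP => di; apply: nd; exists i.
  apply: le_trans di _; rewrite -[iota 0 n](_ : index_iota 0 n = _) ?big_mkord; last first.
    by rewrite /index_iota subn0.
  rewrite (bigD1 (Ordinal iN)) //= /defect.
  rewrite (_ : (1 - (q i).2) * _ + _ - _ = (1 - (q i).2) * (d y (q i).1.1) +
    (q i).2 * d y (q i).1.2 - d y (geo hd (q i).1.1 (q i).1.2 (q i).2)); last by ring.
  rewrite lerDl sumr_ge0 // => j _.
  by have := defect_ge0 y (q01 j); rewrite /defect; lra.
rewrite sE big1 => [|i _]; last first.
  by rewrite (fc (q i).1.2 (q i).1.1) (fc (geo _ _ _ _) (q i).1.1); ring.
by rewrite leNgt e0.
Qed.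

(** * Ultrafilters along which the distance functions become affine *)

Section AffineLimit.
Variable U : set_system Y.
Hypothesis FU : UltraFilter U.
Hypothesis Udef : forall p e, 0 <= p.2 <= 1 -> 0 < e -> U [set y | defect p y < e].

(* If the distance functions stay bounded along [U], they converge to an affine
   [d z], which forces [Y] to be isometric to a subset of a half-line starting at [z]. *)
Lemma affine_limit_bounded M : U [set y | d y y0 <= M] -> False.
Proof.
move=> UM; have [z hz] := ulim_exists (FU := FU) hd (hspace_geometry hY) UM.
(* The limit [d z] is affine, and then CN at the midpoint of [a] and [b] gives the upper bound. *)
have E a b : d a b = `|d z a - d z b|.
  apply/le_anti/andP; split; last by rewrite !(pm_sym pm z) pm_dist.
  have h2 : 0 <= (1 / 2 : R) <= 1 by apply/andP; split; lra.
  pose m := geo hd a b (1 / 2).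
  have hm : (d z a + d z b) / 2 <= d z m.
    apply/ler_addgt0Pr => e e0; have e4 : 0 < e / 4 by lra.
    have [y [/= yz yd]] := ultra_exists (filterI (hz _ e4) (Udef (p := (a, b, 1 / 2)) h2 e4)).
    have := pm_tri pm z y m; have := pm_tri pm y z a; have := pm_tri pm y z b.
    rewrite /defect /= -/m in yd.
    have := pm_dist pm y z a; have := pm_dist pm y z b; have := pm_dist pm y z m.
    by rewrite !ler_norml => /andP[? ?] /andP[? ?] /andP[? ?]; lra.
  have := geo_cn hd a b z h2; rewrite -/m.
  have := pm_ge0 pm z a; have := pm_ge0 pm z b; have := pm_ge0 pm z m.
  move=> m0 b0 a0 cn; apply: le_of_sqr => //; rewrite real_normK ?num_real //.
  have : ((d z a + d z b) / 2) ^+ 2 <= d z m ^+ 2.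
    by rewrite ler_pXn2r ?nnegrE //; lra.
  lra.
have [fixz|nfix] := pselect (forall s, H s -> d z (act s z) = 0).
  have [s sS] := hs_moving hY z.
  by rewrite (pm_sym pm) fixz ?leNgt ?eps0 //; exact: SH.
have [h0 [Hh0 r0]] : exists h, H h /\ 0 < d z (act h z).
  apply: contrapT => nh; apply: nfix => s Hs; apply/le_anti.
  rewrite (pm_ge0 pm) andbT leNgt; apply/negP => h; apply: nh; by exists s.
(* An isometry that moves the end [z] of the half-line must take it to the other end of [Y], so
   nothing lies beyond [act h z]. *)
have bound h b : H h -> 0 < d z (act h z) -> d z b <= d z (act h z).
  move=> Hh r; rewrite leNgt; apply/negP => hb.
  have e1 : d (act h z) (act h b) = d z b by exact: (ia_iso ia).
  have e2 := E (act h z) b.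
  have e3 : d (act h^-1%g b) z = d b (act h z).
    by rewrite -(ia_iso ia _ _ Hh) (pm_eq0l pm _ (act_invK hY b Hh)).
  have e4 : d (act h^-1%g b) (act h^-1%g z) = d b z by exact: (ia_iso ia _ _ (HV Hh)).
  have e5 : d (act h^-1%g z) z = d z (act h z).
    by rewrite -(ia_iso ia _ _ Hh) (pm_eq0l pm _ (act_invK hY z Hh)).
  have e6 := E (act h^-1%g b) (act h^-1%g z).
  rewrite e4 (pm_sym pm z (act h^-1%g b)) e3 (pm_sym pm z (act h^-1%g z)) e5 in e6.
  rewrite (pm_sym pm b (act h z)) e2 (pm_sym pm b z) [`|_ - d z b|]ltr0_norm in e6; last by lra.
  move: e6; rewrite opprB; have [hh|hh] := leP 0 (d z b - d z (act h z) - d z (act h z)).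
    by rewrite ger0_norm //; lra.
  by rewrite ltr0_norm //; lra.
pose rho := d z (act h0 z).
have same h : H h -> 0 < d z (act h z) -> d z (act h z) = rho.
  by move=> Hh r; apply/le_anti; rewrite !bound.
have h2 : 0 <= (1 / 2 : R) <= 1 by apply/andP; split; lra.
(* [Y] is now a segment of length [rho], and every element of [H] fixes its midpoint, against
   [moving]. *)
pose w := geo hd z (act h0 z) (1 / 2).
have wz : d z w = rho / 2 by rewrite /w geo_l // /rho; lra.
have [s sS] := hs_moving hY w; have Hs := SH sS.
suff -> : d (act s w) w = 0 by rewrite leNgt eps0.
rewrite E wz; suff -> : d z (act s w) = rho / 2 by rewrite subrr normr0.
have iso : d (act s z) (act s w) = rho / 2 by rewrite (ia_iso ia).
have [r|r] := ltP 0 (d z (act s z)).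
  rewrite E (same s Hs r) in iso; have := bound h0 (act s w) Hh0 r0; rewrite -/rho => hb.
  by rewrite ger0_norm in iso; lra.
have r1 : d z (act s z) = 0 by apply/le_anti; rewrite r (pm_ge0 pm).
by rewrite (pm_eq0l pm _ r1).
Qed.

Hypothesis Uesc : forall x M, U [set y | M <= d x y].

(** With [l] the limit of [d y x - d y x'], [half] bounds the distance from [phi t x] to [x'] below
    by its Euclidean value. The bounds for a pair and for the exchanged pair, inserted into the
    quadrilateral inequality, show that [phi t] does not contract. *)
Lemma affine_limit_isoflow : exists phi, isoflow d 1 phi.
Proof.
(* The index set is [Y] itself and [P i] is the constant map to [i]: all geodesics of one index aim
   at the same point. *)
have Pne (i x y : Y) : d ((fun i _ => i) i x) ((fun i _ => i) i y) <= d x y.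
  by rewrite (pm_refl pm) (pm_ge0 pm).
have [phi [fl lim]] := escape_semiflow (FU := FU) hd (hspace_geometry hY) Pne Uesc.
exists phi.
(* first variation along [c_s], the geodesic from [x] to [x'] *)
have half x x' l t : 0 <= t ->
    (forall e, 0 < e -> U [set y | `|d y x - d y x' - l| < e]) ->
    t ^+ 2 - 2 * t * l + d x x' ^+ 2 <= d (phi t x) x' ^+ 2.
  move=> t0 hl; have near s : 0 <= s <= 1 ->
      t - s * l <= d (phi t x) (geo hd x x' s).
    move=> s01; have /andP[s0 s1] := s01; apply/ler_addgt0Pr => e e0.
    have e4 : 0 < e / 4 by lra.
    have [y [[/= hxx hd'] [hphi hesc]]] := ultra_exists (filterI
      (filterI (hl _ e4) (Udef (p := (x, x', s)) s01 e4))
      (filterI (lim x t t0 _ e4) (Uesc x (t + 1)))).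
    rewrite /defect /= in hd'.
    have y0' : 0 < d x y by lra.
    have f01 : 0 <= t / d x y <= 1 by apply: frac01 => //; lra.
    have hy : d (along hd (fun i _ => i) y x t) y = d x y - t.
      by rewrite /along geo_r // mulrBl mul1r divfK ?gt_eqF.
    have t1 := pm_tri pm y (phi t x) (geo hd x x' s).
    have t2 := pm_tri pm y (along hd (fun i _ => i) y x t) (phi t x).
    rewrite (pm_sym pm y (along _ _ _ _ _)) hy in t2.
    have : s * (d y x - d y x') <= s * (l + e / 4).
      by rewrite ler_wpM2l //; move: hxx; rewrite ltr_distl => /andP[*]; lra.
    have : s * (e / 4) <= e / 4 by rewrite ler_piMl //; lra.
    by rewrite (pm_sym pm y x) in hd' *; lra.
  have dt : d (phi t x) x = t.
    rewrite (pm_sym pm) -(pm_eq0l pm _ (sf_0 fl x)) (sf_speed fl) //.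
    by rewrite sub0r normrN ger0_norm.
  have [t_eq0|t_gt0] := leP t 0.
    have t00 : t = 0 by apply/le_anti; rewrite t_eq0.
    rewrite t00 (pm_eq0l pm _ (sf_0 fl x)); lra.
  apply/ler_addgt0Pr => e e0.
  have L1 : 0 < d x x' ^+ 2 + 1 by have := sqr_ge0 (d x x'); lra.
  have l1 : 0 < `|l| + 1 by have := normr_ge0 l; lra.
  (* For small [s] the bound [near], inserted into CN at ratio [s], compares the terms linear in
     [s]. [sl] keeps [t - s * l] nonnegative, so that it may be squared; [sL] makes the remaining
     error at most [e]. *)
  have [s [s0 s1 sl sL]] : exists s, [/\ 0 < s, s <= 1, s * (`|l| + 1) <= t &
      s * (d x x' ^+ 2 + 1) <= e].
    exists (Num.min 1 (Num.min (t / (`|l| + 1)) (e / (d x x' ^+ 2 + 1)))); split.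
    - by rewrite !lt_min ltr01 !divr_gt0.
    - by rewrite ge_min lexx.
    - by rewrite -ler_pdivlMr // !ge_min lexx orbT.
    - by rewrite -ler_pdivlMr // !ge_min lexx !orbT.
  have s01 : 0 <= s <= 1 by rewrite ltW.
  have h := near s s01; have cn := geo_cn hd x x' (phi t x) s01.
  rewrite dt in cn.
  have ll : s * l <= s * (`|l| + 1).
    by rewrite ler_wpM2l; [|exact: ltW|have := ler_norm l; lra].
  have sq : (t - s * l) ^+ 2 <= d (phi t x) (geo hd x x' s) ^+ 2.
    by rewrite ler_pXn2r ?nnegrE ?(pm_ge0 pm) //; lra.
  have key := le_trans sq cn.
  set D := d (phi t x) x' in key *; set L := d x x' in key sL *.
  have : s * (t ^+ 2 - 2 * t * l + L ^+ 2 - D ^+ 2) <= s * (s * L ^+ 2).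
    have := sqr_ge0 (s * l); rewrite -subr_ge0; lra.
  rewrite ler_pM2l // => h2; have : s * L ^+ 2 <= s * (L ^+ 2 + 1) by rewrite ler_pM2l //; lra.
  lra.
split=> //.
- by move=> x s t s0 t0; rewrite mul1r (sf_speed fl).
- move=> x y t t0; apply/le_anti; rewrite (sf_nonexp fl) //=.
  have [l hl] : exists l, forall e, 0 < e -> U [set z | `|d z x - d z y - l| < e].
    apply: (real_ultralimit (FU := FU) (f := fun z => d z x - d z y) (M := d x y)).
    apply: filterS filterT => z _ /=; rewrite !(pm_sym pm z); exact: (pm_dist pm).
  have hl' e : 0 < e -> U [set z | `|d z y - d z x - - l| < e].
    move=> /hl; apply: filterS => z /=.
    by rewrite !ltr_norml => /andP[*]; apply/andP; split; lra.
  have a := half x y l t t0 hl; have b := half y x (- l) t t0 hl'.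
  have := quadrilateral hd x (phi t x) y (phi t y).
  have dt u : d u (phi t u) = t.
    by rewrite -(pm_eq0l pm _ (sf_0 fl u)) (sf_speed fl) // sub0r normrN ger0_norm.
  rewrite !dt (pm_sym pm x (phi t y)) => q; apply: le_of_sqr; first exact: (pm_ge0 pm).
  by rewrite (pm_sym pm y x) in b; lra.
- exact: (sf_add fl).
- exact: (sf_0 fl).
Qed.

End AffineLimit.

End Fixed.

(** * Isometric flows on minimal spaces *)

Section Fixed.
Variables (k : nat) (Y : Type) (d : Y -> Y -> R) (act : G -> Y -> Y).
Hypothesis hY : hspace H S N eps dX k d act.
Hypothesis minY : minimal_hspace hY.
Let hd := hs_hd hY.
Let pm := hd_pm hd.
Let ia := hs_act hY.
Variable y0 : Y.

Lemma isoflow_or_step : has_hspace k.+1 \/ exists phi, isoflow d 1 phi.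
Proof.
have [f [fh fH]] := amenable y0 hY.
have [c0|nc0] := pselect (forall h, H h -> f (act h y0) = 0); last first.
  left; apply: contrapT => nst; apply: nc0 => h Hh; apply/eqP/negPn/negP => c0.
  by apply: nst; exact: (resolvent_step hY fh fH Hh c0).
right; have fc := hull_constant minY fh fH c0.
pose D := [set nqe : nat * (nat -> Y * Y * R) * R |
  (forall i, 0 <= (nqe.1.2 i).2 <= 1) /\ 0 < nqe.2].
pose BD (nqe : nat * (nat -> Y * Y * R) * R) :=
  [set y | forall i, (i < nqe.1.1)%N -> defect hY (nqe.1.2 i) y < nqe.2].
have FB : ProperFilter (filter_from D BD).
  apply: filter_from_proper; last first.
    by move=> [[n q] e] [/= q01 e0]; exact: (small_defects hY fh fc n e0 q01).
  apply: filter_from_filter.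
    by exists (0%N, fun=> (y0, y0, 0), 1); split => //= _; rewrite lexx ler01.
  move=> [[n q] e] [[n' q'] e'] [/= q01 e0] [/= q01' e0'].
  exists ((n + n')%N, fun i => if (i < n)%N then q i else q' (i - n)%N, Num.min e e').
    by split=> [i /=|/=]; [case: ifP|rewrite lt_min e0].
  move=> y; rewrite /BD /= => h; split=> i /= iN.
    have := h i (ltn_addr _ iN); rewrite iN => /lt_le_trans; apply.
    by rewrite ge_min lexx.
  have := h (n + i)%N; rewrite ltn_add2l [(n + i < n)%N]ltnNge leq_addr /= addKn => /(_ iN).
  by move=> /lt_le_trans; apply; rewrite ge_min lexx orbT.
have [U [FU BU]] := ultraFilterLemma FB.
have Udef p e : 0 <= p.2 <= 1 -> 0 < e -> U [set y | defect hY p y < e].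
  move=> p01 e0; apply: BU; exists (1%N, fun=> p, e); first by [].
  by move=> y /= /(_ 0%N isT).
have nb M : ~ U [set y | d y y0 <= M].
  exact: (affine_limit_bounded (hY := hY) FU Udef (y0 := y0)).
apply: (affine_limit_isoflow (hY := hY) FU Udef) => x M.
have [//|UM] := in_ultra_setVsetC [set y | M <= d x y] FU; exfalso.
apply: (nb (M + d x y0)); apply: filterS UM => y /= /negP; rewrite -ltNge => h.
by have := pm_tri pm y x y0; rewrite (pm_sym pm y x); lra.
Qed.

Lemma isoflow_conj h phi : H h -> isoflow d 1 phi ->
  isoflow d 1 (fun t x => act h (phi t (act h^-1%g x))).
Proof.
move=> Hh fl; have Hi := HV Hh; split=> [x s t s0 t0|x y t t0|x s t s0 t0|x].
- by rewrite (ia_iso ia) // (if_speed fl).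
- by rewrite (ia_iso ia) // (if_iso fl) // (ia_iso ia).
- rewrite (ia_iso ia) // (pm_eq0l pm _ (if_add fl _ s0 t0)) (if_iso fl) //.
  by rewrite (pm_sym pm) (act_Kinv hY).
- by rewrite -(pm_eq0r pm _ (act_invK hY x Hh)) (ia_iso ia) // (if_0 fl).
Qed.

(** The distance from [phi t x] to [psi t x] does not depend on [x], so flows are compared at [y0]
    alone. There all [phi t y0] lie within [t] of [y0], and the packing bound limits separated
    families. *)
Lemma isoflow_net t r : 0 <= t -> 0 < r -> exists n (f : nat -> R -> Y -> Y),
  (forall i, (i < n)%N -> isoflow d 1 (f i)) /\
  forall phi, isoflow d 1 phi -> exists2 i, (i < n)%N & forall x, d (phi t x) (f i t x) < r.
Proof.
move=> t0 r0; apply: contrapT => nonet.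
have indep phi psi x y : isoflow d 1 phi -> isoflow d 1 psi ->
    d (phi t x) (psi t x) = d (phi t y) (psi t y).
  move=> fp fq; apply/eqP; rewrite -(@eqrXn2 _ 2) ?(pm_ge0 pm) //; apply/eqP.
  rewrite !(flows_dist hd _ fp fq t0 t0).
  by rewrite (busemann_along_const hd fp fq x y).
have sep n : exists f : nat -> R -> Y -> Y, (forall i, (i < n)%N -> isoflow d 1 (f i)) /\
    forall i j, (i < j)%N -> (j < n)%N -> r <= d (f i t y0) (f j t y0).
  elim: n => [|n [f [fl fs]]]; first by exists (fun _ _ => id).
  have [phi [fp far]] : exists phi, isoflow d 1 phi /\
      forall i, (i < n)%N -> r <= d (phi t y0) (f i t y0).
    apply: contrapT => nphi; apply: nonet; exists n, f; split=> // phi fp.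
    apply: contrapT => ni; apply: nphi; exists phi; split=> // i iN.
    rewrite leNgt; apply/negP => dl; apply: ni; exists i => // x.
    by rewrite (indep _ _ x y0) //; exact: fl.
  exists (fun j => if j == n then phi else f j); split=> [j|i j ij].
    by rewrite ltnS leq_eqVlt; case: eqP => //= _ /fl.
  rewrite ltnS leq_eqVlt => /orP[/eqP jn|jn].
    by rewrite jn eqxx ltn_eqF -?jn // (pm_sym pm) far // -jn.
  by rewrite !ltn_eqF // ?(ltn_trans ij jn) // fs.
have [n hn] := hspace_geometry hY (t + t) r0; have [f [fl fs]] := sep n.
have [i j iN jN|i [j [ij jN]]] := hn (fun i => f i t y0).
  have := pm_tri pm (f i t y0) y0 (f j t y0).
  rewrite (pm_sym pm (f i t y0) y0) (if_dist hd (fl i iN)) // (if_dist hd (fl j jN)) //.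
  lra.
by rewrite ltNge fs.
Qed.

(** Isometric flows commute, so moving a common point of the earlier ranges by one more flow keeps
    it in all of them. *)
Lemma isoflow_common_range t n (f : nat -> R -> Y -> Y) : 0 <= t ->
  (forall i, (i < n)%N -> isoflow d 1 (f i)) ->
  exists x, forall i, (i < n)%N -> exists z, d x (f i t z) = 0.
Proof.
move=> t0; elim: n => [|n IH] fl; first by exists y0.
have [i iN|x hx] := IH; first by apply: fl; exact: ltnW.
have fn := fl n (leqnn _); exists (f n t x) => i.
rewrite ltnS leq_eqVlt => /orP[/eqP -> |iN]; first by exists x; exact: pm_refl.
have [z xz] := hx i iN; have fi := fl i (ltnW iN).
exists (f n t z); rewrite -(pm_eq0r pm _ (flows_commute hd z fn fi t0 t0)).
by rewrite (if_iso fn).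
Qed.

(* The points within [r] of the ranges of all isometric flows form an invariant
   closed convex set, hence are everything by minimality. *)
Lemma isoflow_surjective phi t y : isoflow d 1 phi -> 0 <= t ->
  exists x, d (phi t x) y = 0.
Proof.
move=> fp t0.
have near r x : 0 < r -> forall psi, isoflow d 1 psi ->
    forall e, 0 < e -> exists z, d x (psi t z) < r + e.
  move=> r0; apply: (minY (C := [set x | forall psi, isoflow d 1 psi ->
    forall e, 0 < e -> exists z, d x (psi t z) < r + e])); split.
  - have [n [f [fl net]]] := isoflow_net t0 r0.
    have [u hu] := isoflow_common_range t0 fl; exists u => psi fpsi e e0.
    have [i iN hi] := net psi fpsi; have [z uz] := hu i iN; exists z.
    by rewrite (pm_eq0l pm _ uz) (pm_sym pm); have := hi z; lra.
  - move=> u hu psi fpsi e e0; have e2 : 0 < e / 2 by lra.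
    have [w hw uw] := hu _ e2; have [z hz] := hw psi fpsi _ e2.
    by exists z; have := pm_tri pm u w (psi t z); rewrite (pm_sym pm u w); lra.
  - move=> u v s s01 hu hv psi fpsi e e0; have /andP[s0 s1] := s01.
    have [z hz] := hu psi fpsi e e0; have [w hw] := hv psi fpsi e e0.
    exists (geo hd z w s).
    rewrite (pm_eq0r pm _ (geo_map hd z w (fun a b => if_iso fpsi a b t0) s01)).
    apply: le_lt_trans (geo_dist hd u v _ _ s01) _.
    have s1' : 0 <= 1 - s by lra.
    have a := ler_wpM2l s1' (ltW hz); have b := ler_wpM2l s0 (ltW hw).
    have [s_eq0|s_gt0] := leP s 0.
      have -> : s = 0 by apply/le_anti; rewrite s_eq0.
      lra.
    by have : s * d v (psi t w) < s * (r + e) by [rewrite ltr_pM2l]; lra.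
  - move=> h u Hh hu psi fpsi e e0.
    have Hi := HV Hh; have := isoflow_conj Hi fpsi.
    rewrite invgK => fc; have [z hz] := hu _ fc e e0.
    exists (act h z); rewrite -(pm_eq0r pm _ (act_invK hY (psi t (act h z)) Hh)).
    by rewrite (ia_iso ia).
(* As [r] is arbitrary, the range of [phi t] is dense; preimages of a convergent sequence are Cauchy
   because [phi t] is isometric. *)
have pos n : 0 < (n.+1%:R^-1 : R) by rewrite invr_gt0 ltr0n.
have ex n : exists z, d y (phi t z) < n.+1%:R^-1.
  have p2 : 0 < (n.+1%:R^-1 / 2 : R) by rewrite divr_gt0.
  have [z hz] := near _ y p2 phi fp _ p2; exists z.
  by rewrite [ltRHS]splitr.
have [z hz] := choice ex.
have [|x hx] := hd_cpl hd (u := z).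
  move=> e e0; have [|n hn] := @harmonic_small R (e / 2); first by lra.
  exists n => i j /hn hi /hn hj; rewrite -(if_iso fp _ _ t0).
  have := lt_trans (hz i) hi; have := lt_trans (hz j) hj.
  by have := pm_tri pm (phi t (z i)) y (phi t (z j)); rewrite (pm_sym pm _ y); lra.
exists x; apply: (pm_eq0_le pm) => e e0; have e2 : 0 < e / 2 by lra.
have [n1 h1] := hx _ e2; have [n2 h2] := harmonic_small e2.
pose i := maxn n1 n2; have a := h1 i (leq_maxl _ _).
have b := lt_trans (hz i) (h2 i (leq_maxr _ _)).
have := pm_tri pm (phi t x) (phi t (z i)) y.
by rewrite (if_iso fp) // (pm_sym pm x (z i)) (pm_sym pm (phi t (z i)) y); lra.
Qed.

End Fixed.

(** * Maximal groups of Clifford translations *)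

Hypothesis linear_trivial : forall m (rho : G -> 'M[R]_m),
  rho 1%g = 1%:M ->
  (forall g h, Gam g -> Gam h -> rho (g * h)%g = rho g *m rho h) ->
  forall g, Gam g -> rho g = 1%:M.

(** A conjugate of a one-parameter group of translations is another one, and by maximality
    [span_or_extend] places it in the given group. So conjugation acts linearly on [R^(m+1)]. *)
Lemma clifford_step k (Y : Type) (d : Y -> Y -> R) (act : G -> Y -> Y) m
    (Psi : 'rV[R]_m.+1 -> Y -> Y) (hY : hspace H S N eps dX k d act) (y0 : Y) :
  clifford d Psi ->
  (forall Psi' : 'rV[R]_m.+2 -> Y -> Y, ~ clifford d Psi') ->
  has_hspace k.+1.
Proof.
move=> cl maxm; have hd := hs_hd hY; have pm := hd_pm hd; have ia := hs_act hY.
pose conj_to h (v w : 'rV[R]_m.+1) :=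
  forall x, d (act h (Psi v x)) (Psi w (act h x)) = 0.
have conjD h v w v' w' : H h -> conj_to h v w -> conj_to h v' w' ->
    conj_to h (v + v') (w + w').
  move=> Hh c c' x.
  have e : d (act h (Psi (v + v') x)) (act h (Psi v (Psi v' x))) = 0.
    by rewrite (ia_iso ia) // (cl_add cl).
  rewrite (pm_eq0l pm _ e) (pm_eq0l pm _ (c _)) (pm_eq0r pm _ (cl_add cl _ _ _)).
  by rewrite (cl_iso cl).
have conj0 h : H h -> conj_to h 0 0.
  move=> Hh x; rewrite (pm_eq0r pm _ (cl_0 cl _)) (ia_iso ia) //.
  exact: (cl_0 cl).
have ex (hi : G * 'I_m.+1) : exists a : 'rV[R]_m.+1, H hi.1 ->
    forall r, conj_to hi.1 (r *: delta_mx 0 hi.2) (r *: a).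
  case: hi => h i /=; have [Hh|nH] := pselect (H h); last by exists 0.
  pose F r x := act h (Psi (r *: delta_mx 0 i) (act h^-1%g x)).
  have Hi := HV Hh.
  have tf : transflow d F.
    split=> [r x y|r s x|r x]; rewrite /F.
    - by rewrite (ia_iso ia) // (cl_iso cl) (ia_iso ia).
    - rewrite (ia_iso ia) // scalerDl (pm_eq0l pm _ (cl_add cl _ _ _)) (cl_iso cl).
      by rewrite (pm_sym pm) (act_Kinv hY).
    - rewrite -(pm_eq0r pm _ (act_invK hY x Hh)) (ia_iso ia) //.
      apply/eqP; rewrite -(@eqrXn2 _ 2) ?(pm_ge0 pm) // (cl_norm cl).
      by rewrite real_normK ?num_real // dotvZl dotvZr dotv_delta mxE !eqxx /=; apply/eqP; ring.
  have [sp|[Psi' cl']] := span_or_extend hd cl tf y0; last by case: (maxm Psi').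
  exists (wvec d Psi y0 (F 1 y0)) => _ r x.
  rewrite -(pm_eq0r pm _ (sp r (act h x))) /F (ia_iso ia) // (cl_iso cl) (pm_sym pm).
  exact: (act_Kinv hY).
have [a ha] := choice ex.
(* Row [i] is the conjugate of the basis vector [i]. On row vectors [A] reverses products, hence the
   transpose in [AG]. *)
pose A h : 'M[R]_m.+1 := \matrix_i a (h, i).
have conjA h v : H h -> conj_to h v (v *m A h).
  move=> Hh; rewrite {1}(row_sum_delta v) mulmx_sum_row.
  apply: (big_ind2 (conj_to h)); [exact: conj0|by move=> *; exact: conjD|].
  by move=> i _; rewrite rowK; exact: (ha (h, i)).
have conj_inj h v w w' : conj_to h v w -> conj_to h v w' -> w = w'.
  move=> c c'; apply/eqP; rewrite -subr_eq0; apply/eqP/dotv_eq0.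
  rewrite -(cl_dist2 hd cl w w' (act h y0)).
  by rewrite -(pm_eq0l pm _ (c y0)) (c' y0) expr0n.
have eq_mul (B B' : 'M[R]_m.+1) : (forall v : 'rV[R]_m.+1, v *m B = v *m B') -> B = B'.
  by move=> e; apply/row_matrixP => i; rewrite !rowE.
have A1 : A 1%g = 1%:M.
  apply: eq_mul => v; apply: (conj_inj 1%g v); first exact: conjA.
  move=> x; rewrite mulmx1 (pm_eq0l pm _ (ia_1 ia _)) (cl_iso cl) (pm_sym pm).
  exact: (ia_1 ia).
have AM g h : H g -> H h -> A (g * h)%g = A h *m A g.
  move=> Hg Hh; apply: eq_mul => v; apply: (conj_inj (g * h)%g v).
    by apply: conjA; exact: HM.
  move=> x; rewrite (pm_eq0l pm _ (ia_M ia _ Hg Hh)) mulmxA.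
  have e : d (act g (act h (Psi v x))) (act g (Psi (v *m A h) (act h x))) = 0.
    by rewrite (ia_iso ia) //; exact: conjA.
  rewrite (pm_eq0l pm _ e) (pm_eq0l pm _ (conjA g _ Hg _)) (cl_iso cl) (pm_sym pm).
  exact: (ia_M ia).
have AG g : Gam g -> A g = 1%:M.
  move=> Gg; apply: trmx_inj; rewrite trmx1.
  apply: (linear_trivial (rho := fun g => (A g)^T)) => //; first by rewrite A1 trmx1.
  by move=> g' h' Gg' Gh'; rewrite AM ?trmx_mul //; exact: GamH.
have norm h v : H h -> exists w, forall x, d (Psi w (act h x)) (act h (Psi v x)) = 0.
  by move=> Hh; exists (v *m A h) => x; rewrite (pm_sym pm); exact: conjA.
have cent g v x : Gam g -> d (Psi v (act g x)) (act g (Psi v x)) = 0.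
  move=> Gg; rewrite (pm_sym pm); have := conjA g v (GamH Gg) x.
  by rewrite AG // mulmx1.
have [d'' hY''] := clifford_quotient FN HS GamH HV perfect hY cl norm cent.
by exists Y, d'', act; split=> //; exact: (inhabits y0).
Qed.

Lemma hspace_step k : has_hspace k -> has_hspace k.+1.
Proof.
move=> hk; have [//|[Y [d [act [hY [[y0] minY]]]]]] :=
  minimal_or_escape hk.
have hd := hs_hd hY.
have [//|[phi fp]] := isoflow_or_step minY y0.
have [F tf] := isoflow_two_sided hd fp
  (fun t y t0 => isoflow_surjective minY y0 y fp t0).
have [n hn] := clifford_dim hd y0 (hspace_geometry hY).
pose P m := exists Psi : 'rV[R]_m.+1 -> Y -> Y, clifford d Psi.
have P0 : P 0%N by exists (fun v => F (v 0 0)); exact: transflow_clifford.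
have Pn : ~ P n by move=> [Psi /hn]; rewrite ltnNge leqnSn.
have [m [[Psi cl] nPm]] : exists m, P m /\ ~ P m.+1.
  apply: contrapT => nex; apply: Pn; elim: n {hn} => [//|m Pm].
  by apply: contrapT => nPm; apply: nex; exists m.
by apply: (clifford_step hY y0 cl) => Psi' cl'; apply: nPm; exists Psi'.
Qed.

Lemma no_hspace : ~ has_hspace 0.
Proof.
move=> h0; have [n hn] := finitely_represented_dim bgX pmX.
have hk k : has_hspace k by elim: k => // k; exact: hspace_step.
have [Y [d [act [[y] hY]]]] := hk n.
by have := hn n Y d y (hd_pm (hs_hd hY)) (hs_fr hY); rewrite ltnn.
Qed.

End Step.

(** * Residual finiteness of finitely generated linear groups *)

Section ResidualFiniteness.
Variable F : numFieldType.

Lemma finite_field_root (k : finFieldType) (p : {poly k}) : (1 < size p)%N ->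
  exists (L : finFieldType) (iota : {rmorphism k -> L}) (c : L),
    root (map_poly iota p) c.
Proof.
move=> p1; have p0 : p != 0 by rewrite -size_poly_gt0 ltnW.
have [L [rs eqp _]] := FinSplittingFieldFor p0.
exists (FinFieldExtType L), (in_alg L).
have /eqp_size := eqp; rewrite size_map_poly size_prod_XsubC => sz.
case: rs sz eqp {p0} => [|z rs] sz eqp; first by rewrite sz in p1.
by exists z; rewrite (eqp_root eqp) root_prod_XsubC mem_head.
Qed.

(** The image of [ev] stands for a subring of [F], and a [psi] that kills the kernel of [ev] for a
    homomorphism from this subring to a finite field. Adjoining a generator to the subring then only
    replaces [A] by [{poly A}]. *)
Definition finitely_separated (A : idomainType) (ev : {rmorphism A -> F}) :=
  forall a, ev a != 0 -> exists (k : finFieldType) (psi : {rmorphism A -> k}),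
    (forall b, ev b = 0 -> psi b = 0) /\ psi a != 0.

Lemma finitely_separated_int : finitely_separated (intr : {rmorphism int -> F}).
Proof.
move=> a; rewrite intr_eq0 => a0.
have [p ap pp] := prime_above `|a|%N.
exists 'F_p, intr; split=> [b /eqP|]; first by rewrite intr_eq0 => /eqP ->.
rewrite -(dvdz_pcharf (pchar_Fp pp)) dvdzE /=; apply: contraL ap => /dvdn_leq.
by rewrite absz_gt0 -leqNgt; apply.
Qed.

Section Poly.
Variables (A : idomainType) (ev : {rmorphism A -> F}) (x : F).
Hypothesis sep : finitely_separated ev.

Definition eval_at : {rmorphism {poly A} -> F} := horner_eval x \o map_poly ev.

Lemma eval_atC a : eval_at a%:P = ev a.
Proof. by rewrite /eval_at /= map_polyC /horner_eval hornerC. Qed.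

Lemma eval_atX : eval_at 'X = x.
Proof. by rewrite /eval_at /= map_polyX /horner_eval hornerX. Qed.

(** Leading terms may vanish under [ev]; cutting them off changes nothing in [F] and makes sizes and
    pseudo-division behave as over a field. *)
Lemma truncate_poly (p : {poly A}) : map_poly ev p != 0 -> exists q : {poly A},
  [/\ map_poly ev q = map_poly ev p, size q = size (map_poly ev p) &
      ev (lead_coef q) != 0].
Proof.
move=> p0; set n := size (map_poly ev p).
have n0 : (0 < n)%N by rewrite size_poly_gt0.
have e : map_poly ev (take_poly n p) = map_poly ev p.
  apply/polyP => i; rewrite !coef_map coef_take_poly /=; case: ltnP => // ni.
  by rewrite rmorph0 -coef_map nth_default.
have lead : ev (take_poly n p)`_n.-1 != 0.
  by rewrite -coef_map e -lead_coefE lead_coef_eq0.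
have sz : size (take_poly n p) = n.
  apply/anti_leq; rewrite size_take_poly /= leqNgt -[X in (_ < X)%N](prednK n0) ltnS.
  by apply: contra lead => ?; rewrite nth_default ?rmorph0.
by exists (take_poly n p); split=> //; rewrite lead_coefE sz.
Qed.

(** If [x] is transcendental over the image of [ev], then ['X] may go to any element that is not a
    root of the reduced [a]. If [x] is algebraic, ['X] has to go to a root of the reduced minimal
    relation [q], and [a] survives because it divides a surviving constant [b] in the image. *)
Lemma finitely_separated_poly : finitely_separated eval_at.
Proof.
have [alg|tr] := pselect (exists q, eval_at q = 0 /\ map_poly ev q != 0); last first.
  have {}tr q : eval_at q = 0 -> map_poly ev q = 0.
    by move=> q0; apply/eqP; apply: contrapT => /negP ?; apply: tr; exists q.
  move=> a ea; have ma : map_poly ev a != 0.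
    by apply: contra ea => /eqP ma; rewrite /eval_at /= ma /horner_eval horner0.
  have : ev a`_(size (map_poly ev a)).-1 != 0.
    by rewrite -coef_map -lead_coefE lead_coef_eq0.
  move=> /sep[k [psi [kills psia]]].
  have pa : map_poly psi a != 0.
    by apply: contra psia => /eqP pa; rewrite -coef_map pa coef0.
  (* At a root [c] of this polynomial the reduced [a] takes an invertible value. *)
  have [|L [iota [c rc]]] := @finite_field_root k (map_poly psi a * 'X + 1%:P).
    by rewrite size_MXaddC (negbTE pa) /= ltnS size_poly_gt0.
  exists L, (horner_eval c \o map_poly (iota \o psi) : {rmorphism _ -> _}).
  split=> [b /tr mb|].
    rewrite /= (_ : map_poly _ b = 0) ?/horner_eval ?horner0 //.
    apply/polyP => i; rewrite coef_map coef0 /= kills ?rmorph0 //.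
    by rewrite -coef_map mb coef0.
  move: rc; rewrite /root rmorphD rmorphM /= map_polyX map_polyC /= rmorph1.
  rewrite -map_poly_comp !hornerE /= /horner_eval.
  by apply: contraTneq => ->; rewrite mul0r add0r oner_eq0.
have /ex_minnP[n /asboolP[q [q0 lq sq]] minq] : exists n, `[< exists q,
    [/\ eval_at q = 0, ev (lead_coef q) != 0 & size q = n] >].
  have [q [q0 /truncate_poly[q' [e sq' lq']]]] := alg.
  exists (size q'); apply/asboolP; exists q'; split=> //.
  by rewrite -q0 /eval_at /= e.
have {}minq r : eval_at r = 0 -> (size r < size q)%N -> map_poly ev r = 0.
  move=> r0 sr; apply/eqP; apply: contraTT sr => /truncate_poly[r' [e sr' lr']].
  rewrite -leqNgt sq (leq_trans (minq (size r') _)) //.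
    by apply/asboolP; exists r'; split=> //; rewrite -r0 /eval_at /= e.
  by rewrite sr' size_poly.
have qn0 : q != 0 by apply: contraNneq lq => ->; rewrite lead_coef0 rmorph0.
have mulE r s : eval_at (r * s) = eval_at r * eval_at s by rewrite rmorphM.
have scaleE (e : A) r : eval_at (e *: r) = ev e * eval_at r.
  by rewrite -mul_polyC mulE eval_atC.
move=> a ea.
(* Polynomials [p] of size below that of [q] whose value at [x] is a multiple of that of [a]; the
   smallest turns out to be constant. *)
pose P n := `[< exists p u, [/\ eval_at p = eval_at (a * u), ev (lead_coef p) != 0,
   (size p < size q)%N & size p = n] >].
have mkP (r u : {poly A}) : eval_at r = eval_at (a * u) -> (size r < size q)%N ->
    map_poly ev r != 0 -> exists2 n, P n & (n <= size r)%N.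
  move=> er sr /truncate_poly[r' [e sr' lr']]; exists (size r').
    apply/asboolP; exists r', u; split=> //; first by rewrite -er /eval_at /= e.
    by rewrite sr' (leq_ltn_trans (size_poly _ _)).
  by rewrite sr' size_poly.
have /ex_minnP[m /asboolP[p [u [ep lp spq sp]]] minp] : exists m, P m.
  have := Pdiv.ComRing.rdivp_eq q a.
  set s := _ ^+ _; set r := Pdiv.Ring.rmodp a q => eqr.
  have er : eval_at r = eval_at (a * s%:P).
    have := congr1 eval_at eqr; rewrite rmorphD mulE q0 mulr0 add0r scaleE mulE eval_atC.
    by move=> <-; rewrite mulrC.
  have [||m ? _] := mkP r s%:P er; last by exists m.
    exact: Pdiv.Ring.ltn_rmodpN0.
  apply: contraNneq ea => mr.
  have : eval_at r = 0 by rewrite /eval_at /= mr /horner_eval horner0.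
  rewrite er mulE eval_atC => /eqP; rewrite mulf_eq0 => /orP[//|].
  by rewrite /s rmorphXn expf_eq0 (negbTE lq) andbF.
have pn0 : p != 0 by apply: contraNneq lp => ->; rewrite lead_coef0 rmorph0.
have mp0 : map_poly ev p != 0.
  by apply: contraNneq lp => mp; rewrite lead_coefE -coef_map mp coef0.
have ep0 : eval_at p != 0 by apply: contraNneq mp0 => /minq ->.
(* The remainder of [q] by [p] is again such a multiple, so it vanishes by minimality. Then the
   quotient [s] is a relation for [x] and is as long as [q], which leaves a constant for [p]. *)
have sp1 : size p = 1%N.
  have := Pdiv.ComRing.rdivp_eq p q.
  set e := _ ^+ _; set s := Pdiv.Ring.rdivp q p; set r := Pdiv.Ring.rmodp q p => eqr.
  have ee : ev e != 0 by rewrite /e rmorphXn expf_neq0.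
  have sr : (size r < size p)%N by exact: Pdiv.Ring.ltn_rmodpN0.
  have mr : map_poly ev r = 0.
    apply/eqP; apply: contraTT (sr) => mr; rewrite -leqNgt sp.
    have [||m' Pm mr'] := mkP r (- (s * u)) _ _ mr.
    - have := congr1 eval_at eqr; rewrite rmorphD scaleE q0 mulr0 => /esym/eqP.
      rewrite addrC addr_eq0 => /eqP ->; rewrite mulrN rmorphN !mulE ep mulE; ring.
    - exact: (ltn_trans sr).
    - exact: leq_trans (minp _ Pm) mr'.
  have er : eval_at r = 0 by rewrite /eval_at /= mr /horner_eval horner0.
  have es : eval_at s = 0.
    have := congr1 eval_at eqr; rewrite rmorphD scaleE q0 mulr0 er addr0 mulE.
    by move=> /esym/eqP; rewrite mulf_eq0 (negbTE ep0) orbF => /eqP.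
  have := congr1 (map_poly ev) eqr; rewrite /= map_polyZ.
  rewrite rmorphD rmorphM /= mr addr0 => eqm.
  have mq0 : ev e *: map_poly ev q != 0.
    rewrite scaler_eq0 (negbTE ee) /=.
    by apply: contraNneq lq => mq; rewrite lead_coefE -coef_map mq coef0.
  have ms0 : map_poly ev s != 0.
    by apply: contraNneq mq0 => ms; rewrite eqm ms mul0r.
  have /truncate_poly[s' [e' ss' ls']] := ms0.
  have : (size q <= size s')%N.
    rewrite leqNgt; apply: contraNN ms0 => /minq h; rewrite -e' h //.
    by rewrite -es /eval_at /= e'.
  have := congr1 (size : {poly F} -> nat) eqm.
  rewrite size_mul // size_scale // => eqs.
  have : (size (map_poly ev q) <= size q)%N by exact: size_poly.
  have mps : size (map_poly ev p) = size p by rewrite size_map_poly_id0.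
  rewrite eqs ss' mps => h1 h2; have := leq_trans h1 h2.
  have : (0 < size p)%N by rewrite size_poly_gt0.
  have : (0 < size (map_poly ev s))%N by rewrite size_poly_gt0.
  case: (size _) => // n1 _; case: (size _) => // n2 _.
  by rewrite addnS /= -[X in (_ <= X)%N]addn0 leq_add2l leqn0 => /eqP ->.
have /eqP/size_poly1P[b b0 pb] := sp1.
have eb : ev b != 0 by move: ep0; rewrite pb eval_atC.
(* Keeping the leading coefficient of [q] alive gives the reduced [q] a positive degree, hence a
   root, and lets the factors from pseudo-division be cancelled. *)
have /sep[k [psi [kills]]] : ev (b * lead_coef q) != 0 by rewrite rmorphM mulf_neq0.
rewrite rmorphM mulf_eq0 negb_or => /andP[psib psiq].
have [|L [iota [c rc]]] := @finite_field_root k (map_poly psi q).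
  rewrite size_map_poly_id0 //; apply: leq_ltn_trans spq.
  by rewrite size_poly_gt0.
pose ps : {rmorphism {poly A} -> L} := horner_eval c \o map_poly (iota \o psi).
have psq : ps q = 0.
  by move: rc; rewrite /root -map_poly_comp => /eqP.
have psC y : ps y%:P = iota (psi y).
  by rewrite /ps /= map_polyC /horner_eval hornerC.
have pskills y : eval_at y = 0 -> ps y = 0.
  move=> ey; have := Pdiv.ComRing.rdivp_eq q y.
  set e := _ ^+ _; set s := Pdiv.Ring.rdivp y q; set r := Pdiv.Ring.rmodp y q => eqr.
  have sr : (size r < size q)%N by exact: Pdiv.Ring.ltn_rmodpN0.
  have er : eval_at r = 0.
    have := congr1 eval_at eqr.
    by rewrite rmorphD mulE q0 mulr0 add0r scaleE ey mulr0.
  have pr : ps r = 0.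
    rewrite /ps /= (_ : map_poly _ r = 0) ?/horner_eval ?horner0 //.
    apply/polyP => i; rewrite coef_map coef0 /= kills ?rmorph0 //.
    by rewrite -coef_map (minq _ er sr) coef0.
  have := congr1 ps eqr; rewrite rmorphD rmorphM psq mulr0 pr addr0 -mul_polyC rmorphM.
  rewrite psC => /eqP; rewrite mulf_eq0 fmorph_eq0 /e rmorphXn expf_eq0 (negbTE psiq).
  by rewrite andbF => /eqP.
exists L, ps; split=> //; apply: contraNneq psib => pa.
have : ps (p - a * u) = 0 by apply: pskills; rewrite rmorphB ep subrr.
by rewrite rmorphB rmorphM pa mul0r subr0 pb psC => /eqP; rewrite fmorph_eq0.
Qed.

End Poly.

Lemma finitely_separated_seq (s : seq F) :
  exists (A : idomainType) (ev : {rmorphism A -> F}), finitely_separated ev /\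
    forall x, x \in s -> exists a, ev a = x.
Proof.
elim: s => [|x s [A [ev [sep ih]]]].
  by exists int, intr; split=> //; exact: finitely_separated_int.
exists {poly A}, (eval_at ev x); split; first exact: finitely_separated_poly.
move=> y; rewrite inE => /orP[/eqP ->|/ih[a <-]].
  by exists 'X; rewrite eval_atX.
by exists a%:P; rewrite eval_atC.
Qed.

End ResidualFiniteness.

(** * Finite quotients, characters and linear representations of simple groups *)

Section SimpleSubgroups.
Local Open Scope group_scope.
Context {G : groupType}.
Implicit Types K Gam : set G.

Lemma subgroupV K x : subgroup K -> K x -> K x^-1.
Proof. by move=> [K1 KD] Kx; have := KD _ _ K1 Kx; rewrite mul1g. Qed.

Lemma subgroupM K x y : subgroup K -> K x -> K y -> K (x * y).
Proof.
by move=> sK Kx Ky; have := sK.2 _ _ Kx (subgroupV sK Ky); rewrite invgK.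
Qed.

Lemma subgroupJ K x y : subgroup K -> K x -> K y -> K (x ^ y).
Proof.
move=> sK Kx Ky; rewrite conjgE; apply: subgroupM => //.
  exact: subgroupV.
exact: subgroupM.
Qed.

(** [f] need not be a homomorphism: it is enough that elements with the same value are congruent
    modulo [K]. If [K] is trivial, [f] is injective on [Gam]. *)
Lemma simple_finite_kernel Gam K (T : finType) (f : G -> T) :
  simple_subgroup Gam -> subgroup K -> K `<=` Gam ->
  (forall n h, K n -> Gam h -> K (n ^ h)) ->
  (forall g h, Gam g -> Gam h -> f g = f h -> K (g / h)) ->
  finite_set Gam \/ K = Gam.
Proof.
move=> [_ _ simple] sK KG nK fK; have [K1|] := simple _ sK KG nK; last by right.
left; suff inj : {in Gam &, injective f}.
  by rewrite -(eq_finite_set (inj_card_eq inj)); exact: sub_finite_set (@subsetT _ _) _.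
move=> g h /set_mem Gg /set_mem Gh /fK => /(_ Gg Gh); rewrite K1 /= => gh.
by rewrite -(mulgVK h g) gh mul1g.
Qed.

Lemma simple_character_trivial (R : numDomainType) Gam (c : G -> R) :
  simple_subgroup Gam ->
  (forall g h, Gam g -> Gam h -> c (g * h) = (c g + c h)%R) ->
  forall g, Gam g -> c g = 0%R.
Proof.
move=> [sG _ simple] cM x Gx.
have GV g : Gam g -> Gam g^-1 by exact: subgroupV.
have GM y z : Gam y -> Gam z -> Gam (y * z) by exact: subgroupM.
have c1 : c 1 = 0%R.
  by have := cM 1 1 sG.1 sG.1; rewrite mulg1 -{1}[c 1]addr0 => /addrI.
have cV g : Gam g -> c g^-1 = (- c g)%R.
  move=> Gg; have := cM g g^-1 Gg (GV _ Gg); rewrite mulgV c1 => /esym/eqP.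
  by rewrite addrC addr_eq0 => /eqP.
(* With even multiples of [c x], [K] contains [x * x], so it is trivial only if [c x = 0]; and it
   contains [x] only if an odd multiple of [c x] vanishes. *)
pose K := [set g | Gam g /\ exists n : int, c g = ((n *+ 2)%:~R * c x)%R].
have [||g h [Gg [n gn]] Gh|KE|KE] := simple K.
- split; first by split; [exact: sG.1|exists 0%R; rewrite mul0rn mul0r].
  move=> g h [Gg [n gn]] [Gh [m hm]]; split; first exact: sG.2.
  exists (n - m)%R; rewrite cM ?cV //; last exact: GV.
  by rewrite gn hm mulrnBl intrB mulrBl.
- by move=> g [].
- split; first exact: subgroupJ.
  have Gh' := GV _ Gh; have Ggh := GM _ _ Gg Gh.
  exists n; rewrite conjgE !cM // cV //.
  by rewrite addrCA addNr addr0.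
- have : K (x * x).
    by split; [exact: subgroupM|exists 1%R; rewrite cM // -mulr2n mulr_natl].
  rewrite KE => /= /(congr1 c); rewrite cM // c1 -mulr2n => /eqP.
  by rewrite mulrn_eq0 => /eqP.
have [_ [n xn]] : K x by rewrite KE.
apply/eqP; have /eqP : ((n *+ 2 - 1)%:~R * c x = 0)%R.
  by rewrite intrB mulrBl -xn mul1r subrr.
rewrite mulf_eq0 intr_eq0 subr_eq0 -mulr_natr => /orP[/eqP|//].
by move=> /(congr1 (odd \o absz)); rewrite /= abszM oddM andbF.
Qed.

(** Malcev's argument: if an entry of [rho g] differs from that of the identity, a homomorphism to a
    finite field detects the difference and reduces [rho] to a finite matrix group. The kernel of
    the reduction is not [Gam], and as it is then trivial, [Gam] is finite. *)
Lemma simple_linear_trivial (F : numFieldType) Gam m (rho : G -> 'M[F]_m) :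
  simple_subgroup Gam -> finitely_generated Gam -> infinite_set Gam ->
  rho 1 = 1%:M%R ->
  (forall g h, Gam g -> Gam h -> rho (g * h) = (rho g *m rho h)%R) ->
  forall g, Gam g -> rho g = 1%:M%R.
Proof.
move=> simG [B /finite_seqP[S BS] GamE] infG rho1 rhoM g Gg.
have [sG _ _] := simG.
have SG s : s \in S -> Gam s.
  by move=> sS; rewrite GamE BS => K [_]; apply.
pose entries x := [seq rho x i j | i <- enum 'I_m, j <- enum 'I_m].
have [A [ev [sep hA]]] := finitely_separated_seq
  (flatten [seq entries s ++ entries s^-1 | s <- S]).
pose lifts x M := map_mx ev M = rho x.
have lift x : (forall i j, exists a, ev a = rho x i j) -> exists M, lifts x M.
  move=> h; have /choice[f fh] := fun ij => h ij.1 ij.2.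
  by exists (\matrix_(i, j) f (i, j))%R; apply/matrixP => i j; rewrite !mxE fh.
have Slift s : s \in S -> (exists M, lifts s M) /\ exists M, lifts s^-1 M.
  move=> sS; have h i j : (exists a, ev a = rho s i j) /\ exists a, ev a = rho s^-1 i j.
    have ent x : rho x i j \in entries x.
      by apply/allpairsP; exists (i, j); rewrite !mem_enum.
    have sE y : y \in entries s ++ entries s^-1 -> exists a, ev a = y.
      move=> ys; apply: hA; apply/flattenP; exists (entries s ++ entries s^-1) => //.
      by apply/mapP; exists s.
    by split; apply: sE; rewrite mem_cat ent // orbT.
  by split; apply: lift => i j; [exact: (h i j).1|exact: (h i j).2].
have Glift x : Gam x -> exists M, lifts x M.
  (* Lifts of inverses are included because subgroups are defined by closure under [x / y]. *)
  pose K := [set x | [/\ Gam x, exists M, lifts x M & exists M, lifts x^-1 M]].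
  suff : Gam `<=` K by move=> GK /GK[].
  rewrite {1}GamE; apply: smallest_sub.
    split.
      split; first exact: sG.1.
        by exists 1%:M%R; rewrite /lifts map_mx1.
      by exists 1%:M%R; rewrite /lifts invg1 map_mx1.
    move=> {}x y [Gx [M hM] [M' hM']] [Gy [L hL] [L' hL']]; split.
    - exact: sG.2.
    - exists (M *m L')%R; rewrite /lifts map_mxM hM hL' rhoM //.
      exact: subgroupV.
    - exists (L *m M')%R; rewrite /lifts map_mxM hL hM' invgM invgK rhoM //.
      exact: subgroupV.
  by rewrite BS => s /= sS; have [] := Slift s sS; split=> //; exact: SG.
apply/eqP; rewrite -subr_eq0; apply: contra_notT infG => neq.
have [i [j nij]] : exists i j, (rho g i j - (i == j)%:R != 0)%R.
  apply: contrapT => h; move/negP: neq; apply; apply/eqP/matrixP => i j.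
  rewrite !mxE; apply/eqP; apply: contrapT => /negP ?.
  by apply: h; exists i, j.
have [M hM] := Glift g Gg.
have : ev (M i j - (i == j)%:R)%R != 0%R.
  by rewrite rmorphB rmorph_nat; have := nij; rewrite -hM mxE.
move=> /sep[k [psi [kills psi0]]].
have psiE (M1 M2 : 'M[A]_m) : map_mx ev M1 = map_mx ev M2 -> map_mx psi M1 = map_mx psi M2.
  move=> /matrixP e; apply/matrixP => i' j'; rewrite !mxE; apply/eqP.
  rewrite -subr_eq0 -rmorphB; apply/eqP/kills; rewrite rmorphB; apply/eqP.
  by rewrite subr_eq0; have := e i' j'; rewrite !mxE => ->.
have [red redP] : exists red : G -> 'M[k]_m, forall x, Gam x ->
    forall M, lifts x M -> red x = map_mx psi M.
  have /choice[red redP] : forall x, exists M : 'M[k]_m, Gam x -> forall M', lifts x M' -> M = map_mx psi M'.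
    move=> x; have [/Glift[Mx lx]|nG] := pselect (Gam x); last by exists 0%R.
    by exists (map_mx psi Mx) => _ M' lM'; apply: psiE; rewrite lM'.
  by exists red.
have redM x y : Gam x -> Gam y -> red (x * y) = (red x *m red y)%R.
  move=> Gx Gy; have [Mx hx] := Glift x Gx; have [My hy] := Glift y Gy.
  rewrite (redP _ Gx _ hx) (redP _ Gy _ hy) -map_mxM; apply: redP.
    exact: subgroupM.
  by rewrite /lifts map_mxM hx hy rhoM.
have red1 : red 1 = 1%:M%R.
  rewrite -(map_mx1 psi); apply: redP; first exact: sG.1.
  by rewrite /lifts map_mx1.
have GV x : Gam x -> Gam x^-1 by exact: subgroupV.
have GM y z : Gam y -> Gam z -> Gam (y * z) by exact: subgroupM.
pose K := [set x | Gam x /\ red x = 1%:M%R].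
have [|x [Gx rx]|x h [Gx rx] Gh|x y Gx Gy rxy|//|KE] := @simple_finite_kernel Gam K _ red simG.
- split; first by split=> //; exact: sG.1.
  move=> x y [Gx rx] [Gy ry]; split; first exact: sG.2.
  rewrite redM ?rx ?mul1mx //; last exact: GV.
  by have := redM y y^-1 Gy (GV _ Gy); rewrite mulgV red1 ry mul1mx.
- by [].
- split; first exact: subgroupJ.
  have Gh' := GV _ Gh; have Gxh := GM _ _ Gx Gh.
  by rewrite conjgE !redM // rx mul1mx -redM // mulVg.
- split; first exact: sG.2.
  by rewrite redM ?rxy -?redM ?mulgV //; exact: GV.
have [_] : K g by rewrite KE.
rewrite (redP _ Gg _ hM) => /matrixP/(_ i j); rewrite !mxE => e.
by move: psi0; rewrite rmorphB rmorph_nat e subrr eqxx.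
Qed.

End SimpleSubgroups.

(** * Amenability *)

(** Functions with the topology of pointwise convergence, under a name of their own that carries the
    vector space structure; compactness comes from Tychonoff's theorem. *)
Definition pointwise (R : realType) (Y : Type) : Type :=
  prod_topology (fun _ : Y => R^o).

Section Pointwise.
Context {R : realType} {Y : Type}.
Local Notation E := (pointwise R Y).

HB.instance Definition _ := GRing.Lmodule.copy E (Y -> R^o).
HB.instance Definition _ :=
  Uniform.copy E (prod_topology (fun _ : Y => R^o)).

Lemma cvg_pointwise (T : Type) (F : set_system T) (u : T -> E) (f : E) : Filter F ->
  (forall y, (fun t => u t y : R^o) @ F --> (f y : R^o)) -> u @ F --> f.
Proof.
move=> FF uf; apply/cvg_sup => y A [_ [[B oB <-] Bf] BA].
by apply: (filterS BA); apply: (uf y); exact: open_nbhs_nbhs.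
Qed.

Lemma eval_continuous y : continuous (fun f : E => f y : R^o).
Proof. exact: (@proj_continuous {classic Y} (fun _ => R^o) y). Qed.

Lemma pointwise_add : continuous (fun p : E * E => p.1 + p.2).
Proof.
move=> [f g]; apply: (@cvg_pointwise (E * E)%type (nbhs (f, g)) _ (f + g)) => y.
apply: (@cvgD R R^o).
  by move=> A /eval_continuous; exact: (@cvg_fst _ _ (nbhs f) (nbhs g)).
by move=> A /eval_continuous; exact: (@cvg_snd _ _ (nbhs f) (nbhs g)).
Qed.

Lemma pointwise_scale : continuous (fun p : R^o * E => p.1 *: p.2).
Proof.
move=> [r g]; apply: (@cvg_pointwise (R^o * E)%type (nbhs (r, g)) _ (r *: g)) => y.
apply: (@cvgZ R R^o); first exact: cvg_fst.
by move=> A /eval_continuous; exact: (@cvg_snd _ _ (nbhs (r : R^o)) (nbhs g)).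
Qed.

Lemma pointwise_convex : exists2 B : set_system E,
  (forall b, b \in B -> convex_set b) & basis B.
Proof.
exists [set U | open U /\ convex_set U]; first by move=> U /set_mem[].
split=> [U []//|f].
pose F : set_system E := filter_from [set U | [set U | open U /\ convex_set U] U /\ U f] id.
have FF : Filter F.
  apply: filter_from_filter; first exists setT.
    by split=> //; split; [exact: openT|move=> x y l; rewrite inE].
  move=> U V [[oU cU] Uf] [[oV cV] Vf]; exists (U `&` V) => //; split; last by split.
  split; first exact: openI.
  move=> x y l; rewrite !in_setI => /andP[? ?] /andP[? ?].
  by rewrite cU // cV.
apply: (@cvg_pointwise _ F id) => y; apply/cvgrPdist_lt => e e0.
exists [set g : E | `|f y - g y| < e] => //; split; last by rewrite /= subrr normr0.
split.
  rewrite (_ : mkset _ = (fun g : E => g y : R^o) @^-1` ball (f y : R^o) e) //.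
  by apply: open_comp; [move=> ? _; exact: eval_continuous|exact: ball_open].
apply/convex_setW => g h; rewrite !inE /= => gl hl l l0 l1.
rewrite inE /= (_ : f y - _ = l%:num * (f y - g y) + (1 - l%:num) * (f y - h y)); last first.
  rewrite (_ : conv l g h y = l%:num * g y + (1 - l%:num) * h y) //.
  by move: (l%:num : R) (g y : R) (h y : R) (f y : R) => *; ring.
have l1' : 0 < 1 - l%:num by rewrite subr_gt0.
apply: le_lt_trans (ler_normD _ _) _; rewrite !normrM (gtr0_norm l0) (gtr0_norm l1').
rewrite (_ : e = l%:num * e + (1 - l%:num) * e); last by ring.
by apply: ltrD; rewrite ltr_pM2l.
Qed.

HB.instance Definition _ :=
  PreTopologicalNmodule_isTopologicalNmodule.Build E pointwise_add.
HB.instance Definition _ :=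
  TopologicalNmodule_isTopologicalLmodule.Build R E pointwise_scale.
HB.instance Definition _ := Uniform_isTvs.Build R E pointwise_convex.

Lemma pointwise_hausdorff : hausdorff_space E.
Proof.
by apply: (@hausdorff_product {classic Y} (fun _ => R^o)) => _; exact: norm_hausdorff.
Qed.

Lemma pointwise_compact (b : Y -> R) : compact [set f : E | forall y, `|f y| <= b y].
Proof.
have := @tychonoff {classic Y} (fun _ => R^o) (fun y => [set r : R | `|r| <= b y]).
apply=> y; rewrite (_ : mkset _ = `[- b y, b y]%classic); last first.
  by apply/seteqP; split=> r /=; rewrite in_itv /= ler_norml.
exact: segment_compact.
Qed.

End Pointwise.

Lemma continuous_linear_comb {R : realType} (T : topologicalType) (I : Type)
    (s : seq I) (c : I -> R) (u : I -> T -> R^o) : (forall i, continuous (u i)) ->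
  continuous (fun t => \sum_(i <- s) c i * u i t : R^o).
Proof.
move=> cu t; elim: s => [|i s ih].
  rewrite (_ : (fun t => _) = fun=> 0 : R^o); first exact: cst_continuous.
  by apply/funext => t'; rewrite big_nil.
rewrite (_ : (fun t => _) =
  fun t => (c i *: u i t + (\sum_(j <- s) c j * u j t) : R^o)).
  by apply: (@cvgD R R^o) => //; apply: (@cvgZr _ R^o); exact: cu.
by apply/funext => t'; rewrite big_cons.
Qed.

Section AmenableHoroHull.
Context {R : realType} {G : topologicalGroupType}.
Variables (H : set G) (S : seq G) (eps : R) (X : Type) (dX : X -> X -> R).
Hypothesis amenH : amenable_subgroup R H.
Let H1 : H 1%g. Proof. exact: amenH.1.1. Qed.
Let HV h : H h -> H h^-1%g. Proof. exact: subgroupV amenH.1. Qed.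
Let HM g h : H g -> H h -> H (g * h)%g. Proof. exact: subgroupM amenH.1. Qed.
Variables (k : nat) (Y : Type) (d : Y -> Y -> R) (act : G -> Y -> Y) (y0 : Y).
Hypothesis hY : hspace H S (nbhs 1%g) eps dX k d act.
Let hd := hs_hd hY.
Let pm := hd_pm hd.
Let ia := hs_act hY.
Let hull : set (pointwise R Y) := [set f | horo_hull d y0 f].

Let hull_dist f x y : hull f -> `|f x - f y| <= d x y.
Proof.
move=> hf; rewrite ler_norml.
have := hull_lipschitz hY hf x y; have := hull_lipschitz hY hf y x.
by rewrite (pm_sym pm y x) => ? ?; apply/andP; split; lra.
Qed.

Let hull_base f : hull f -> f y0 = 0.
Proof.
move=> hf; have h r : 0 <= r * f y0.
  have := hf [:: (r, y0)] 0; rewrite big_cons big_nil addr0; apply=> y.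
  by rewrite big_cons big_nil /= subrr mulr0 addr0.
by have := h 1; have := h (-1); lra.
Qed.

Let hull_compact : compact hull.
Proof.
apply: (subclosed_compact _ (@pointwise_compact R Y (fun y => d y y0))); last first.
  by move=> f hf y /=; rewrite -[f y]subr0 -(hull_base hf); exact: hull_dist.
rewrite (_ : hull = \bigcap_(p in [set p : seq (R * Y) * R |
    forall y, p.2 <= \sum_(q <- p.1) q.1 * (d y q.2 - d y y0)])
    [set f : pointwise R Y | p.2 <= \sum_(q <- p.1) q.1 * f q.2]); last first.
  by apply/seteqP; split=> f hf; [move=> [s c] /= /hf|move=> s c /(hf (s, c))].
apply: closed_bigI => -[s c] _ /=.
apply: (@closed_comp _ _ (fun f : pointwise R Y => \sum_(q <- s) q.1 * f q.2 : R^o)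
  [set r | c <= r]); last exact: (@closed_ge R).
move=> f _; apply: (@continuous_linear_comb R (pointwise R Y) _ s
  (fun q => q.1) (fun q g => g q.2)) => q.
exact: eval_continuous.
Qed.

(** Translates are normalized again to vanish at [y0], so the fixed points are the functions that
    [H] changes by constants only. *)
Let horo_act (h : G) (f : pointwise R Y) : pointwise R Y :=
  fun x => f (act h^-1%g x) - f (act h^-1%g y0).

Let horo_act_hull h f : H h -> hull f -> hull (horo_act h f).
Proof.
move=> Hh hf s c sc; set t := \sum_(p <- s) p.1.
have e (F : R * Y -> R) (b : R) : \sum_(p <- s) p.1 * (F p - b) =
    \sum_(p <- s) p.1 * F p - t * b.
  by rewrite mulr_suml -sumrB; apply: eq_bigr => p _; exact: mulrBr.
(* An affine inequality for the translate is one for [f] at the moved points; the normalization adds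
   the moved [y0] with weight [- t]. *)
have h0 := hf ((- t, act h^-1%g y0) :: [seq (p.1, act h^-1%g p.2) | p <- s]) c.
rewrite /horo_act (e (fun p => f (act h^-1%g p.2))) addrC -mulNr.
move: h0; rewrite big_cons big_map; apply=> y.
rewrite big_cons big_map /= (e (fun p => d y (act h^-1%g p.2))).
have := sc (act h y); rewrite (e (fun p => d (act h y) p.2)).
have eqd x : d (act h y) x = d y (act h^-1%g x).
  by rewrite -(pm_eq0r pm _ (act_invK HV hY x Hh)) (ia_iso ia).
by rewrite eqd; under eq_bigr do rewrite eqd; lra.
Qed.

Let horo_act_continuous_affine : continuous_affine_action H hull horo_act.
Proof.
split.
- by move=> h f; exact: horo_act_hull.
- move=> f hf; apply/funext => x; rewrite /horo_act invg1.
  by rewrite !(hull_eq0 hY hf (ia_1 ia _)) (hull_base hf) subr0.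
- move=> g h f Hg Hh hf; apply/funext => x; rewrite /horo_act invgM.
  rewrite !(hull_eq0 hY hf (ia_M ia _ (HV Hh) (HV Hg))); ring.
- move=> h f g t Hh hf hg t01; apply/funext => x.
  rewrite /horo_act.
  change (t * f (act h^-1%g x) + (1 - t) * g (act h^-1%g x) -
     (t * f (act h^-1%g y0) + (1 - t) * g (act h^-1%g y0)) =
    t * (f (act h^-1%g x) - f (act h^-1%g y0)) +
    (1 - t) * (g (act h^-1%g x) - g (act h^-1%g y0))); ring.
apply/subspace_continuousP => -[h f] [/= Hh hf].
(* Functions in the hull are 1-Lipschitz, and the points to which the inverses of [g] and [h] move
   [y] are as far apart as [g * h^-1] moves [y]. So continuity of orbit maps at 1 is enough. *)
have lim y : (fun p : G * pointwise R Y => p.2 (act p.1^-1%g y) : R^o) @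
    within (H `*` hull) (nbhs (h, f)) --> (f (act h^-1%g y) : R^o).
  apply/cvgrPdist_le => e e0; have e20 : 0 < e / 2 by lra.
  have n1 : nbhs (h, f) [set p : G * pointwise R Y | H (p.1 * h^-1)%g ->
      d (act (p.1 * h^-1)%g y) y < e / 2].
    have := ia_cts ia y e20; rewrite -[1%g](mulgV h) => n1.
    have c : continuous (fun g : G => (g * h^-1)%g).
      move=> g; apply: (@continuous_comp _ _ _ (fun g : G => (g, h^-1%g))
        (fun p : G * G => (p.1 * p.2)%g)); last exact: mulg_continuous.
      by apply: cvg_pair; [exact: cvg_id|exact: cvg_cst].
    exact: (@cvg_fst _ _ (nbhs h) (nbhs f) _ _ (c h _ n1)).
  have n2 : nbhs (h, f) [set p : G * pointwise R Y |
      `|f (act h^-1%g y) - p.2 (act h^-1%g y)| < e / 2].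
    have /cvgrPdist_lt/(_ _ e20) := @eval_continuous R Y (act h^-1%g y) f.
    exact: (@cvg_snd _ _ (nbhs h) (nbhs f)).
  apply: filterS2 n1 n2 => -[g f'] /= h1 h2 [Hg hf'].
  have Hgh := HM Hg (HV Hh).
  have := hull_dist (act h^-1%g y) (act g^-1%g y) hf'.
  have -> : d (act h^-1%g y) (act g^-1%g y) = d (act (g * h^-1)%g y) y.
    rewrite -(ia_iso ia _ _ Hg) (pm_eq0r pm _ (act_invK HV hY y Hg)).
    by rewrite (pm_eq0l pm _ (ia_M ia _ Hg (HV Hh))).
  have := h1 Hgh; move: h2; rewrite !ltr_norml !ler_norml => /andP[? ?] ? /andP[? ?].
  by apply/andP; split; lra.
apply: (@cvg_pointwise R Y _ _ (fun p : G * pointwise R Y => horo_act p.1 p.2)) => y.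
by apply: (@cvgB R R^o); exact: lim.
Qed.

Lemma amenable_horo_hull : exists f : Y -> R,
  horo_hull d y0 f /\ forall h x, H h -> f (act h x) = f x + f (act h y0).
Proof.
have [_ fix_pt] := amenH.
have [||||f hf fixf] := fix_pt (pointwise R Y) hull horo_act (@pointwise_hausdorff R Y).
- exists (fun x => d y0 x - d y0 y0) => s c; exact.
- exact: hull_compact.
- move=> f g l /set_mem hf /set_mem hg; apply/mem_set => s c sc.
  rewrite (_ : \sum_(p <- s) _ = l%:num * (\sum_(p <- s) p.1 * f p.2) +
    (1 - l%:num) * (\sum_(p <- s) p.1 * g p.2)); last first.
    rewrite !mulr_sumr -big_split /=; apply: eq_bigr => p _.
    rewrite (_ : conv l f g p.2 = l%:num * f p.2 + (1 - l%:num) * g p.2) //.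
    by move: (l%:num : R) (f p.2 : R) (g p.2 : R) => *; ring.
  have l1 : 0 <= 1 - l%:num by rewrite subr_ge0.
  have l0 : 0 <= (l%:num : R) by [].
  have := ler_wpM2l l0 (hf s c sc); have := ler_wpM2l l1 (hg s c sc).
  by move: (l%:num : R) => *; lra.
- exact: horo_act_continuous_affine.
exists f; split=> // h x Hh.
have e1 := congr1 (fun g => g (act h x)) (fixf h Hh).
have e2 := congr1 (fun g => g (act h y0)) (fixf h Hh).
have eK y : f (act h^-1%g (act h y)) = f y.
  by have := act_invK HV hY y (HV Hh); rewrite invgK => /(hull_eq0 hY hf).
by move: e1 e2; rewrite /horo_act !eK (hull_base hf) => <- <-; ring.
Qed.

End AmenableHoroHull.

(** * Totally disconnected groups *)

(** Replaces the passage to convergent subsequences. Typically [P i] is the set of counterexamples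
    to the choice [i], and a cluster point is contradictory. *)
Lemma compact_directed (T : topologicalType) (I : Type) (D : set I)
    (P : I -> set T) (C : set T) :
  compact C -> (exists2 i, D i & P i `<=` C) ->
  (forall i j, D i -> D j -> exists2 k, D k & P k `<=` P i `&` P j) ->
  (forall i, D i -> P i !=set0) ->
  exists x, C x /\ forall i, D i -> closure (P i) x.
Proof.
move=> cC [i0 D0 P0] dir ne.
have FF : ProperFilter (filter_from D P).
  by apply: filter_from_proper => //; apply: filter_from_filter => //; exists i0.
have [|x [Cx cx]] := cC _ FF; first by exists i0.
by exists x; split=> // i Di B; apply: cx; exists i.
Qed.

Section TopologicalGroups.
Local Open Scope group_scope.
Context {G : topologicalGroupType}.
Implicit Types (x y : G) (K L U V W : set G).

Lemma nbhs_mulg x y U : nbhs (x * y) U ->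
  exists A B, [/\ nbhs x A, nbhs y B & forall a b, A a -> B b -> U (a * b)].
Proof.
move=> /(@mulg_continuous G (x, y))[[A B] /= [Ax By] AB].
by exists A, B; split=> // a b Aa Bb; exact: (AB (a, b)).
Qed.

Lemma mulgl_continuous x : continuous (fun y : G => x * y).
Proof.
move=> y; apply: (@continuous_comp _ _ _ (fun y : G => (x, y))
  (fun p : G * G => p.1 * p.2)); last exact: mulg_continuous.
by apply: cvg_pair; [exact: cvg_cst|exact: cvg_id].
Qed.

Lemma nbhs_mulgl x y U : nbhs y U -> nbhs (x * y) [set z | U (x^-1 * z)].
Proof. by move=> Uy; apply: mulgl_continuous; rewrite mulKg. Qed.

Lemma nbhs_lcoset x W : nbhs 1 W -> nbhs x [set z | W (x^-1 * z)].
Proof. by move=> /(nbhs_mulgl x); rewrite mulg1. Qed.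

Lemma compact_lcoset x K : compact K -> compact [set z | K (x^-1 * z)].
Proof.
rewrite (_ : [set z | _] = [set x * y | y in K]); last first.
  apply/seteqP; split=> z /=; first by move=> Kz; exists (x^-1 * z) => //; exact: mulVKg.
  by move=> [y Ky <-]; rewrite mulKg.
apply: continuous_compact; apply: continuous_subspaceT; exact: mulgl_continuous.
Qed.

Lemma compact_mul_nbhs K U : compact K -> K `<=` U -> open U ->
  exists2 W, nbhs 1 W & forall x w, K x -> W w -> U (x * w).
Proof.
move=> cK KU oU; apply: contrapT => nW.
pose P W := [set x | K x /\ exists2 w, W w & ~ U (x * w)].
have [|W W' W1 W1'|W W1|z [Kz cz]] := @compact_directed G _ (nbhs (1 : G)) P K cK.
- by exists setT; [exact: filterT|move=> x []].
- exists (W `&` W'); first exact: filterI.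
  by move=> x [Kx [w [Ww Ww'] nU]]; split; split=> //; exists w.
- apply: contrapT => h; apply: nW; exists W => // x w Kx Ww.
  by apply: contrapT => nU; apply: h; exists x; split=> //; exists w.
have [|A [B [zA B1 AB]]] := @nbhs_mulg z 1 U.
  by rewrite mulg1; apply: open_nbhs_nbhs; split=> //; exact: KU.
have [x [[Kx [w Bw nU]] Ax]] := cz _ B1 _ zA.
by apply: nU; exact: AB.
Qed.

Lemma nbhs_mulVg z W : nbhs 1 W -> nbhs z [set x | W (x^-1 * z)].
Proof.
move=> W1; have c : continuous (fun x : G => x^-1 * z).
  move=> x; apply: (@continuous_comp _ _ _ (fun x : G => (x^-1, z))
    (fun p : G * G => p.1 * p.2)); last exact: mulg_continuous.
  by apply: cvg_pair; [exact: invg_continuous|exact: cvg_cst].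
by apply: c; rewrite mulVg.
Qed.

Lemma nbhs1_square W : nbhs 1 W ->
  exists2 W', nbhs 1 W' & forall x y, W' x -> W' y -> W (x * y).
Proof.
rewrite -{1}[1](mulg1 1) => /nbhs_mulg[A [B [A1 B1 AB]]].
by exists (A `&` B); [exact: filterI|move=> x y [Ax _] [_ By]; exact: AB].
Qed.

Section Chains.
Variable K : set G.

(** Points reachable from 1 inside [K] by steps in [W]. For compact [K], those reachable for every
    neighbourhood [W] of 1 form a connected set. *)
Inductive chain W : G -> Prop :=
| chain1 : chain W 1
| chainM x w : chain W x -> W w -> K (x * w) -> chain W (x * w).

Hypotheses (K1 : K 1) (cK : compact K).

Lemma chain_sub W x : chain W x -> K x.
Proof. by case. Qed.

Lemma chain_mono W W' x : W `<=` W' -> chain W x -> chain W' x.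
Proof.
by move=> WW'; elim=> [|{}x w _ ih Ww Kxw]; constructor=> //; exact: WW'.
Qed.

Lemma chain_cluster W z : nbhs 1 W -> K z ->
  (forall A, nbhs z A -> exists2 x, chain W x & A x) -> chain W z.
Proof.
move=> W1 Kz /(_ [set x | W (x^-1 * z)])[|x cx Wx].
  exact: nbhs_mulVg.
by rewrite -(mulVKg x z); constructor=> //; rewrite mulVKg.
Qed.

Lemma chains_cluster (P : set G) :
  (forall W, nbhs 1 W -> exists2 x, chain W x & P x) ->
  exists z, [/\ forall W, nbhs 1 W -> chain W z, closure P z & K z].
Proof.
move=> hP; pose Q W := [set x | chain W x /\ P x].
have [|W W' W1 W1'|W /hP[x]|z [Kz cz]] := @compact_directed G _ (nbhs (1 : G)) Q K cK.
- by exists setT; [exact: filterT|move=> x [/chain_sub]].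
- exists (W `&` W'); first exact: filterI.
  by move=> x [cx Px]; split; split=> //; apply: chain_mono cx => ? [].
- by exists x.
exists z; split=> //.
  move=> W W1; apply: chain_cluster => // A /(cz _ W1)[x [[cx _] Ax]].
  by exists x.
by move=> A /(cz _ filterT)[x [[_ Px] Ax]]; exists x.
Qed.

(** If a relatively clopen part of [Z] contained 1 but not all of [Z], chains with ever smaller
    steps would leave it through the collar [P]. Their points in [P] cluster at a point of [Z] that
    is too near the part to be outside it and too far to be inside. *)
Lemma chains_trivial : totally_disconnected [set: G] ->
  forall z, (forall W, nbhs 1 W -> chain W z) -> z = 1.
Proof.
move=> td z hz; pose Z := [set z | forall W, nbhs 1 W -> chain W z].
have Z1 : Z 1 by move=> W _; exact: chain1.
suff cZ : connected Z.
  have := td 1 I; rewrite eqEsubset => -[h _].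
  by apply: h; exists Z => //; split.
have ZK x : Z x -> K x by move=> /(_ setT filterT)/chain_sub.
have claim O F : open O -> closed F -> Z `&` O = Z `&` F -> O 1 -> Z `<=` O.
  move=> oO cF OF O1 b Zb; apply: contrapT => nOb.
  have cA : compact (Z `&` F).
    move=> Phi PF PA; have [|x [Kx cx]] := cK PF.
      by apply: filterS PA => x [/ZK].
    exists x; split=> //; split.
      move=> W W1; apply: chain_cluster => // A /(cx _ _ PA)[y [[Zy _] Ay]].
      by exists y => //; exact: Zy.
    apply: cF => A /(cx _ _ PA)[y [[_ Fy] Ay]]; by exists y.
  have AO : Z `&` F `<=` O by rewrite -OF => x [].
  have [W00 W00n AW] := compact_mul_nbhs cA AO oO.
  have [W0 W0n W0W] := nbhs1_square W00n.
  have [W1 W1n W1W] := nbhs1_square W0n.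
  pose P := [set x | (exists2 a, (Z `&` F) a & W0 (a^-1 * x)) /\
                     ~ exists2 a, (Z `&` F) a & W1 (a^-1 * x)].
  have A1 : (Z `&` F) 1 by rewrite -OF.
  have [|z' [hz' clz Kz']] := chains_cluster (P := P).
  - move=> W Wn; apply: contrapT => nP.
    have near x : chain (W `&` W1) x -> exists2 a, (Z `&` F) a & W1 (a^-1 * x).
      elim=> [|{}x w cx [a Aa ax] [Ww W1w] Kxw].
        by exists 1 => //; rewrite mulVg; exact: nbhs_singleton.
      apply: contrapT => nx; apply: nP; exists (x * w).
        by constructor=> //; apply: chain_mono cx => ? [].
      by split=> //; exists a => //; rewrite mulgA; exact: W1W.
    have [a Aa ab] := near b (Zb _ (filterI Wn W1n)).
    apply: nOb; rewrite -(mulVKg a b); apply: AW => //.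
    rewrite -[_ * b]mulg1; apply: W0W; last exact: nbhs_singleton.
    by rewrite -[_ * b]mulg1; apply: W1W => //; exact: nbhs_singleton.
  - have [x [[[a Aa ax] _] xz]] := clz _ (nbhs_mulVg z' W0n).
    have Oz : O z'.
      rewrite -(mulVKg a z'); apply: AW => //.
      by rewrite -(mulVKg x z') mulgA; exact: W0W.
    have Az : (Z `&` F) z' by rewrite -OF.
    have [y [[_ nP] yz]] := clz _ (nbhs_lcoset z' W1n).
    by apply: nP; exists z'.
move=> B [b Bb] [U oO BO] [F cF BF].
have OF : Z `&` U = Z `&` F by rewrite -BO.
have [U1|nU1] := pselect (U 1).
  by rewrite BO; apply/setIidl; exact: claim OF U1.
have nF1 : ~ F 1.
  by move=> F1; apply: nU1; have : (Z `&` F) 1 by []; rewrite -OF => -[].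
have [] : ~ F b.
  have h := @claim (~` F) (~` U); apply: h => //.
  - exact: closed_openC.
  - exact: open_closedC.
  - apply/seteqP; split=> x [Zx nx]; split=> // x'.
      by have : (Z `&` U) x by []; rewrite OF => -[].
    by have : (Z `&` F) x by []; rewrite -OF => -[].
  - by move: Bb; rewrite BF => -[].
by move: Bb; rewrite BF => -[].
Qed.

End Chains.

Definition compact_open_subgroup V := [/\ subgroup V, nbhs 1 V & compact V].

(** Van Dantzig's theorem. For small steps all chains stay in [W0], whose products lie in [K]; so
    [K] never stops a chain, and chains with symmetric steps form a subgroup. *)
Lemma compact_open_subgroup_basis K U : totally_disconnected [set: G] ->
  nbhs 1 K -> compact K -> nbhs 1 U ->
  exists2 V, compact_open_subgroup V & V `<=` U.
Proof.
move=> td Kn cK Un; have K1 : K 1 by exact: nbhs_singleton.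
have [W0 W0n W0W] := nbhs1_square (filterI Kn Un).
have [W Wn chW] : exists2 W, nbhs 1 W & forall x, chain K W x -> W0 x.
  apply: contrapT => nW.
  have [|z [hz clz Kz]] := chains_cluster K1 cK (P := ~` W0).
  - move=> W Wn; apply: contrapT => nP; apply: nW; exists W => // x cx.
    by apply: contrapT => nx; apply: nP; exists x.
  - have z1 := chains_trivial K1 cK td hz.
    have [x [nx Wx]] : (~` W0 `&` W0) !=set0 by apply: clz; rewrite z1.
    by [].
pose W' := [set x | (W `&` W0) x /\ (W `&` W0) x^-1].
have W'n : nbhs 1 W'.
  apply: filterI; first exact: filterI.
  by apply: invg_continuous; rewrite invg1; exact: filterI.
have W'W : W' `<=` W by move=> x [[]].
pose V := chain K W'.
have VW0 x : V x -> W0 x by move=> /(chain_mono W'W)/chW.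
have W01 : W0 1 by exact: nbhs_singleton.
have VM x w : V x -> W' w -> V (x * w).
  move=> Vx W'w; apply: chainM => //; have [] : (K `&` U) (x * w).
    by apply: W0W; [exact: VW0|case: W'w => -[]].
  by [].
have VV x y : V x -> V y -> V (x * y).
  by move=> Vx; elim=> [|{}y w _ ih W'w _]; rewrite ?mulg1 // mulgA; exact: VM.
have W'V w : W' w -> V w by move=> W'w; rewrite -[w]mul1g; apply: VM => //; exact: chain1.
have Vi x : V x -> V x^-1.
  elim=> [|{}x w _ ih W'w _]; first by rewrite invg1; exact: chain1.
  rewrite invgM; apply: VV => //; apply: W'V; rewrite /W' /= invgK.
  by case: W'w.
exists V; first split.
- by split; [exact: chain1|move=> x y Vx Vy; apply: VV => //; exact: Vi].
- by apply: filterS W'n => w; exact: W'V.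
- move=> Phi PF PV; have [|x [Kx cx]] := cK Phi PF.
    by apply: filterS PV => x; exact: chain_sub.
  exists x; split=> //; apply: chain_cluster => // A /(cx _ _ PV)[y [Vy Ay]].
  by exists y.
- move=> x Vx; have [] : (K `&` U) x.
    by rewrite -[x]mulg1; apply: W0W => //; exact: VW0.
  by [].
Qed.

Lemma totally_disconnected_separated x : totally_disconnected [set: G] ->
  (forall U, nbhs 1 U -> U x) -> x = 1.
Proof.
move=> td h; have := td x I; rewrite eqEsubset => -[+ _] => /(_ 1) e; apply/esym/e.
exists (closure [set x]); last first.
  by move=> A /h Ax; exists x.
split=> //; first exact: subset_closure.
apply: connected_closure; exact: connected1.
Qed.

Lemma compact_finite_cosets L V : compact L -> nbhs 1 V -> exists s : seq G,
  forall x, L x -> exists i : 'I_(size s), V ((nth 1 s i)^-1 * x).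
Proof.
move=> cL Vn; apply: contrapT => ns.
pose P (s : seq G) := [set x | L x /\ forall y, y \in s -> ~ V (y^-1 * x)].
have [|s t _ _|s _|x [Lx cx]] := @compact_directed G _ setT P L cL.
- by exists [::] => // x [].
- exists (s ++ t) => // x [Lx h].
  by split; split=> // y ys; apply: h; rewrite mem_cat ys ?orbT.
- apply: contrapT => h; apply: ns; exists s => x Lx.
  apply: contrapT => nx; apply: h; exists x; split=> // y ys Vy; apply: nx.
  have ys' : (index y s < size s)%N by rewrite index_mem.
  by exists (Ordinal ys'); rewrite /= nth_index.
have [y [[_ h] Vy]] := cx [:: x] I _ (nbhs_lcoset x Vn).
by apply: (h x); rewrite ?mem_head.
Qed.

(** [Gam] permutes the cosets of [V] that meet [L]. They are finitely many by compactness, and an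
    infinite simple group acts trivially on a finite set. *)
Lemma compact_orbit_fixed Gam L V : simple_subgroup Gam -> infinite_set Gam ->
  compact L -> subgroup V -> nbhs 1 V ->
  (forall g x, Gam g -> L x -> exists2 y, L y & V (y^-1 * (g * x))) ->
  forall g x, Gam g -> L x -> V (x^-1 * (g * x)).
Proof.
move=> simG infG cL sV Vn LV.
have [sG _ _] := simG.
have VM x y : V x -> V y -> V (x * y) by exact: subgroupM.
have VI x : V x -> V x^-1 by exact: subgroupV.
have GV x : Gam x -> Gam x^-1 by exact: subgroupV.
have GM y z : Gam y -> Gam z -> Gam (y * z) by exact: subgroupM.
have [s hs] := compact_finite_cosets cL Vn.
have sy x y : V (x^-1 * y) -> V (y^-1 * x) by move=> /VI; rewrite invgM invgK.
have tr x y z : V (x^-1 * y) -> V (y^-1 * z) -> V (x^-1 * z).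
  by move=> Vxy Vyz; have := VM _ _ Vxy Vyz; rewrite -mulgA mulVKg.
have lmul g x y : V (x^-1 * y) -> V ((g * x)^-1 * (g * y)).
  by rewrite invgM -mulgA mulKg.
pose K := [set g | Gam g /\ forall x, L x -> V (x^-1 * (g * x))].
(* The permutation as a set of pairs of coset representatives, by their indices in [s]. *)
pose f g := [set p : 'I_(size s) * 'I_(size s) |
  `[< exists2 x, L x & V ((nth 1 s p.1)^-1 * x) /\ V ((nth 1 s p.2)^-1 * (g * x)) >]]%SET.
have [|g [Gg Kg]|g h [Gg Kg] Gh|g h Gg Gh fgh|//|KE] := @simple_finite_kernel G Gam K _ f simG.
- split; first by split; [exact: sG.1|move=> x _; rewrite mul1g mulVg; exact: nbhs_singleton].
  move=> g h [Gg Kg] [Gh Kh]; split; first exact: sG.2.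
  move=> x Lx; have [y Ly yx] := LV h^-1 x (GV _ Gh) Lx.
  have e1 : V (x^-1 * (h * y)) by have := lmul h _ _ yx; rewrite mulVKg => /sy.
  have e2 : V (x^-1 * y) by apply: (tr _ _ _ e1); apply: sy; exact: Kh.
  apply: (tr _ _ _ e2); apply: (tr _ _ _ (Kg y Ly)).
  by rewrite -mulgA; apply: lmul.
- by [].
- split; first exact: subgroupJ.
  move=> x Lx; have [y Ly yx] := LV h x Gh Lx.
  rewrite conjgE -!mulgA; have := lmul h^-1 (h * x) (g * (h * x)); rewrite mulKg; apply.
  by apply: (tr _ _ _ (sy _ _ yx)); apply: (tr _ _ _ (Kg y Ly)); apply: lmul.
- split; first exact: sG.2.
  move=> x Lx; have [y Ly yx] := LV h^-1 x (GV _ Gh) Lx.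
  have [i iy] := hs y Ly; have [z Lz zy] := LV h y Gh Ly; have [j jz] := hs z Lz.
  have : (i, j) \in f h.
    by rewrite inE; apply/asboolP; exists y => //; split=> //=; exact: (tr _ _ _ jz zy).
  rewrite -fgh inE => /asboolP[y' Ly' [/= iy' jy']].
  have yy' : V (y^-1 * y') by exact: (tr _ _ _ (sy _ _ iy) iy').
  have gy : V ((h * y)^-1 * (g * y)).
    apply: (tr _ _ _ (sy _ _ (tr _ _ _ jz zy))); apply: (tr _ _ _ jy'); apply: lmul; exact: sy.
  have hy : V (x^-1 * (h * y)) by have := lmul h _ _ yx; rewrite mulVKg => /sy.
  apply: (tr _ _ _ hy); apply: (tr _ _ _ gy); rewrite -mulgA; exact: lmul.
by move=> g x Gg Lx; have [_ Kg] : K g; [rewrite KE|exact: Kg].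
Qed.

End TopologicalGroups.

(** * Proper cocompact actions of totally disconnected groups *)

Section Cocompact.
Context {R : realType} {X : completeMetricType R} {G : topologicalGroupType}.
Variable a : group_action G X.
Hypotheses (lcX : locally_compact [set: X]) (ctsa : continuous_action a)
  (isoa : isometric_action a) (propa : proper_action a) (cca : cocompact_action a).

Lemma mdist_pseudometric : pseudometric (@mdist R X).
Proof.
split; [exact: mdistxx|exact: metric_sym|exact: metric_triangle].
Qed.
Let pm := mdist_pseudometric.

Lemma nbhs_mdist_lt (x : X) e : 0 < e -> nbhs x [set y | mdist x y < e].
Proof. by move=> e0; apply/metricType_numDomainType.nbhs_mdistP; exists e. Qed.

Lemma compact_nbhs (x : X) : exists2 B : set X, compact B & nbhs x B.
Proof.
have := lcX (x := x) I; rewrite withinET => -[B Bx [cB _]].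
by exists B.
Qed.

Lemma act_continuous g : continuous (a g).
Proof.
move=> x; apply: (@continuous_comp _ _ _ (fun x : X => (g, x))
  (fun p : G * X => a p.1 p.2)); last exact: ctsa.
by apply: cvg_pair; [exact: cvg_cst|exact: cvg_id].
Qed.

Lemma orbit_continuous x : continuous (a^~ x).
Proof.
move=> g; apply: (@continuous_comp _ _ _ (fun g : G => (g, x))
  (fun p : G * X => a p.1 p.2)); last exact: ctsa.
by apply: cvg_pair; [exact: cvg_id|exact: cvg_cst].
Qed.

Lemma actK g x : a g^-1%g (a g x) = x.
Proof. by rewrite -actM mulVg act1. Qed.

Lemma actKV g x : a g (a g^-1%g x) = x.
Proof. by rewrite -actM mulgV act1. Qed.

Lemma compact_fundamental : exists2 C : set X, compact C & forall x, exists g, C (a g x).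
Proof.
have /choice[B hB] : forall x : X, exists B : set X, compact B /\ nbhs x B.
  by move=> x; have [B] := compact_nbhs x; exists B.
apply: contrapT => nC; pose pi : X -> orbit_space a := \pi_(orbit_space a)%qT.
pose P (s : seq X) := [set x | forall y g, y \in s -> ~ B y (a g x)].
have [|s t _ _|s _|q [_ cq]] := @compact_directed _ _ setT (fun s => pi @` P s) _ cca.
- by exists [::].
- exists (s ++ t) => // _ [x Px <-].
  by split; exists x => // y g ys; apply: Px; rewrite mem_cat ys ?orbT.
- apply: contrapT => h; apply: nC.
  exists (\big[setU/set0]_(y <- s) B y).
    by apply: bigsetU_compact => y _; exact: (hB y).1.
  move=> x; apply: contrapT => nx; apply: h; exists (pi x), x => // y g ys By.
  by apply: nx; exists g; rewrite -bigcup_seq; exists y.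
pose x := repr q; have qx : pi x = q by exact: reprK.
pose O := [set q' | exists2 z, interior (B x) z & pi z = q'].
have oO : open O.
  rewrite /open /= /quotient_open (_ : _ @^-1` O = \bigcup_g (a g @^-1` interior (B x))).
    by apply: bigcup_open => g _; apply: open_comp;
      [move=> z _; exact: act_continuous|exact: open_interior].
  apply/seteqP; split=> z.
    by move=> [z' Bz' /eqmodP/asboolP[g ->]]; exists g^-1%g; rewrite //= actK.
  move=> [g _ Bgz]; exists (a g z) => //; apply/eqmodP/asboolP; exists g^-1%g.
  by rewrite actK.
have Oq : nbhs q O.
  apply: open_nbhs_nbhs; split=> //; exists x => //; exact: (hB x).2.
have [_ [[z Pz <-] [z' Bz' /eqmodP/asboolP[g e]]]] := cq [:: x] I _ Oq.
apply: (Pz x g^-1%g (mem_head _ _)); rewrite e actK; exact: interior_subset.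
Qed.

Lemma compact_nbhs1 : exists2 K : set G, compact K & nbhs 1%g K.
Proof.
have [B cB Bx] := compact_nbhs point.
exists [set g | (a g @` B) `&` B !=set0]; first exact: propa.
have Bn : nbhs 1%g (a^~ point @^-1` B).
  by apply: orbit_continuous; rewrite act1.
apply: filterS Bn => g Bg; exists (a g point); split=> //; exists point => //.
exact: nbhs_singleton.
Qed.

Hypothesis td : totally_disconnected [set: G].

(** By properness the elements that move [y] only a little lie in a compact set, and where they
    cluster as [e] tends to 0, they fix [y]. *)
Lemma near_stabilizer y V : nbhs 1%g V -> exists2 e : R, 0 < e &
  forall g, mdist (a g y) y < e -> exists2 q, a q y = y & V (q^-1 * g)%g.
Proof.
move=> Vn; apply: contrapT => ne.
have [B cB Bn] := compact_nbhs y.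
pose M := [set g | (a g @` B) `&` B !=set0].
pose P e := [set g | mdist (a g y) y < e /\ ~ exists2 q, a q y = y & V (q^-1 * g)%g].
have /metricType_numDomainType.nbhs_mdistP[r /= r0 rB] := Bn.
have [|e e' e0 e'0|e e0|q [_ cq]] :=
  @compact_directed _ _ [set e : R | 0 < e] P _ (propa cB).
- exists r => // g [gr _]; exists (a g y); split; last by apply: rB; rewrite /= metric_sym.
  by exists y => //; exact: nbhs_singleton.
- exists (Num.min e e'); first by rewrite /= lt_min e0.
  by move=> g []; rewrite lt_min => /andP[? ?] ?; split; split.
- apply: contrapT => h; apply: ne; exists e => // g ge.
  by apply: contrapT => ng; apply: h; exists g.
have qy : a q y = y.
  apply: mdist_positivity; apply: (pm_eq0_le pm) => e e0.
  have e2 : 0 < e / 2 by rewrite divr_gt0.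
  have [g [[gy _] qg]] := cq _ e2 _ (@orbit_continuous y q _ (nbhs_mdist_lt _ e2)).
  by have := metric_triangle (a q y) (a g y) y; move: gy qg => /=; lra.
have [g [[_ ng] Vg]] := cq _ ltr01 _ (nbhs_lcoset q Vn).
by apply: ng; exists q.
Qed.

(** The stabilizer of a point is compact but not known to be open. A first pass, on cosets meeting
    the stabilizer of [y], conjugates [Gam] into one compact open subgroup [V0]. This conjugate
    preserves [V0] itself, so a second pass, on cosets in [V0], works for every smaller subgroup
    [V]. *)
Lemma displaced Gam (S : seq G) : simple_subgroup Gam -> infinite_set Gam ->
  Gam = smallest subgroup [set` S] ->
  exists2 e : R, 0 < e & forall x, exists2 s, s \in S & e <= mdist (a s x) x.
Proof.
move=> simG infG GamE; apply: contrapT => ne.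
have [sG _ _] := simG.
have [C cC hC] := compact_fundamental.
(* Conjugation moves the points of small displacement into the compact set [C], where they cluster
   at [y]. *)
have [y hy] : exists y, forall e : R, 0 < e -> exists g : G, forall s, s \in S ->
    mdist (a (g * s * g^-1)%g y) y < e.
  pose P e := [set y | C y /\ exists g, forall s, s \in S ->
    mdist (a (g * s * g^-1)%g y) y < e].
  have [|e e' e0 e'0|e e0|y [_ cy]] := @compact_directed _ _ [set e : R | 0 < e] P C cC.
  - by exists 1 => //= y [].
  - exists (Num.min e e'); first by rewrite /= lt_min e0.
    move=> y [Cy [g hg]]; split; split=> //; exists g => s /hg;
      by rewrite lt_min => /andP[].
  - apply: contrapT => h; apply: ne; exists e => // x.
    apply: contrapT => ns; apply: h; have [g Cgx] := hC x.
    exists (a g x); split=> //; exists g => s sS.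
    rewrite !actM actK isoa ltNge; apply/negP => es; apply: ns; by exists s.
  exists y => e e0; have e3 : 0 < e / 3 by rewrite divr_gt0.
  have [z [[_ [g hg]] zy]] := cy _ e3 _ (nbhs_mdist_lt y e3).
  exists g => s /hg; set k := (g * s * g^-1)%g => h.
  have := pm_tri4 pm (a k y) (a k z) z y; rewrite isoa (metric_sym z y).
  by move: zy h => /=; lra.
have [K cK Kn] := compact_nbhs1.
have [V0 [sV0 V0n cV0] _] := compact_open_subgroup_basis td Kn cK Kn.
pose Q := [set q | a q y = y].
have cQ : compact Q.
  rewrite (_ : Q = [set g | (a g @` [set y]) `&` [set y] !=set0]).
    by apply: propa; exact: compact_set1.
  apply/seteqP; split=> q /= h; first by exists y; split=> //; exists y.
  by case: h => z [[_ -> yz] zy]; rewrite /Q /= yz.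
have [g0 hg0] : exists g : G, forall gam, Gam gam -> V0 (g * gam * g^-1)%g.
  have [e e0 he] := near_stabilizer y V0n.
  have [g hg] := hy e e0; exists g.
  pose L := [set z | Q (g * z)%g].
  have cL : compact L by have := compact_lcoset (x := g^-1%g) cQ; rewrite invgK.
  have Lg : L g^-1%g by rewrite /L /= mulgV; exact: act1.
  (* [gam] maps [L] into the union of the cosets [z V0] with [z] in [L]. For generators this is
     [near_stabilizer], and it passes to products. *)
  pose stab gam := forall x, L x -> exists2 z, L z & V0 (z^-1 * (gam * x))%g.
  have near gam : mdist (a (g * gam * g^-1)%g y) y < e -> stab gam.
    move=> h x Lx; have [|q Qq Vq] := he (g * gam * g^-1 * (g * x))%g.
      by rewrite actM Lx.
    exists (g^-1 * q)%g; first by rewrite /L /= mulVKg.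
    by rewrite invgM invgK -mulgA; move: Vq; rewrite !mulgA mulgVK.
  have stabM g1 g2 : stab g1 -> stab g2 -> stab (g1 * g2)%g.
    move=> s1 s2 x /s2[z /s1[z' Lz' Vz'] Vz]; exists z' => //.
    by have := subgroupM sV0 Vz' Vz; rewrite !mulgA mulgK.
  have stabG : Gam `<=` [set gam | stab gam /\ stab gam^-1%g].
    rewrite GamE; apply: smallest_sub.
      have stab1 : stab 1%g.
        by move=> x Lx; exists x => //; rewrite mul1g mulVg; exact: sV0.1.
      split; first by rewrite /= invg1.
      move=> g1 g2 [s1 s1'] [s2 s2']; split; first exact: stabM.
      by rewrite invgM invgK; exact: stabM.
    move=> s /= sS; split; apply: near; first exact: hg.
    rewrite (_ : g * s^-1 * g^-1 = (g * s * g^-1)^-1)%g; last first.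
      by rewrite !invgM invgK mulgA.
    rewrite -(isoa (g * s * g^-1)%g) actKV metric_sym; exact: hg.
  move=> gam Gg; have := compact_orbit_fixed simG infG cL sV0 V0n _ Gg Lg.
  by rewrite invgK mulgA; apply=> h x /stabG[+ _]; exact.
have [gam Gg ngam] : exists2 gam, Gam gam & gam <> 1%g.
  apply: contrapT => h; have [_ + _] := simG; apply; apply/seteqP; split=> gam.
    by move=> Gg; apply: contrapT => ?; apply: h; exists gam.
  by move=> ->; exact: sG.1.
apply: ngam; suff e : (g0 * gam * g0^-1 = 1)%g.
  by rewrite -(mulKg g0 gam) -(mulgVK g0 (g0 * gam)%g) e mul1g mulVg.
apply: (totally_disconnected_separated td) => U Un.
have [V [sV Vn cV] VU] := compact_open_subgroup_basis td Kn cK Un.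
apply: VU.
pose L := [set z | V0 (g0 * z)%g].
have cL : compact L by have := compact_lcoset (x := g0^-1%g) cV0; rewrite invgK.
have Lg : L g0^-1%g by rewrite /L /= mulgV; exact: sV0.1.
have := compact_orbit_fixed simG infG cL sV Vn _ Gg Lg.
rewrite invgK mulgA; apply=> h x Gh Lx; exists (h * x)%g.
  have := subgroupM sV0 (hg0 h Gh) Lx; rewrite /L /=.
  by rewrite !mulgA mulgVK.
by rewrite mulVg; exact: sV.1.
Qed.

End Cocompact.

(** * CAT(0) spaces *)

Section ComparisonTriangles.
Context {R : realType}.

Lemma edist_sqr (u v : 'rV[R]_2) :
  Defs.edist u v ^+ 2 = (u 0 0 - v 0 0) ^+ 2 + (u 0 1 - v 0 1) ^+ 2.
Proof.
rewrite /Defs.edist sqr_sqrtr.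
  by rewrite !big_ord_recl big_ord0 addr0 (_ : lift ord0 ord0 = 1) //; exact: val_inj.
by apply: sumr_ge0 => i _; exact: sqr_ge0.
Qed.

Lemma edist_ge0 (u v : 'rV[R]_2) : 0 <= Defs.edist u v.
Proof. exact: sqrtr_ge0. Qed.

Lemma edist_sym (u v : 'rV[R]_2) : Defs.edist u v = Defs.edist v u.
Proof.
rewrite /Defs.edist; congr Num.sqrt; apply: eq_bigr => i _.
by rewrite -sqrrN opprB.
Qed.

Lemma edistxx (u : 'rV[R]_2) : Defs.edist u u = 0.
Proof.
by rewrite /Defs.edist big1 ?sqrtr0 // => i _; rewrite subrr expr0n.
Qed.

Lemma edist_eq (u v : 'rV[R]_2) c : 0 <= c -> Defs.edist u v ^+ 2 = c ^+ 2 -> Defs.edist u v = c.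
Proof. by move=> c0 e; rewrite -(ger0_norm c0) -sqrtr_sqr -e sqrtr_sqr ger0_norm ?edist_ge0. Qed.

Lemma stewart (u v w : 'rV[R]_2) t :
  Defs.edist w ((1 - t) *: u + t *: v) ^+ 2 =
  (1 - t) * Defs.edist w u ^+ 2 + t * Defs.edist w v ^+ 2 - t * (1 - t) * Defs.edist u v ^+ 2.
Proof. by rewrite !edist_sqr !mxE; ring. Qed.

Lemma comparison_triangle (D p q : R) : 0 <= D -> 0 <= p -> 0 <= q ->
  D <= p + q -> p <= D + q -> q <= D + p ->
  exists u v w : 'rV[R]_2, [/\ Defs.edist u v = D, Defs.edist u w = p & Defs.edist v w = q].
Proof.
move=> D0 p0 q0 h1 h2 h3.
pose vec (a b : R) : 'rV[R]_2 := \row_(i < 2) (if i == 0 then a else b).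
have vecE a b a' b' : Defs.edist (vec a b) (vec a' b') ^+ 2 = (a - a') ^+ 2 + (b - b') ^+ 2.
  by rewrite edist_sqr !mxE.
have [D00|Dn0] := eqVneq D 0.
  have pq : p = q by lra.
  exists (vec 0 0), (vec 0 0), (vec p 0); split; apply: edist_eq; rewrite ?vecE //;
    rewrite ?D00 ?pq; ring.
have Dp : 0 < D by rewrite lt_def Dn0.
pose a := (p ^+ 2 + D ^+ 2 - q ^+ 2) / (2 * D).
have aD : 2 * a * D = p ^+ 2 + D ^+ 2 - q ^+ 2 by rewrite /a; field.
have ap : a ^+ 2 <= p ^+ 2.
  have ap1 : a <= p.
    rewrite -(ler_pM2r Dp) -(ler_pM2l (ltr0n R 2)) mulrA aD.
    have : (D - p) ^+ 2 <= q ^+ 2.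
      rewrite -(real_normK (num_real (D - p))) ler_pXn2r ?nnegrE //.
      by rewrite ler_norml; apply/andP; split; lra.
    lra.
  have ap2 : - p <= a.
    rewrite -(ler_pM2r Dp) -(ler_pM2l (ltr0n R 2)) [2 * (a * D)]mulrA aD.
    have : q ^+ 2 <= (D + p) ^+ 2 by rewrite ler_pXn2r ?nnegrE ?addr_ge0.
    lra.
  rewrite -(real_normK (num_real a)) ler_pXn2r ?nnegrE //.
  by rewrite ler_norml ap2.
exists (vec 0 0), (vec D 0), (vec a (Num.sqrt (p ^+ 2 - a ^+ 2))).
have s : Num.sqrt (p ^+ 2 - a ^+ 2) ^+ 2 = p ^+ 2 - a ^+ 2 by rewrite sqr_sqrtr ?subr_ge0.
split; apply: edist_eq; rewrite // vecE.
- ring.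
- by rewrite !sub0r !sqrrN s; ring.
- by rewrite sub0r sqrrN s; move: aD; rewrite sqrrB => ?; lra.
Qed.

End ComparisonTriangles.

Section CAT0Hadamard.
Context {R : realType} {X : completeMetricType R}.
Local Notation d := (@mdist R X).

Lemma mdist_complete (u : nat -> X) : cauchy_seq d u -> exists y, converges_to d u y.
Proof.
move=> cu; have cv : cvg (u @ \oo).
  apply: cauchy_cvg; apply: cauchy_exP => e e0; have [N hN] := cu e e0.
  by exists (u N); exists N => // n /= Nn; rewrite ballEmdist; exact: hN.
exists (lim (u @ \oo)) => e e0; have [N _ hN] := cv _ (nbhs_mdist_lt (lim (u @ \oo)) e0).
by exists N => n Nn; rewrite metric_sym; exact: hN.
Qed.

Hypothesis cat0 : CAT0_space X.

(** The comparison inequality for a point of the side from [x] to [y] and the opposite vertex,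
    evaluated by Stewart's theorem. The vertex [z] enters as the initial point of the side with
    index [i2]. *)
Lemma cat0_cn (x y : X) t : 0 <= t <= 1 -> exists p, forall z,
  d z p ^+ 2 <= (1 - t) * d z x ^+ 2 + t * d z y ^+ 2 - t * (1 - t) * d x y ^+ 2.
Proof.
move=> t01; have /andP[t0 t1] := t01; have [geod cmp] := cat0.
have [Sxy sxy] := geod x y; have [c [cx cy ciso SE]] := sxy.
have D0 : 0 <= d x y by exact: mdist_ge0.
have tD : t * d x y \in `[0, d x y]%R.
  by rewrite in_itv /= mulr_ge0 //= ler_piMl.
exists (c (t * d x y)) => z.
have [Syz syz] := geod y z; have [Szx szx] := geod z x.
have [A [B [Z [AB AZ BZ]]]] : exists A B Z : 'rV[R]_2,
    [/\ Defs.edist A B = d x y, Defs.edist A Z = d x z & Defs.edist B Z = d y z].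
  apply: comparison_triangle; rewrite ?mdist_ge0 ?metric_triangle //.
    by rewrite (metric_sym y z) metric_triangle.
  by rewrite (metric_sym x y) metric_triangle.
pose v (i : 'I_3) := nth x [:: x; y; z] i.
pose S (i : 'I_3) := nth Sxy [:: Sxy; Syz; Szx] i.
pose v' (i : 'I_3) := nth A [:: A; B; Z] i.
pose i0 : 'I_3 := Ordinal (isT : 0 < 3)%N; pose i2 : 'I_3 := Ordinal (isT : 2 < 3)%N.
have h1 i : geodesic_segment (v i) (v (ordS i)) (S i).
  by case: i => [[|[|[|//]]]] ?; rewrite /v /S.
have h2 i j : Defs.edist (v' i) (v' j) = d (v i) (v j).
  case: i => [[|[|[|//]]]] ?; case: j => [[|[|[|//]]]] ?; rewrite /v /v' /=
    ?edistxx ?mdistxx //; by rewrite edist_sym metric_sym.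
have le : d (c (t * d x y)) z <= Defs.edist ((1 - t) *: A + t *: B) Z.
  apply: (cmp v S v' h1 h2 i0 i2).
  - by rewrite /S /= SE; exists (t * d x y).
  - rewrite /S /=; have [c' [cz _ _ ->]] := szx.
    by exists 0; rewrite //= in_itv /= lexx mdist_ge0.
  - split; first by exists t; rewrite // in_itv /= t0.
    have dxp : d x (c (t * d x y)) = t * d x y.
      rewrite -{1}cx ciso ?in_itv /= ?lexx //.
      by rewrite sub0r normrN ger0_norm ?mulr_ge0.
    rewrite /v /v' /= dxp; apply: edist_eq; first exact: mulr_ge0.
    by rewrite stewart edistxx AB; ring.
  - split; last by rewrite /v /v' /= edistxx mdistxx.
    by exists 0; rewrite ?in_itv /= ?lexx ?ler01 // subr0 scale1r scale0r addr0.
rewrite metric_sym; apply: (@le_trans _ _ (Defs.edist ((1 - t) *: A + t *: B) Z ^+ 2)).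
  by rewrite ler_pXn2r ?nnegrE ?mdist_ge0 ?edist_ge0.
by rewrite edist_sym stewart AB !(edist_sym Z) AZ BZ !(metric_sym z).
Qed.

Lemma cat0_hadamard : hadamard d.
Proof. split; [exact: mdist_pseudometric|exact: cat0_cn|exact: mdist_complete]. Qed.

End CAT0Hadamard.

(** * Uniformly bounded geometry of cocompact spaces *)

Section BoundedGeometry.
Context {R : realType} {X : completeMetricType R}.
Local Notation d := (@mdist R X).

(** A colouring in place of a covering by small sets; the packing bound is then the pigeonhole
    principle. *)
Definition splits (r : R) (N : nat) (A : set X) := exists f : X -> 'I_N,
  forall x y, A x -> A y -> f x = f y -> d x y < r.

Lemma compact_splits (M : set X) r : compact M -> 0 < r ->
  exists N, forall A, A `<=` M -> splits r N A.
Proof.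
rewrite compact_cover => cM r0; have r20 : 0 < r / 2 by rewrite divr_gt0.
have [||D' _ hD'] := cM X M (fun x => interior (ball x (r / 2))).
- by move=> x _; exact: open_interior.
- by move=> x Mx; exists x => //; exact: nbhsx_ballx.
pose s : seq X := finmap.enum_fset D'.
(* Points outside all balls get the index [size s], hence one extra colour. *)
pose f x := find (fun y => `[< ball y (r / 2) x >]) s.
have fs x : (f x < (size s).+1)%N by rewrite ltnS; exact: find_size.
exists (size s).+1 => A AM; exists (fun x => Ordinal (fs x)) => x y Ax Ay [fxy].
have near z : A z -> ball (nth point s (f z)) (r / 2) z.
  move=> /AM/hD'[w /= wD wz]; apply/asboolP.
  apply: (@nth_find _ _ (fun y => `[< ball y (r / 2) z >])).
  by apply/hasP; exists w => //; apply/asboolP; exact: interior_subset.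
have := near x Ax; have := near y Ay; rewrite fxy !ballEmdist /= => h1 h2.
have := metric_triangle x (nth point s (f y)) y.
by rewrite (metric_sym x (nth _ _ _)); move: h1 h2; lra.
Qed.

Lemma splits_refine r r' N A : (forall B, B `<=` A ->
    (forall x y, B x -> B y -> d x y < r) -> splits r' N B) ->
  forall M, splits r M A -> splits r' (M * N) A.
Proof.
move=> h M [f hf].
have /choice[g hg] i : exists g : X -> 'I_N, forall x y, A x -> A y -> f x = i -> f y = i ->
    g x = g y -> d x y < r'.
  have [|x y [Ax fx] [Ay fy]|g hg] := h [set x | A x /\ f x = i].
  - by move=> x [].
  - by apply: hf => //; rewrite fx.
  - by exists g => x y Ax Ay fx fy; exact: hg.
exists (fun x => mxvec_index (f x) (g (f x) x)) => x y Ax Ay.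
move=> /cast_ord_inj/enum_rank_inj[fe ge].
by apply: (hg (f x)) => //; rewrite ge fe.
Qed.

Hypothesis cat0 : CAT0_space X.
Let hd := cat0_hadamard cat0.
Variables (G : topologicalGroupType) (a : group_action G X).
Hypotheses (lcX : locally_compact [set: X]) (ctsa : continuous_action a)
  (isoa : isometric_action a) (cca : cocompact_action a).

(** The group moves any set of small diameter into one compact neighbourhood [M] of [C], so the
    number of colours does not depend on the position of the set. *)
Lemma small_splits : exists2 e0 : R, 0 < e0 & forall r, 0 < r -> exists N,
  forall A, (forall x y, A x -> A y -> d x y < e0) -> splits r N A.
Proof.
have [C cC hC] := compact_fundamental lcX ctsa cca.
have /choice[B hB] : forall x : X, exists B : set X, compact B /\ nbhs x B.
  by move=> x; have [B] := compact_nbhs lcX x; exists B.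
have := cC; rewrite compact_cover => /(_ X C (fun x => interior (B x)))[||D' _ hD'].
- by move=> x _; exact: open_interior.
- by move=> x Cx; exists x => //; exact: (hB x).2.
pose M := \big[setU/set0]_(x <- finmap.enum_fset D') B x.
have cM : compact M by apply: bigsetU_compact => x _; exact: (hB x).1.
have [e0 e0p hM] : exists2 e0 : R, 0 < e0 & forall x z, C x -> d x z < e0 -> M z.
  apply: contrapT => ne.
  pose P (e : R) := [set x | C x /\ exists2 z, d x z < e & ~ M z].
  have [|e e' e0 e'0|e e0|x [Cx cx]] := @compact_directed _ _ [set e : R | 0 < e] P C cC.
  - by exists 1 => //= x [].
  - exists (Num.min e e'); first by rewrite /= lt_min e0.
    by move=> x [Cx [z]]; rewrite lt_min => /andP[? ?] ?; split; split=> //; exists z.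
  - apply: contrapT => h; apply: ne; exists e => // x z Cx xz.
    by apply: contrapT => nM; apply: h; exists x; split=> //; exists z.
  have [w wD wx] := hD' x Cx.
  have /metricType_numDomainType.nbhs_mdistP[r /= r0 rB] : nbhs x (B w) by exact: wx.
  have r20 : 0 < r / 2 by rewrite divr_gt0.
  have [y [[_ [z yz nM]] xy]] := cx _ r20 _ (nbhs_mdist_lt x r20).
  apply: nM; rewrite /M -bigcup_seq; exists w => //; apply: rB => /=.
  by have := metric_triangle x y z; move: yz xy => /=; lra.
exists e0 => // r r0; have [N hN] := compact_splits cM r0.
(* The extra colour serves as a value when [A] is empty and [N] may be 0. *)
exists N.+1 => A hA; have [[x Ax]|nA] := pselect (A !=set0); last first.
  by exists (fun=> ord0) => x y Ax; case: nA; exists x.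
have [g Cgx] := hC x.
have [f hf] : splits r N [set a g z | z in A].
  by apply: hN => _ [z Az <-]; apply: hM Cgx _; rewrite isoa; exact: hA.
exists (fun z => widen_ord (leqnSn N) (f (a g z))) => y z Ay Az /(congr1 val) /= e.
by rewrite -(isoa g); apply: hf; [exists y|exists z|exact: val_inj].
Qed.

(** Cocompactness controls sets of small diameter only. A larger set is contracted towards one of
    its points [x0] by the factor [n / (n + 1)]: the diameter bound drops from [n + 1] to [n] units
    of [del], and each point moves by at most [del]. *)
Lemma cat0_bounded_geometry : uniformly_bounded_geometry d.
Proof.
have [e0 e0p small] := small_splits.
(* Points whose contractions are closer than [del] are themselves less than [3 * del < e0] apart. *)
pose del := e0 / 4; have del0 : 0 < del by rewrite divr_gt0.
have cov n : forall r, 0 < r -> exists N, forall A,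
    (forall x y, A x -> A y -> d x y <= n%:R * del) -> splits r N A.
  elim: n => [|n ih] r r0.
    exists 1%N => A hA; exists (fun=> ord0) => x y Ax Ay _.
    by apply: le_lt_trans (hA x y Ax Ay) _; rewrite mul0r.
  have [M hM] := ih del del0; have [N hN] := small r r0.
  exists (M.+1 * N)%N => A hA; apply: (@splits_refine e0).
    by move=> B _ hB; exact: hN.
  have [[x0 Ax0]|nA] := pselect (A !=set0); last first.
    by exists (fun=> ord0) => x y Ax; case: nA; exists x.
  pose t : R := n%:R / n.+1%:R.
  have n1 : 0 < n.+1%:R :> R by rewrite ltr0n.
  have t01 : 0 <= t <= 1.
    by rewrite divr_ge0 ?ler0n //= ler_pdivrMr // mul1r ler_nat.
  have tn : t * (n.+1%:R * del) = n%:R * del by rewrite mulrA divfK // gt_eqF.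
  have t1n : (1 - t) * (n.+1%:R * del) = del.
    by rewrite mulrBl mul1r tn -[n.+1]addn1 natrD; ring.
  have [f hf] : splits del M [set geo hd x0 x t | x in A].
    apply: hM => _ _ [x Ax <-] [y Ay <-]; apply: le_trans (geo_dist_common hd _ _ _ t01) _.
    by rewrite -tn ler_wpM2l ?hA //; case/andP: t01.
  exists (fun x => widen_ord (leqnSn M) (f (geo hd x0 x t))) => x y Ax Ay /(congr1 val) /= e.
  have h : d (geo hd x0 x t) (geo hd x0 y t) < del.
    by apply: hf; [exists x|exists y|exact: val_inj].
  have far z : A z -> d (geo hd x0 z t) z <= del.
    move=> Az; rewrite geo_r // -t1n ler_wpM2l ?hA // subr_ge0.
    by case/andP: t01.
  have := pm_tri4 mdist_pseudometric x (geo hd x0 x t) (geo hd x0 y t) y.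
  have := far y Ay; have := far x Ax; rewrite (metric_sym _ x) => h1 h2 h3.
  have e4 : 4 * del = e0 by rewrite /del; field.
  lra.
move=> rho r r0.
have [N hN] := cov (Num.truncn (rho / del)).+1 r r0.
exists N.+1 => p hp.
have [|f hf] := hN (p @` [set i | (i < N.+1)%N]).
  move=> _ _ [i iN <-] [j jN <-]; apply: le_trans (hp i j iN jN) _.
  by rewrite -ler_pdivrMr //; apply/ltW; exact: truncnS_gt.
have : ~ injective (fun i : 'I_N.+1 => f (p i)).
  by move=> /leq_card; rewrite !card_ord ltnn.
move=> ninj; apply: contrapT => nex; apply: ninj => i j fij; apply: contrapT => nij.
have [ij|ji|/val_inj//] := ltngtP i j; apply: nex.
  exists (val i), (val j); split; [exact: ij|exact: ltn_ord|].
  by apply: hf fij; [exists (val i)|exists (val j)]; rewrite //=; exact: ltn_ord.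
exists (val j), (val i); split; [exact: ji|exact: ltn_ord|].
by apply: hf (esym fij); [exists (val j)|exists (val i)]; rewrite //=; exact: ltn_ord.
Qed.

End BoundedGeometry.

Theorem corollary1p2 (R : realType) (X : completeMetricType R)
    (G : topologicalGroupType) (a : group_action G X) (Gamma : set G) :
  CAT0_space X ->
  locally_compact [set: X] ->
  totally_disconnected [set: G] ->
  continuous_action a ->
  isometric_action a ->
  proper_action a ->
  cocompact_action a ->
  finitely_generated Gamma ->
  simple_subgroup Gamma ->
  (exists2 H : set G, amenable_subgroup R H & Gamma `<=` H) ->
  finite_set Gamma.
Proof.
move=> cat0 lcX td ctsa isoa propa cca fgG simG [H amenH GH].
apply: contrapT => infG.
have [B /finite_seqP[S BS] GamE] := fgG; rewrite BS in GamE.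
have [eps eps0 disp] := displaced lcX ctsa isoa propa cca td simG infG GamE.
have SG s : s \in S -> Gamma s by move=> sS; rewrite GamE => K [_]; apply.
have sH : subgroup H := amenH.1.
apply: (@no_hspace R G H Gamma S (nbhs 1%g) eps _ X (@mdist R X)) => //.
- exact: sH.1.
- by move=> h; exact: subgroupV.
- by move=> g h; exact: subgroupM.
- by move=> c cM; exact: simple_character_trivial simG cM.
- exact: mdist_pseudometric.
- exact: (cat0_bounded_geometry cat0 lcX ctsa isoa cca).
- move=> k Y d act y0 hY; exact: (amenable_horo_hull amenH y0 hY).
- by move=> m rho rho1 rhoM; exact: (simple_linear_trivial simG fgG infG rho1 rhoM).
exists X, (@mdist R X), a; split; first exact: (inhabits point).
split.
- exact: cat0_hadamard.
- split=> [h x y _|x|g h x _ _|x e e0].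
  + exact: isoa.
  + by rewrite act1 mdistxx.
  + by rewrite actM mdistxx.
  + have : nbhs 1%g [set h | mdist x (a h x) < e].
      apply: (@orbit_continuous R X G a ctsa x 1%g [set y | mdist x y < e]).
      by rewrite act1; exact: nbhs_mdist_lt.
    by apply: filterS => h /=; rewrite metric_sym.
- move=> n y v e e0; exists y => i j _ _.
  by rewrite /sqnorm_diff big_ord0 addr0 subrr normr0 ltW.
- exact: disp.
Qed.
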